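(* Let $R$ be a commutative ring, let $d\ge 1$ and $l\geq 1$ be integers, let $f(x)=x^l+c_1x^{l-1}+\cdots+c_l\in R[x]$ be a monic polynomial of degree $l$, and let $H_d^f$ be the associated degenerate cyclotomic Hecke algebra. Then the center $Z(H_d^f)$ of $H_d^f$ consists of all symmetric polynomials in $x_1,\dots,x_d$. Moreover, $Z(H_d^f)$ is free as an $R$-module with an explicit basis parametrized by all $l$-multipartitions of $d$.
   Context: The degenerate affine Hecke algebra $H_d$ is the $R$-algebra which equals $R[x_1,\dots,x_d]\otimes_R RS_d$ as an $R$-module, where $R[x_1,\dots,x_d]$ is the polynomial algebra and $RS_d$ is the group algebra of the symmetric group $S_d$, with multiplication defined so that $R[x_1,\dots,x_d]$ (identified with $R[x_1,\dots,x_d]\otimes 1$) and $RS_d$ (identified with $1\otimes RS_d$) are subalgebras and, in addition, $s_ix_{i+1}=x_is_i+1$ and $s_ix_j=x_js_i$ for $j\neq i,i+1$, where $s_i$ denotes the basic transposition $(i\ i{+}1)\in S_d$. The degenerate cyclotomic Hecke algebra $H_d^f$ is the quotient of $H_d$ by the two-sided ideal generated by $f(x_1)$; the canonical images of $x_1,\dots,x_d$ in $H_d^f$ are denoted by the same symbols, and ''symmetric polynomials in $x_1,\dots,x_d$'' (with coefficients in $R$) refers to these elements of $H_d^f$, which need not be algebraically independent. For a partition $\lambda=(\lambda_1\geq\lambda_2\geq\cdots)$ write $|\lambda|=\lambda_1+\lambda_2+\cdots$. An $l$-multipartition of $d$ is an $l$-tuple $(\lambda^{(1)},\dots,\lambda^{(l)})$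 of partitions with $|\lambda^{(1)}|+\cdots+|\lambda^{(l)}|=d$. *)

(* Defs.v *)
From HB Require Import structures.
From mathcomp Require Import all_boot all_order all_fingroup all_algebra.
From mathcomp Require Import mpoly.

Set Implicit Arguments.
Unset Strict Implicit.
Unset Printing Implicit Defensive.

Import GRing.Theory.
Local Open Scope ring_scope.

(* The degenerate affine Hecke algebra, as an R-algebra in which R[x_1..x_d]
   and R S_d embed as subalgebras, the product map
   R[x_1..x_d] (x) R S_d -> H_d is an isomorphism of R-modules (an element
   \sum_w p_w (x) w of the tensor product being the finite function w |-> p_w),
   and the two mixed relations hold.  Indices are shifted: x_(i+1) is 'X_i for
   i : 'I_d.  In MathComp (u * v)%g is "u, then v"; with the other convention
   the algebra is the same up to w |-> w^-1, which fixes every s_i. *)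
Record degAffHecke (R : comNzRingType) (d : nat) := DegAffHecke {
  dah_alg :> algType R;
  dah_poly : {lrmorphism {mpoly R[d]} -> dah_alg};
  dah_perm : 'S_d -> dah_alg;
  dah_perm1 : dah_perm 1%g = 1;
  dah_permM : forall u v : 'S_d,
    dah_perm (u * v)%g = dah_perm u * dah_perm v;
  dah_tensor : bijective (fun p : {ffun 'S_d -> {mpoly R[d]}} =>
    \sum_(w : 'S_d) dah_poly (p w) * dah_perm w);
  dah_sx_next : forall i k : 'I_d, k = i.+1 :> nat ->
    dah_perm (tperm i k) * dah_poly 'X_k
      = dah_poly 'X_i * dah_perm (tperm i k) + 1;
  dah_sx_far : forall i k j : 'I_d, k = i.+1 :> nat -> j != i -> j != k ->
    dah_perm (tperm i k) * dah_poly 'X_j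
      = dah_poly 'X_j * dah_perm (tperm i k)
}.

Definition in_ideal_gen (A : nzRingType) (a h : A) : Prop :=
  exists s : seq (A * A), h = \sum_(q <- s) q.1 * a * q.2.

(* The quotient of H_d by the two-sided ideal generated by f(x_1). *)
Record degCycHecke (R : comNzRingType) (d : nat) (d_gt0 : (0 < d)%N)
    (f : {poly R}) (H : degAffHecke R d) := DegCycHecke {
  dch_alg :> algType R;
  dch_proj : {lrmorphism H -> dch_alg};
  dch_proj_surj : forall y : dch_alg, exists h : H, dch_proj h = y;
  dch_proj_ker : forall h : H, dch_proj h = 0 <->
    in_ideal_gen (horner_alg (dah_poly H 'X_(Ordinal d_gt0)) f) h
}.

(* p(x_1, ..., x_d) computed in H_d^f *)
Definition dch_poly (R : comNzRingType) (d : nat) (d_gt0 : (0 < d)%N)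
    (f : {poly R}) (H : degAffHecke R d) (Hf : degCycHecke d_gt0 f H)
    (p : {mpoly R[d]}) : Hf :=
  dch_proj Hf (dah_poly H p).

Definition in_center (A : nzRingType) (z : A) : Prop :=
  forall y : A, z * y = y * z.

(* b is a basis of the R-submodule M of V *)
Definition is_basis_of (R : nzRingType) (V : lmodType R) (M : V -> Prop)
    (I : finType) (b : I -> V) : Prop :=
  (forall v : V, M v <-> exists c : I -> R, v = \sum_i c i *: b i) /\
  (forall c : I -> R, \sum_i c i *: b i = 0 -> forall i, c i = 0).

(* All parts of a partition of size at most d, and their number, are at most d,
   so such a partition is a weakly decreasing d-tuple over {0, ..., d}, padded
   with zeros. *)
Definition is_multipartition (l d : nat) (la : l.-tuple (d.-tuple 'I_d.+1)) :=
  [forall r : 'I_l, sorted geq [seq val a | a <- tnth la r]] &&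
  (\sum_(r < l) \sum_(a <- tnth la r) val a == d)%N.

Record multipartition (l d : nat) := Multipartition {
  mp_val :> l.-tuple (d.-tuple 'I_d.+1);
  _ : is_multipartition mp_val
}.

HB.instance Definition _ l d := [isSub for @mp_val l d].
HB.instance Definition _ l d := [Finite of multipartition l d by <:].

(* A nonzero part a of the (r+1)-st component contributes the exponent
   (a - 1) l + r.  There are at most d of these.  Modulo terms of lower degree
   and permutations moving fewer points, the power sum of exponent
   (a - 1) l + r is the sum over all a-cycles (i_1 ... i_a) of
   h_((a - 1)(l - 1) + r)(x_(i_1), ..., x_(i_a)) (i_1 ... i_a). *)
Definition mp_exponents (l d : nat) (la : multipartition l d) : seq nat :=
  flatten [seq [seq ((val a).-1 * l + val r)%N
                 | a <- tnth la r & (0 < val a)%N] | r : 'I_l].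

(* The monomial symmetric polynomial m_mu(x_1, ..., x_d) with size mu <= d:
   the sum of the distinct monomials whose exponents rearrange mu. *)
Definition monomial_sym (R : comNzRingType) (d : nat) (mu : seq nat) :
    {mpoly R[d]} :=
  \sum_(m <- undup [seq [multinom nth 0%N mu (w i) | i < d] | w : 'S_d])
    'X_[m].

(* Main.v *)
Require Import Defs.
From HB Require Import structures.
From mathcomp Require Import all_boot all_order all_fingroup all_algebra.
From mathcomp Require Import mpoly.
From mathcomp Require Import zify.

(** Put y_i = x_i - \sum_(j < i) (j i).  In terms of the y_i the algebra H_d has
    S_d-symmetric relations: w y_i = y_(w i) w, [y_i, y_j] = (i j)(y_i - y_j), and
    H_d^f is the quotient by the elements f(y_i).  Comparing leading terms, the
    elements y^a w with all a_i < l form a basis of H_d^f.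

    Filter by the degree in the y_i.  The leading coefficients of a central z
    satisfy (y_i - y_(w i)) z_w = 0 in R[y_1, ..., y_d]/(y_i^l); moving one unit of
    exponent at a time along the cycles of w shows that some leading coefficient
    is nonzero at a "standard" pair (w, b): b_i = l - 1 except where i is the
    largest point of its cycle.  A cycle of length a whose largest point has
    exponent r gets the label (a - 1) l + r; standard pairs with the same labels
    are conjugate, and the multisets of labels are the multipartitions.  So a
    central element is determined by one coefficient for each multipartition.

    To find these coefficients for the monomial symmetric polynomials, expand
    x_i = y_i + \sum_(j < i) (j i) and count a transposition like a letter y_i.
    Among the words of minimal length that contribute to the standard pair (w, b),
    all transpositions lie inside the cycles of w, and the number of letters that
    come from x_i with i in a given cycle is the label of this cycle.  This makes
    the matrix of coefficients unitriangular, which gives both that the monomial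
    symmetric polynomials span the center and that they are independent. *)

(** The obstacle is that the [y_i] do not commute: exchanging two letters costs two words with one
    letter less and one transposition more. This trade keeps the number of letters plus
    transpositions, while reducing [y_i^l] loses letters. So at minimal total length a word reaches
    [y^b w] only through moves that waste nothing, and these can be followed cycle by cycle. Total
    degree alone does not give unitriangularity: with equal degrees, a monomial may still spread the
    label of a cycle over several of its points. This takes more distinct letters than using one
    point, so the number of nonzero exponents is the second criterion. As [R] is arbitrary, no rank
    count is used: spanning and independence both come from diagonal coefficients equal to 1. For
    the basis of [H_d^f], the [f(y_i)] behave like a Groebner basis with leading terms [x_i^l]. The
    first one is a polynomial in [x_1] and commutes with all [x_k]; by conjugation all commutators
    of the [f(y_i)] are of lower order, and [x_j^l f(y_i)] can be traded for [x_i^l f(y_j)].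
    Symmetric polynomials are central because the obstruction to commuting with [s_i] is a divided
    difference. *)

Set Implicit Arguments.
Unset Strict Implicit.
Unset Printing Implicit Defensive.

Import GRing.Theory.

(** * Words in transpositions *)

Section TranspositionWords.
Variable d : nat.
Implicit Types (w u : 'S_d) (i j : 'I_d) (t : seq ('I_d * 'I_d)).
Local Open Scope group_scope.

(** Reflection length: the least number of transpositions with product [w], by [reflen_tprod] and
    [reflen_factor]. *)
Definition reflen w : nat := (d - #|porbits w|)%N.

(** Pairs with equal entries give the identity; in the expansions below they stand for letters
    [y_i]. *)
Definition tprod t : 'S_d := \prod_(p <- t) tperm p.1 p.2.

Lemma tprod_nil : tprod [::] = 1.
Proof. by rewrite /tprod big_nil. Qed.

Lemma tprod_cons p t : tprod (p :: t) = tperm p.1 p.2 * tprod t.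
Proof. by rewrite /tprod big_cons. Qed.

Lemma tprod_cat t1 t2 : tprod (t1 ++ t2) = tprod t1 * tprod t2.
Proof. by rewrite /tprod big_cat. Qed.

Lemma card_porbits_le w : (#|porbits w| <= d)%N.
Proof. by rewrite (leq_trans (leq_imset_card _ _)) // cardT size_enum_ord. Qed.

Lemma porbit1 i : porbit 1 i = [set i].
Proof.
apply/setP=> j; rewrite inE; apply/porbitP/eqP => [[k ->]|->].
  by rewrite expg1n perm1.
by exists 0; rewrite perm1.
Qed.

Lemma reflen1 : reflen 1 = 0.
Proof.
rewrite /reflen /porbits card_imset ?card_ord ?subnn // => i j.
by rewrite !porbit1 => /set1_inj.
Qed.

Lemma reflen_tpermM w i j : i != j ->
  reflen (tperm i j * w) = if i \in porbit w j then (reflen w).-1 else (reflen w).+1.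
Proof.
move=> ij; have := porbits_mul_tperm w i j; rewrite /= ij /reflen.
have := card_porbits_le w; have := card_porbits_le (tperm i j * w).
case: (i \in _) => /=; rewrite ?addn0 ?add0n; move: #|_| #|_| => p q; lia.
Qed.

Lemma reflen_tpermM_in w i j : i != j -> i \in porbit w j ->
  (reflen (tperm i j * w)).+1 = reflen w.
Proof.
move=> ij wij; have := porbits_mul_tperm w i j; rewrite /= ij wij /reflen.
have := card_porbits_le w; have := card_porbits_le (tperm i j * w) => /=.
by rewrite addn0; move: #|_| #|_| => p q; lia.
Qed.

Lemma reflen_tprod t : (reflen (tprod t) <= size t)%N.
Proof.
elim: t => [|[i j] t IH]; first by rewrite tprod_nil reflen1.
rewrite tprod_cons /=; have [->|ij] := eqVneq i j.
  by rewrite tperm1 mul1g (leq_trans IH).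
by rewrite reflen_tpermM //; case: ifP => _; lia.
Qed.

(** Multiplying by [tperm i (w i)] for a moved point [i] splits its cycle and lowers the length by
    one. *)
Lemma reflen_factor w : exists2 t, tprod t = w & size t = reflen w.
Proof.
elim: {w}(reflen w) {-2}w (erefl (reflen w)) => [|n IH] w rw.
  exists [::] => //; rewrite tprod_nil; apply/permP=> i; rewrite perm1; apply/eqP/negPn/negP => wi.
  have: i \in porbit w (w i) by rewrite porbit_sym (mem_porbit _ 1).
  by move/(reflen_tpermM_in wi); rewrite rw.
have [i wi]: exists i, i != w i.
  apply/existsP; apply: contra_eqT rw; rewrite negb_exists => /forallP wK.
  suff -> : w = 1 by rewrite reflen1.
  by apply/permP=> i; rewrite perm1; have := wK i; rewrite negbK => /eqP <-.
have: i \in porbit w (w i) by rewrite porbit_sym (mem_porbit _ 1).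
move/(reflen_tpermM_in wi); rewrite rw => -[rE].
have [t tE st] := IH _ rE.
exists ((i, w i) :: t); last by rewrite /= st rE.
by rewrite tprod_cons tE /= mulgA tperm2 mul1g.
Qed.

Lemma tprod_conj u t :
  tprod [seq (u p.1, u p.2) | p <- t] = u^-1 * tprod t * u.
Proof.
elim: t => [|p t IH]; first by rewrite tprod_nil mulg1 mulVg.
rewrite /= !tprod_cons IH /= -tpermJ /conjg !mulgA.
by rewrite mulgK.
Qed.

(* Otherwise w multiplied by (i j) would have reflection length one more than t,
   although it is obtained by deleting a letter of t and conjugating others. *)
Lemma reduced_same_porbit t i j : size t = reflen (tprod t) ->
  (i, j) \in t -> i \in porbit (tprod t) j.
Proof.
move=> st ijt; case/splitPr: ijt st => t1 t2 st.
have [->|ij] := eqVneq i j; first exact: porbit_id.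
apply/negPn/negP => nij.
have := reflen_tpermM (tprod (t1 ++ (i, j) :: t2)) ij.
rewrite (negbTE nij) -st => rE.
have := reflen_tprod ([seq (tperm i j p.1, tperm i j p.2) | p <- t1] ++ t2).
rewrite tprod_cat tprod_conj tpermV.
rewrite (_ : _ * _ = tperm i j * tprod (t1 ++ (i, j) :: t2)); last first.
  by rewrite tprod_cat tprod_cons /= !mulgA.
rewrite rE !size_cat size_map /=; lia.
Qed.

Definition closed_on (S : {set 'I_d}) t := all (fun p => (p.1 \in S) == (p.2 \in S)) t.

Lemma reduced_closed t x : size t = reflen (tprod t) ->
  closed_on (porbit (tprod t) x) t.
Proof.
move=> st; apply/allP=> -[i j] ijt /=.
have := reduced_same_porbit st ijt; rewrite -eq_porbit_mem => /eqP ij.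
by rewrite ![_ \in porbit _ x]porbit_sym -!eq_porbit_mem !(eq_sym (porbit _ x)) -ij.
Qed.

Lemma tperm_closed (S : {set 'I_d}) i j k : (i \in S) = (j \in S) ->
  (tperm i j k \in S) = (k \in S).
Proof. by move=> ij; case: tpermP => [->|->|]. Qed.

Lemma tprod_closed (S : {set 'I_d}) t : closed_on S t ->
  forall k, (tprod t k \in S) = (k \in S).
Proof.
elim: t => [|p t IH] /=; first by move=> _ k; rewrite tprod_nil perm1.
by case/andP=> /eqP pS /IH tS k; rewrite tprod_cons permM tS tperm_closed.
Qed.

Lemma tprod_filter (S : {set 'I_d}) t : closed_on S t ->
  forall k, k \in S -> tprod [seq p <- t | p.1 \in S] k = tprod t k.
Proof.
elim: t => [|p t IH] //= /andP[/eqP pS /IH tS] k kS.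
case: ifP => p1; rewrite !tprod_cons !permM.
  by rewrite tS ?tperm_closed.
by rewrite tpermD ?tS //; apply: contraTneq kS => <-; rewrite -?pS p1.
Qed.

(** The letters inside [S] alone still have a product with [S] as one cycle. That product has at
    most [#|~: S| + 1] cycles, so its reflection length, hence the number of letters, is at least
    [#|S| - 1]. *)
Lemma card_closed_on (S : {set 'I_d}) t i : closed_on S t ->
  S = porbit (tprod t) i -> (#|S| <= (count (fun p => p.1 \in S) t).+1)%N.
Proof.
move=> tS SE; rewrite -size_filter; set t' := filter _ _.
have iS : i \in S by rewrite SE porbit_id.
have pS k : k \in S -> porbit (tprod t') k = S.
  have itS n : k \in S -> ((tprod t') ^+ n) k = ((tprod t) ^+ n) k /\ ((tprod t) ^+ n) k \in S.
    move=> kS; elim: n => [|n [IH1 IH2]]; first by rewrite !expg0 !perm1.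
    by rewrite !expgSr !permM IH1 tprod_filter // tprod_closed.
  move=> kS; have SE' : S = porbit (tprod t) k.
    by apply/eqP; rewrite SE eq_porbit_mem porbit_sym -SE.
  rewrite [RHS]SE'; apply/setP=> j; apply/porbitP/porbitP => -[n ->]; exists n;
  by have [] := itS n kS.
have : (#|porbits (tprod t')| <= (#|~: S|).+1)%N.
  have sub : porbits (tprod t') \subset S |: [set porbit (tprod t') k | k in ~: S].
    apply/subsetP=> _ /imsetP[k _ ->]; rewrite !inE.
    have [kS|kS] := boolP (k \in S); first by rewrite pS ?eqxx.
    by rewrite imset_f ?orbT // inE.
  apply: leq_trans (subset_leq_card sub) _.
  apply: leq_trans (leq_card_setU _ _) _; rewrite cards1 ltnS.
  exact: leq_imset_card.
have := reflen_tprod t'; rewrite /reflen; have := cardsC S; rewrite card_ord.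
by move: #|porbits _| #|S| #|~: S| (size t') => p q r s; lia.
Qed.

(** The relations of [H_d] mention only adjacent transpositions. A transposition over a larger
    distance is one of distance smaller by one, conjugated by an adjacent one. *)
Lemma adjacent_tperm_ind (P : 'S_d -> Prop) : P 1 ->
  (forall u w, P u -> P w -> P (u * w)) ->
  (forall i k : 'I_d, k = i.+1 :> nat -> P (tperm i k)) -> forall w, P w.
Proof.
move=> P1 PM Padj.
have Pt n : forall i j : 'I_d, (j = i + n.+1 :> nat)%N -> P (tperm i j).
  elim: n => [|n IH] i j ij; first by apply: Padj; rewrite ij addn1.
  have ltk : (i + n.+1 < d)%N by have := ltn_ord j; rewrite ij; lia.
  pose k := Ordinal ltk.
  have -> : tperm i j = tperm k j * tperm i k * tperm k j.
    have -> : tperm k j * tperm i k * tperm k j = tperm i k ^ tperm k j.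
      by rewrite /conjg tpermV mulgA.
    rewrite tpermJ tpermL tpermD //; apply/eqP => /(congr1 val) /=; lia.
  have Pkj : P (tperm k j) by apply: Padj; rewrite ij /= addnS.
  by apply: (PM _ _ (PM _ _ Pkj _) Pkj); apply: IH.
move=> w; have [ts -> _] := prod_tpermP w.
elim: ts => [|[i j] ts IH]; first by rewrite big_nil.
rewrite big_cons; apply: PM IH => /=.
have [ij|ij|ij] := ltngtP i j.
- by apply: (Pt (j - i.+1)); lia.
- by rewrite tpermC; apply: (Pt (i - j.+1)); lia.
- by rewrite (ord_inj ij) tperm1.
Qed.

End TranspositionWords.

Local Open Scope ring_scope.

(** * Coefficients in the basis of words *)

(** Sorting by adjacent exchanges, as a proof principle. *)
Lemma swap_perm_eq (T : eqType) (P : seq T -> Prop) :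
  (forall v1 i j v2, P (v1 ++ j :: i :: v2) -> P (v1 ++ i :: j :: v2)) ->
  forall v v', perm_eq v v' -> P v' -> P v.
Proof.
move=> Psw v v' vv'; rewrite -[v']cat0s -[v]cat0s.
elim: v [::] v' vv' => [|x v IH] p v' vv'.
  by move: vv'; rewrite perm_sym => /perm_nilP ->.
have xv' : x \in v' by rewrite -(perm_mem vv') mem_head.
case/splitPr: xv' vv' => v1 v2 vv' Pv.
rewrite -cat_rcons; apply: (IH _ (v1 ++ v2)).
  by move: vv'; rewrite perm_sym -cat1s perm_catCA perm_cons perm_sym.
rewrite cat_rcons; elim/last_ind: v1 v2 {vv'} Pv => [|v1 z IHv] v2 //=.
rewrite cat_rcons catA => /Psw; rewrite -catA => Pv; have := IHv _ Pv.
by rewrite cat_rcons.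
Qed.

Section Words.
Variables d l : nat.
Notation Box := {ffun 'I_d -> 'I_l}.
Implicit Types (v : seq 'I_d) (b : Box) (t : seq ('I_d * 'I_d)) (w : 'S_d).

(** The fixed increasing order of the letters matters, since the [y_i] do not commute. *)
Definition box_word b : seq 'I_d := flatten [seq nseq (b i) i | i <- enum 'I_d].

Lemma count_flatten_nseq (m : 'I_d -> nat) (p : pred 'I_d) :
  count p (flatten [seq nseq (m i) i | i <- enum 'I_d]) = (\sum_(i | p i) m i)%N.
Proof.
rewrite count_flatten -map_comp sumnE big_map big_enum /= [RHS]big_mkcond /=.
by apply: eq_bigr => i _; rewrite count_nseq; case: (p i); rewrite ?mul1n.
Qed.

Lemma count_box_word b (p : pred 'I_d) : count p (box_word b) = (\sum_(i | p i) b i)%N.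
Proof. exact: count_flatten_nseq. Qed.

Lemma count_mem_box_word b i : count_mem i (box_word b) = b i.
Proof. by rewrite count_box_word /= big_pred1_eq. Qed.

Lemma size_box_word b : size (box_word b) = (\sum_i b i)%N.
Proof. by rewrite -count_predT count_box_word. Qed.

Lemma perm_box_word v b : perm_eq v (box_word b) = [forall i, count_mem i v == b i].
Proof.
apply/idP/forallP => [/seq.permP vb i|vb]; first by rewrite vb count_mem_box_word.
by apply/allP=> i _ /=; rewrite count_mem_box_word vb.
Qed.

Lemma box_word_inj b b' : perm_eq (box_word b) (box_word b') = (b == b').
Proof.
rewrite perm_box_word; apply/forallP/eqP => [bb'|-> i]; last by rewrite count_mem_box_word.
by apply/ffunP=> i; apply: val_inj => /=; rewrite -(eqP (bb' i)) count_mem_box_word.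
Qed.

Lemma box_or_big v : (exists b, perm_eq v (box_word b)) \/
  (exists (i : 'I_d) (r : seq 'I_d), perm_eq v (nseq l i ++ r)).
Proof.
have [vl|vl] := boolP [forall i, count_mem i v < l]%N; [left|right].
  exists [ffun i => Ordinal (forallP vl i)]; rewrite perm_box_word.
  by apply/forallP=> i; rewrite ffunE.
move: vl; rewrite negb_forall => /existsP[i]; rewrite -leqNgt => il.
exists i, (nseq (count_mem i v - l) i ++ filter (predC1 i) v).
rewrite catA -nseqD subnKC //.
have -> : nseq (count_mem i v) i = filter (pred1 i) v.
  by rewrite -size_filter; apply/esym/all_pred1P/filter_all.
by rewrite perm_sym perm_filterC.
Qed.

(** Induction along the rewriting of a word into basis elements. The correction terms of an exchange
    move a letter of [v] into [t]: [v] gets shorter while [size v + size t] is unchanged. To see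
    this count, [t] is kept as a list instead of its product. *)
Lemma word_ind (Q : seq 'I_d -> seq ('I_d * 'I_d) -> Prop) :
  (forall v1 v2 (i j : 'I_d) t, i != j -> Q (v1 ++ j :: i :: v2) t ->
    Q (v1 ++ j :: map (tperm i j) v2) ((i, j) :: t) ->
    Q (v1 ++ i :: map (tperm i j) v2) ((i, j) :: t) -> Q (v1 ++ i :: j :: v2) t) ->
  (forall (i : 'I_d) v t, (forall k, (k < l)%N -> Q (nseq k i ++ v) t) -> Q (nseq l i ++ v) t) ->
  (forall b t, Q (box_word b) t) ->
  forall v t, Q v t.
Proof.
move=> Qsw Qpow Qbox v; elim: {v}(size v).+1 {-2}v (ltnSn (size v)) => // n IH v.
rewrite ltnS => sv t.
have Pperm v' : perm_eq v v' -> Q v' t -> Q v t.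
  move=> vv' Qv'.
  have H : forall u u', perm_eq u u' ->
    (size u' = size v -> Q u' t) -> size u = size v -> Q u t; last exact: H vv' _ erefl.
  apply: (@swap_perm_eq _ (fun u => size u = size v -> Q u t)).
  move=> v1 i j v2 Q1; rewrite !size_cat /= => s12.
  have [ij|ij] := eqVneq i j; first by subst j; apply: Q1; rewrite size_cat.
  apply: Qsw => //; first by apply: Q1; rewrite size_cat.
    by apply: IH; rewrite size_cat /= size_map; lia.
  by apply: IH; rewrite size_cat /= size_map; lia.
have [[b vb]|[i [r vr]]] := box_or_big v; first exact: Pperm vb _.
apply: (Pperm _ vr); apply: Qpow => k kl; apply: IH; have sr := perm_size vr.
by move: sr sv kl; rewrite !size_cat !size_nseq => ->; move: (size r) => p; lia.
Qed.

End Words.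

(** All that the study of coefficients uses of [H_d^f], separated from its construction; the
    instance is [dch_pres]. Spanning is asked only for arbitrary words, and [dp_spanned] reduces
    these to boxes. *)
Record dch_presentation (R : comNzRingType) (d l : nat) := DchPresentation {
  dp_alg :> algType R;
  dp_y : 'I_d -> dp_alg;
  dp_s : 'S_d -> dp_alg;
  dp_c : 'I_l -> R;
  dp_s1 : dp_s 1%g = 1;
  dp_sM : forall u w, dp_s (u * w)%g = dp_s u * dp_s w;
  dp_sy : forall w i, dp_s w * dp_y i = dp_y ((w^-1)%g i) * dp_s w;
  dp_yy : forall i j, i != j -> dp_y i * dp_y j =
    dp_y j * dp_y i + (dp_y j - dp_y i) * dp_s (tperm i j);
  dp_ypow : forall i, dp_y i ^+ l = \sum_(k < l) dp_c k *: dp_y i ^+ k;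
  dp_gen : forall h, exists s : seq (R * (seq 'I_d * 'S_d)),
    h = \sum_(q <- s) q.1 *: ((\prod_(i <- q.2.1) dp_y i) * dp_s q.2.2);
  dp_free : forall g : {ffun {ffun 'I_d -> 'I_l} * 'S_d -> R},
    \sum_p g p *: ((\prod_(i <- box_word p.1) dp_y i) * dp_s p.2) = 0 ->
    forall p, g p = 0
}.

Section Coefficients.
Variables (R : comNzRingType) (d l : nat) (A : dch_presentation R d l).
Notation Box := {ffun 'I_d -> 'I_l}.
Implicit Types (v : seq 'I_d) (b : Box) (t : seq ('I_d * 'I_d)) (w u : 'S_d).
Notation y := (dp_y A).
Notation sg := (dp_s A).

Definition Yw v : A := \prod_(i <- v) y i.

Lemma Yw_nil : Yw [::] = 1.
Proof. exact: big_nil. Qed.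

Lemma Yw_cat v1 v2 : Yw (v1 ++ v2) = Yw v1 * Yw v2.
Proof. by rewrite /Yw big_cat. Qed.

Lemma Yw_cons i v : Yw (i :: v) = y i * Yw v.
Proof. by rewrite /Yw big_cons. Qed.

Lemma Yw_nseq k i : Yw (nseq k i) = y i ^+ k.
Proof. by rewrite /Yw big_nseq iter_mulr_1. Qed.

Lemma sg_Yw u v : sg u * Yw v = Yw (map (u^-1)%g v) * sg u.
Proof.
elim: v => [|i v IH]; first by rewrite /Yw !big_nil mulr1 mul1r.
by rewrite /= !Yw_cons mulrA dp_sy -!mulrA IH.
Qed.

Lemma Yw_swap v1 v2 i j w : i != j -> Yw (v1 ++ i :: j :: v2) * sg w =
  Yw (v1 ++ j :: i :: v2) * sg w
  + (Yw (v1 ++ j :: map (tperm i j) v2) * sg (tperm i j * w)%g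
     - Yw (v1 ++ i :: map (tperm i j) v2) * sg (tperm i j * w)%g).
Proof.
move=> ij; have E : sg (tperm i j) * Yw v2 = Yw (map (tperm i j) v2) * sg (tperm i j).
  by rewrite sg_Yw tpermV.
rewrite !Yw_cat !Yw_cons dp_sM -!mulrA (mulrA (Yw (map _ _))) -E.
rewrite -mulrBr -mulrDr; congr (_ * _); rewrite -mulrBl mulrA dp_yy //.
by rewrite mulrDl -!mulrA.
Qed.

Lemma Yw_pow i v w : Yw (nseq l i ++ v) * sg w =
  \sum_(k < l) dp_c A k *: (Yw (nseq k i ++ v) * sg w).
Proof.
rewrite Yw_cat Yw_nseq dp_ypow !mulr_suml; apply: eq_bigr => k _.
by rewrite Yw_cat Yw_nseq -!scalerAl.
Qed.

(** Stated with [==] because [xchoose] takes a boolean predicate. *)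
Lemma dp_spanned (h : A) : exists g : {ffun Box * 'S_d -> R},
  h == \sum_p g p *: (Yw (box_word p.1) * sg p.2).
Proof.
pose span (h : A) := exists g : {ffun Box * 'S_d -> R},
  h = \sum_p g p *: (Yw (box_word p.1) * sg p.2).
have spanD h1 h2 : span h1 -> span h2 -> span (h1 + h2).
  move=> [g1 ->] [g2 ->]; exists [ffun p => g1 p + g2 p].
  by rewrite -big_split; apply: eq_bigr => p _; rewrite ffunE scalerDl.
have spanZ a h1 : span h1 -> span (a *: h1).
  move=> [g1 ->]; exists [ffun p => a * g1 p].
  by rewrite scaler_sumr; apply: eq_bigr => p _; rewrite ffunE scalerA.
have spanN h1 : span h1 -> span (- h1) by rewrite -scaleN1r; apply: spanZ.
have span0 : span 0.
  by exists [ffun=> 0]; rewrite big1 // => p _; rewrite ffunE scale0r.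
have spanY v w : span (Yw v * sg w).
  have [t <- _] := reflen_factor w; move: v t.
  apply: (@word_ind d l (fun v t => span (Yw v * sg (tprod t)))).
  - move=> v1 v2 i j t ij S1 S2 S3; rewrite Yw_swap //.
    by move: S2 S3; rewrite tprod_cons => S2 S3; apply: spanD S1 (spanD _ _ S2 (spanN _ S3)).
  - move=> i v t S; rewrite Yw_pow.
    by elim/big_ind: _ => // k _; apply: spanZ; apply: S.
  - move=> b t; exists [ffun p => (p == (b, tprod t))%:R].
    rewrite (bigD1 (b, tprod t)) //= ffunE eqxx scale1r big1 ?addr0 // => p.
    by rewrite ffunE => /negbTE ->; rewrite scale0r.
suff [g ->] : span h by exists g.
have [s ->] := dp_gen h; elim/big_ind: _ => // q _.
exact: spanZ (spanY _ _).
Qed.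

Definition ycoef (h : A) := xchoose (dp_spanned h).

Lemma ycoefE h : h = \sum_p ycoef h p *: (Yw (box_word p.1) * sg p.2).
Proof. exact: eqP (xchooseP (dp_spanned h)). Qed.

Lemma ycoef_uniq h (g : {ffun Box * 'S_d -> R}) :
  h = \sum_p g p *: (Yw (box_word p.1) * sg p.2) -> ycoef h = g.
Proof.
move=> hE; pose g' := [ffun p => ycoef h p - g p].
have g'0 : forall p, g' p = 0.
  apply: dp_free; transitivity (h - h); last by rewrite subrr.
  rewrite [X in X - _]ycoefE [X in _ - X]hE -sumrB.
  by apply: eq_bigr => p _; rewrite ffunE scalerBl.
by apply/ffunP=> p; apply/eqP; rewrite -subr_eq0; have := g'0 p; rewrite ffunE => ->.
Qed.

Definition kap b w (h : A) : R := ycoef h (b, w).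

Lemma kap_is_linear b w : scalar (kap b w).
Proof.
move=> a h1 h2; rewrite /kap.
rewrite (@ycoef_uniq _ [ffun p => a * ycoef h1 p + ycoef h2 p]) ?ffunE //.
rewrite {1}(ycoefE h1) {1}(ycoefE h2) scaler_sumr -big_split /=.
by apply: eq_bigr => p _; rewrite ffunE scalerDl scalerA.
Qed.

HB.instance Definition _ b w :=
  GRing.isLinear.Build R A R *%R (kap b w) (kap_is_linear b w).

Lemma kap_basis b w b' w' :
  kap b w (Yw (box_word b') * sg w') = ((b == b') && (w == w'))%:R.
Proof.
rewrite /kap (@ycoef_uniq _ [ffun p => (p == (b', w'))%:R]) ?ffunE -?xpair_eqE //.
rewrite (bigD1 (b', w')) //= ffunE eqxx scale1r big1 ?addr0 // => p.
by rewrite ffunE => /negbTE ->; rewrite scale0r.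
Qed.

Lemma kap_eq0 h : (forall b w, kap b w h = 0) -> h = 0.
Proof.
by move=> h0; rewrite (ycoefE h) big1 // => -[b w] _; rewrite [ycoef _ _]h0 scale0r.
Qed.

(** The correction terms of an exchange and the reduction of an [l]-th power have fewer letters than
    [b], so only a rearrangement of [box_word b] survives, with its permutation unchanged. *)
Lemma kap_top b w v u : (size v <= size (box_word b))%N ->
  kap b w (Yw v * sg u) = (perm_eq v (box_word b) && (w == u))%:R.
Proof.
have [t <- _] := reflen_factor u; move: v t.
apply: (@word_ind d l (fun v t => (size v <= size (box_word b))%N ->
  kap b w (Yw v * sg (tprod t)) = (perm_eq v (box_word b) && (w == tprod t))%:R)).
- move=> v1 v2 i j t ij; rewrite !tprod_cons !size_cat /= size_map => S1 S2 S3 vb.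
  rewrite Yw_swap // linearD linearB /= S1 // S2 ?S3; try lia.
  have nperm z : perm_eq (v1 ++ z :: map (tperm i j) v2) (box_word b) = false.
    by apply/negP=> /perm_size; rewrite size_cat /= size_map; lia.
  rewrite !nperm subrr addr0; congr (_ && _)%:R.
  by apply: permPl; rewrite perm_cat2l (perm_catCA [:: j] [:: i] v2).
- move=> i v t S vb; rewrite Yw_pow linear_sum big1 /= => [|k _].
    have -> // : perm_eq (nseq l i ++ v) (box_word b) = false.
    apply/negP => /seq.permP /(_ (pred1 i)).
    rewrite count_mem_box_word count_cat count_nseq /= eqxx mul1n => E.
    by have := ltn_ord (b i); rewrite -E; lia.
  have kl := ltn_ord k.
  rewrite linearZ /= S //; last first.
    by move: vb; rewrite !size_cat !size_nseq; lia.
  have -> : perm_eq (nseq k i ++ v) (box_word b) = false; last by rewrite mulr0.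
  apply/negP=> /perm_size; move: vb; rewrite !size_cat !size_nseq => vb E.
  by move: vb; rewrite -E leq_add2r leqNgt kl.
- move=> b' t _; rewrite kap_basis box_word_inj [b' == b]eq_sym //.
Qed.

End Coefficients.

(** * Coefficients of words of minimal length *)

Section Vanishing.
Variables (R : comNzRingType) (d l : nat) (A : dch_presentation R d l).
Notation Box := {ffun 'I_d -> 'I_l}.
Implicit Types (v : seq 'I_d) (b : Box) (t : seq ('I_d * 'I_d)) (w u : 'S_d).
Notation y := (dp_y A).
Notation sg := (dp_s A).
Notation Yw := (@Yw R d l A).
Notation kap := (@kap R d l A).

(** No rewriting move increases [size v + size t], and [w] cannot be written with fewer than
    [reflen w] transpositions. *)
Lemma kap_short b w v t : (size v + size t < size (box_word b) + reflen w)%N ->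
  kap b w (Yw v * sg (tprod t)) = 0.
Proof.
move: v t; apply: (@word_ind d l (fun v t =>
  (size v + size t < size (box_word b) + reflen w)%N ->
  kap b w (Yw v * sg (tprod t)) = 0)).
- move=> v1 v2 i j t ij; rewrite /= !tprod_cons !size_cat /= size_map => S1 S2 S3 vb.
  by rewrite Yw_swap // linearD linearB /= S1 ?S2 ?S3 ?subrr ?addr0 //; lia.
- move=> i v t S; rewrite size_cat size_nseq => vb.
  rewrite Yw_pow linear_sum big1 // => k _; rewrite linearZ /= S ?mulr0 //.
  rewrite size_cat size_nseq; have := ltn_ord k; lia.
- move=> b' t; rewrite kap_basis; case: eqP => [<-|] //; case: eqP => [->|] //.
  by have := reflen_tprod t; lia.
Qed.

Lemma kap_short_perm b w v u : (size v + reflen u < size (box_word b) + reflen w)%N ->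
  kap b w (Yw v * sg u) = 0.
Proof. by have [t <- <-] := reflen_factor u; apply: kap_short. Qed.

Definition count_on (S : {set 'I_d}) v t : nat :=
  (count (mem S) v + count (fun p : 'I_d * 'I_d => p.1 \in S) t)%N.

(** The property [good] passes backwards along every rewriting move, and a basis word with
    coefficient 1 has it: there [t] is forced to be a reduced factorization of [w], so
    [reduced_closed] and [card_closed_on] apply. *)
Lemma kap_open b w v t x : (size v + size t <= size (box_word b) + reflen w)%N ->
  kap b w (Yw v * sg (tprod t)) != 0 ->
  closed_on (porbit w x) t /\
  (count (mem (porbit w x)) (box_word b) + #|porbit w x| <= (count_on (porbit w x) v t).+1)%N.
Proof.
set S := porbit w x; set E := (_ + #|S|)%N.
pose good v t := closed_on S t && (E <= (count_on S v t).+1)%N.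
suff H : (size v + size t <= size (box_word b) + reflen w)%N -> ~~ good v t ->
    kap b w (Yw v * sg (tprod t)) = 0.
  by move=> vb; have [/andP[]//|/(H vb) ->] := boolP (good v t); rewrite eqxx.
move: v t; apply: (@word_ind d l (fun v t =>
  (size v + size t <= size (box_word b) + reflen w)%N -> ~~ good v t ->
  kap b w (Yw v * sg (tprod t)) = 0)).
- move=> v1 v2 i j t ij; rewrite /= !tprod_cons !size_cat /= size_map => S1 S2 S3 vb gd.
  have cnt : i \in S = (j \in S) -> count (mem S) (map (tperm i j) v2) = count (mem S) v2.
    by move=> ijS; rewrite count_map; apply: eq_count => z /=; rewrite tperm_closed.
  rewrite Yw_swap // linearD linearB /= S1 ?S2 ?S3 ?subrr ?addr0 //; try lia.
  + apply: contra gd => /andP[/= /andP[/eqP ijS tS]]; rewrite /good tS /count_on !count_cat /=.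
    rewrite cnt //= ijS; move: (count _ v1) (count _ v2) (count _ t) (nat_of_bool _) (E) => ? ? ? ? ?; lia.
  + apply: contra gd => /andP[/= /andP[/eqP ijS tS]]; rewrite /good tS /count_on !count_cat /=.
    rewrite cnt //= ijS; move: (count _ v1) (count _ v2) (count _ t) (nat_of_bool _) (E) => ? ? ? ? ?; lia.
  + apply: contra gd => /andP[tS]; rewrite /good tS /count_on !count_cat /=.
    move: (count _ v1) (count _ v2) (count _ t) (E) (nat_of_bool (i \in S)) (nat_of_bool (j \in S)) => ? ? ? ? ? ?; lia.
- move=> i v t IH; rewrite size_cat size_nseq => vb gd.
  rewrite Yw_pow linear_sum big1 // => k _; have kl := ltn_ord k.
  rewrite linearZ /= IH ?mulr0 //; first by rewrite size_cat size_nseq; lia.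
  apply: contra gd => /andP[tS]; rewrite /good tS /count_on !count_cat !count_nseq /=.
  by move: (count _ v) (count _ t) (E) (nat_of_bool _) => p q r s; nia.
- move=> b' t vb gd; rewrite kap_basis; case: eqP => // bb'; case: eqP => // wE.
  subst b'; case/negP: gd.
  have st : size t = reflen (tprod t).
    by apply/eqP; rewrite eqn_leq reflen_tprod andbT -wE; lia.
  have tS : closed_on S t by rewrite /S wE reduced_closed.
  rewrite /good tS /= /E /count_on -addnS leq_add2l.
  by apply: card_closed_on tS _; rewrite /S wE.
Qed.

(** The correction terms of an exchange vanish: if [i] and [j] share a cycle of [u], multiplying by
    their transposition lowers the reflection length and the word is too short; if they lie in
    different cycles of [w], the transposition joins these, against [kap_open]. Hence the letters of
    [v] may be sorted freely. *)
Lemma kap_same b w v u : (size v + reflen u = size (box_word b) + reflen w)%N ->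
  {in v &, forall i j, i != j -> i \in porbit u j \/ i \notin porbit w j} ->
  kap b w (Yw v * sg u) = (perm_eq v (box_word b) && (w == u))%:R.
Proof.
move=> vb vS.
have extra v1 v2 z i j : perm_eq (v1 ++ i :: j :: v2) v -> i != j ->
  kap b w (Yw (v1 ++ z :: map (tperm i j) v2) * sg (tperm i j * u)%g) = 0.
  move=> vv' ij; have iv : i \in v by rewrite -(perm_mem vv') mem_cat !inE eqxx orbT.
  have jv : j \in v by rewrite -(perm_mem vv') mem_cat !inE eqxx !orbT.
  have sv : (size v1 + (size v2).+2 = size v)%N by rewrite -(perm_size vv') size_cat.
  case: (vS _ _ iv jv ij) => [/(reflen_tpermM_in ij) ru|ijw].
    by rewrite kap_short_perm // size_cat /= size_map; lia.
  have [t tE st] := reflen_factor u; rewrite -tE -(tprod_cons (i, j)).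
  apply/eqP/negPn/negP => /(@kap_open _ _ _ _ j)[].
    by rewrite size_cat /= size_map; lia.
  by rewrite /= (negbTE ijw) porbit_id.
have inv v' : perm_eq v v' -> kap b w (Yw v * sg u) = kap b w (Yw v' * sg u).
  move=> vv'; set X := RHS.
  apply: (@swap_perm_eq _ (fun v0 => perm_eq v0 v -> kap b w (Yw v0 * sg u) = X) _ v v') => //.
  move=> v1 i j v2 IH vv1; have [ij|ij] := eqVneq i j.
    by move: IH vv1; rewrite ij; apply.
  rewrite Yw_swap // linearD linearB /= !(extra _ _ _ _ _ vv1) // subrr addr0 IH //.
  by apply: perm_trans vv1; rewrite perm_cat2l (perm_catCA [:: j] [:: i] v2).
have [[b' vb']|[i [r vr]]] := box_or_big l v.
  by rewrite (inv _ vb') kap_basis (permPl vb') box_word_inj eq_sym.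
have sv := perm_size vr; move: sv; rewrite size_cat size_nseq => sv.
rewrite (inv _ vr) Yw_pow linear_sum big1 /= => [|k _].
  have -> // : perm_eq v (box_word b) = false.
  apply/negP => /seq.permP /(_ (pred1 i)); rewrite (seq.permP vr).
  rewrite count_mem_box_word count_cat count_nseq /= eqxx mul1n => E.
  by have := ltn_ord (b i); rewrite -E; lia.
rewrite linearZ /= kap_short_perm ?mulr0 // -vb sv size_cat size_nseq.
by rewrite -!addnA ltn_add2r.
Qed.

End Vanishing.

(** * Expansion of monomials in the [x_i] into words in the [y_i] and transpositions *)

Section Choices.
Variable d : nat.
Implicit Types (X : seq 'I_d) (Z : seq ('I_d * 'I_d)).

(* A letter (i, j) stands for the summand of x_i = y_i + \sum_(j < i) (i j)
   with index j, and for y_i if j = i. *)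
Fixpoint choices X : seq (seq ('I_d * 'I_d)) :=
  if X is i :: X' then
    [seq (i, j) :: Z | j <- [seq k : 'I_d <- enum 'I_d | (k <= i)%N], Z <- choices X']
  else [:: [::]].

(** The letters [y] left after all transpositions have been moved to the right; a transposition acts
    on each later letter that it passes. *)
Fixpoint yletters Z : seq 'I_d :=
  if Z is (i, j) :: Z' then
    if i == j then i :: yletters Z' else map (tperm i j) (yletters Z')
  else [::].

Definition tletters Z := [seq p <- Z | p.1 != p.2].
Arguments tletters : simpl never.

Lemma mem_choices X Z :
  (Z \in choices X) = (map fst Z == X) && all (fun p : 'I_d * 'I_d => p.2 <= p.1)%N Z.
Proof.
elim: X Z => [|i X IH] [|[i' j] Z] //=.
- by apply/allpairsP => -[p [_ _ E]].
- rewrite eqseq_cons; apply/allpairsP/idP => [[[j' Z'] /= [j'i Z'X [-> -> ->]]]|].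
    by move: Z'X j'i; rewrite IH mem_filter eqxx => /andP[-> ->] /andP[->].
  case/andP=> /andP[/eqP -> ZX] /andP[ji Zle]; exists (j, Z) => //=.
  by rewrite mem_filter ji mem_enum IH ZX Zle.
Qed.

Lemma choices_uniq X : uniq (choices X).
Proof.
elim: X => [|i X IH] //=; apply: allpairs_uniq => //.
  by rewrite filter_uniq ?enum_uniq.
by move=> [j Z] [j' Z'] _ _ /= [-> ->].
Qed.

Lemma size_letters Z : (size (yletters Z) + size (tletters Z) = size Z)%N.
Proof.
elim: Z => [|[i j] Z IH] //=; rewrite /tletters /=; case: eqP => _ /=.
  by rewrite addSn IH.
by rewrite size_map addnS IH.
Qed.

Lemma tletters_cons i j Z : tletters ((i, j) :: Z) =
  if i == j then tletters Z else (i, j) :: tletters Z.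
Proof. by rewrite /tletters /=; case: eqP. Qed.

Lemma tprod_tletters Z : tprod (tletters Z) = tprod Z.
Proof.
elim: Z => [|[i j] Z IH] //; rewrite tletters_cons tprod_cons /=.
by case: eqP => [->|_]; rewrite ?tperm1 ?mul1g // tprod_cons IH.
Qed.

Lemma closed_tletters (S : {set 'I_d}) Z : closed_on S (tletters Z) = closed_on S Z.
Proof.
elim: Z => [|[i j] Z IH] //; rewrite tletters_cons /=.
by case: eqP => [->|_] /=; rewrite ?eqxx IH.
Qed.

Lemma yletters_cat Z1 Z2 :
  yletters (Z1 ++ Z2) = yletters Z1 ++ map (tprod Z1)^-1%g (yletters Z2).
Proof.
elim: Z1 => [|[i j] Z1 IH] /=.
  by rewrite tprod_nil invg1 map_id_in // => i _; rewrite perm1.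
rewrite IH tprod_cons invMg tpermV /=; case: eqP => [->|_] /=.
  by rewrite tperm1 mulg1.
by rewrite map_cat -map_comp; congr (_ ++ _); apply: eq_map => z /=; rewrite permM.
Qed.

(** A transposition that does not cross the border of [S] relabels later letters without moving any
    of them into or out of [S]. *)
Lemma count_letters (S : {set 'I_d}) Z : closed_on S Z ->
  count_on S (yletters Z) (tletters Z) = count (mem S) (map fst Z).
Proof.
elim: Z => [|[i j] Z IH] // /andP[/eqP /= ijS ZS].
rewrite tletters_cons -IH // /count_on; case: eqP => [_|_] /=; first by rewrite addnA.
rewrite addnCA; congr (_ + (_ + _))%N; rewrite count_map; apply: eq_count => z /=.
by rewrite tperm_closed.
Qed.

Lemma yletters_origin (S : {set 'I_d}) Z z : closed_on S Z ->
  z \in yletters Z -> z \in S -> exists2 i, i \in map fst Z & i \in S.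
Proof.
elim: Z z => [|[i j] Z IH] z //= /andP[/eqP /= ijS ZS].
case: eqP => _; rewrite ?inE => zZ zS.
  case/predU1P: zZ => [<-|/IH]; first by exists z; rewrite // inE eqxx.
  by case=> // k kZ kS; exists k; rewrite // inE kZ orbT.
case/mapP: zZ => z' /IH H zE; case: H => //; first by rewrite -(tperm_closed z' ijS) -zE.
by move=> k kZ kS; exists k; rewrite // inE kZ orbT.
Qed.

End Choices.
Arguments tletters : simpl never.

(** * Standard pairs *)

Section Tops.
Variable d : nat.
Implicit Types (w : 'S_d) (i j : 'I_d).

Definition is_top w i := [forall (j | j \in porbit w i), (j <= i)%N].

Definition topof w i : 'I_d := [arg max_(j > i in porbit w i) (j : nat)].

Lemma topof_porbit w i : topof w i \in porbit w i.
Proof. by rewrite /topof; case: arg_maxnP => //; apply: porbit_id. Qed.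

Lemma porbit_topof w i : porbit w (topof w i) = porbit w i.
Proof. by apply/eqP; rewrite eq_porbit_mem topof_porbit. Qed.

Lemma topof_top w i : is_top w (topof w i).
Proof.
apply/'forall_implyP => j; rewrite porbit_topof /topof.
by case: arg_maxnP => [|k ki max_k]; [apply: porbit_id | apply: max_k].
Qed.

Lemma top_le w i j : is_top w i -> j \in porbit w i -> (j <= i)%N.
Proof. by move=> /'forall_implyP; apply. Qed.

Lemma top_uniq w i j : is_top w i -> is_top w j -> i \in porbit w j -> i = j.
Proof.
move=> ti tj ij; apply/ord_inj/eqP; rewrite eqn_leq (top_le tj ij) (top_le ti) //.
by rewrite porbit_sym.
Qed.

Lemma topof_eq w i j : is_top w i -> (topof w j == i) = (j \in porbit w i).
Proof.
move=> ti; apply/eqP/idP => [<-|ji]; first by rewrite porbit_sym topof_porbit.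
apply: (@top_uniq w) ti _; first exact: topof_top.
by rewrite -eq_porbit_mem porbit_topof eq_porbit_mem.
Qed.

Lemma topof_id w i : is_top w i -> topof w i = i.
Proof. by move=> ti; apply/eqP; rewrite topof_eq // porbit_id. Qed.

Lemma eq_topof w i j : (topof w i == topof w j) = (i \in porbit w j).
Proof. by rewrite topof_eq ?topof_top // porbit_topof. Qed.

Lemma sum_tops w (F : 'I_d -> nat) :
  (\sum_j F j = \sum_(i | is_top w i) \sum_(j in porbit w i) F j)%N.
Proof.
rewrite (partition_big (topof w) (is_top w)) => [|j _]; last exact: topof_top.
by apply: eq_bigr => i ti; apply: eq_bigl => j; rewrite topof_eq.
Qed.

Lemma card_porbits_tops w : #|porbits w| = #|[pred i | is_top w i]|.
Proof.
have -> : porbits w = porbit w @: [set i | is_top w i].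
  apply/setP=> S; apply/imsetP/imsetP => -[i _ ->]; last by exists i.
  by exists (topof w i); rewrite ?inE ?topof_top // porbit_topof.
rewrite card_in_imset => [|i j]; first by rewrite cardsE.
rewrite !inE => ti tj ij; apply: (top_uniq ti tj).
by rewrite -eq_porbit_mem ij.
Qed.

Lemma reflen_tops w : reflen w = (\sum_(i | is_top w i) #|porbit w i|.-1)%N.
Proof.
rewrite /reflen card_porbits_tops.
have dE : d = (\sum_(i | is_top w i) #|porbit w i|)%N.
  by rewrite -{1}(card_ord d) -sum1_card (sum_tops w); apply: eq_bigr => i _; rewrite sum1_card.
rewrite [X in (X - _)%N]dE -sum1_card.
have E : (\sum_(i | is_top w i) #|porbit w i| =
  \sum_(i | is_top w i) #|porbit w i|.-1 + \sum_(i | is_top w i) 1)%N.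
  rewrite -big_split; apply: eq_bigr => i _ /=.
  by have := card_porbit_neq0 w i; case: #|_| => // n; rewrite addn1.
by rewrite E addnK.
Qed.

Lemma size_count_tops w (X : seq 'I_d) :
  size X = (\sum_(i | is_top w i) count (mem (porbit w i)) X)%N.
Proof.
rewrite -sum1_size (partition_big (topof w) (is_top w)) => [|j _]; last exact: topof_top.
by apply: eq_bigr => i ti; rewrite -sum1_count; apply: eq_bigl => j; rewrite topof_eq.
Qed.

End Tops.

Section Standard.
Variables d l : nat.
Hypothesis l_gt0 : (0 < l)%N.
Notation Box := {ffun 'I_d -> 'I_l}.
Implicit Types (b : Box) (w : 'S_d) (i j : 'I_d).

Definition standard w b := [forall i, is_top w i || (b i == l.-1 :> nat)].

(** The label of the cycle when [i] is its top. Division by [l] recovers the cycle length minus one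
    and the exponent [b i]. *)
Definition cycle_exp w b i : nat := (#|porbit w i|.-1 * l + b i)%N.

Lemma standardP w b i : standard w b -> ~~ is_top w i -> b i = l.-1 :> nat.
Proof. by move=> /forallP /(_ i) /orP[->|/eqP]. Qed.

(** For a cycle of length [a] this is [(a - 1)(l - 1) + b_i + a = (a - 1) l + b_i + 1]. It turns the
    inequality of [kap_open] into a lower bound by the label. *)
Lemma standard_count w b i : standard w b -> is_top w i ->
  (count (mem (porbit w i)) (box_word b) + #|porbit w i| = (cycle_exp w b i).+1)%N.
Proof.
move=> wb ti; rewrite count_box_word (bigD1 i) ?porbit_id //= /cycle_exp.
rewrite (eq_bigr (fun=> l.-1)) => [|j /andP[ji nji]]; last first.
  apply: (standardP wb); apply: contra nji => tj; apply/eqP.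
  exact: (top_uniq tj ti ji).
have := cardD1 i (porbit w i); rewrite porbit_id /= => cE.
rewrite big_const iter_addn_0.
have -> : #|[pred j | (j \in porbit w i) && (j != i)]| = #|porbit w i|.-1.
  by rewrite cE; apply: eq_card => j; rewrite !inE andbC.
case: #|porbit w i| (card_porbit_neq0 w i) => // n _ /=.
  by case: l l_gt0 (b i) => // m _ /= bi; lia.
exact: porbit_id.
Qed.

Lemma standard_degree w b : standard w b ->
  (size (box_word b) + reflen w = \sum_(i | is_top w i) cycle_exp w b i)%N.
Proof.
move=> wb; rewrite size_box_word (sum_tops w) reflen_tops -big_split /=.
apply: eq_bigr => i ti; have := standard_count wb ti; rewrite count_box_word.
by case: #|porbit w i| (card_porbit_neq0 w i) => // n _ /=; rewrite addnS => -[].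
Qed.

End Standard.

Section Expansion.
Variables (R : comNzRingType) (d l : nat) (A : dch_presentation R d l).
Hypothesis l_gt0 : (0 < l)%N.
Notation Box := {ffun 'I_d -> 'I_l}.
Implicit Types (v X : seq 'I_d) (b : Box) (w u : 'S_d) (i j : 'I_d).
Implicit Types Z : seq ('I_d * 'I_d).
Notation y := (dp_y A).
Notation sg := (dp_s A).
Notation Yw := (@Yw R d l A).
Notation kap := (@kap R d l A).

(** The sum is a Jucys-Murphy element, so this is [x_i] written in the [y] generators; see
    [dch_poly_Xw]. *)
Definition jmx i : A := y i + \sum_(j < d | (j < i)%N) sg (tperm i j).

Definition Xw X : A := \prod_(i <- X) jmx i.

Lemma Xw_choices X : Xw X = \sum_(Z <- choices X) Yw (yletters Z) * sg (tprod Z).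
Proof.
elim: X => [|i X IH].
  by rewrite /Xw big_nil big_seq1 tprod_nil dp_s1 mulr1 Yw_nil.
rewrite /Xw big_cons -/(Xw X) IH /= big_allpairs_dep /= big_filter.
rewrite /jmx mulrDl mulr_suml.
rewrite [RHS]big_enum_cond /= [RHS](bigD1 i) //=; congr (_ + _).
  rewrite mulr_sumr; apply: eq_bigr => Z _.
  by rewrite eqxx Yw_cons tprod_cons tperm1 mul1g mulrA.
apply: eq_big => [j|j ji]; first by rewrite ltn_neqAle andbC.
rewrite mulr_sumr; apply: eq_bigr => Z _.
have /negbTE -> : i != j by apply: contraTneq ji => ->; rewrite ltnn.
by rewrite tprod_cons dp_sM !mulrA sg_Yw tpermV.
Qed.

Lemma kap_Xw b w X :
  kap b w (Xw X) = \sum_(Z <- choices X) kap b w (Yw (yletters Z) * sg (tprod Z)).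
Proof. by rewrite Xw_choices linear_sum. Qed.

Lemma kap_Xw_neq0 b w X : kap b w (Xw X) != 0 ->
  exists2 Z, Z \in choices X & kap b w (Yw (yletters Z) * sg (tprod Z)) != 0.
Proof.
rewrite kap_Xw => nz; case: (boolP (has (fun Z => kap b w (Yw (yletters Z) * sg (tprod Z)) != 0) (choices X))) => [/hasP//|].
rewrite -all_predC => /allP z0; case/negP: nz; apply/eqP.
by rewrite big_seq big1 // => Z /z0 /=; rewrite negbK => /eqP.
Qed.

Section Fixed.
Variables (b : Box) (w : 'S_d) (X : seq 'I_d).
Hypotheses (wb : standard w b) (Xn : (size X <= size (box_word b) + reflen w)%N).

Lemma choice_closed Z i : Z \in choices X ->
  kap b w (Yw (yletters Z) * sg (tprod Z)) != 0 ->
  closed_on (porbit w i) Z /\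
  (count (mem (porbit w i)) (box_word b) + #|porbit w i| <= (count (mem (porbit w i)) X).+1)%N.
Proof.
rewrite mem_choices => /andP[/eqP ZX _]; rewrite -tprod_tletters => /(kap_open i) H.
have [|ZS cS] := H; first by rewrite size_letters -(size_map fst) ZX.
have ZS' : closed_on (porbit w i) Z by rewrite -closed_tletters.
by split=> //; rewrite -ZX -count_letters.
Qed.

Hypothesis nz : kap b w (Xw X) != 0.

(** Each cycle receives at least its label of letters by [choice_closed], and the labels add up to
    the largest length allowed for [X]. So every inequality is an equality. *)
Lemma count_orbits : (size X = size (box_word b) + reflen w)%N /\
  forall i, is_top w i -> count (mem (porbit w i)) X = cycle_exp w b i.
Proof.
have [Z ZX Znz] := kap_Xw_neq0 nz.
have ge i : is_top w i -> (cycle_exp w b i <= count (mem (porbit w i)) X)%N.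
  by move=> ti; have [_] := choice_closed i ZX Znz; rewrite standard_count.
move: Xn; rewrite (size_count_tops w) standard_degree // => le.
have eqs := leqif_sum (fun i ti => leqif_geq (ge i ti)).
have /eqP E : (\sum_(i | is_top w i) cycle_exp w b i ==
  \sum_(i | is_top w i) count (mem (porbit w i)) X)%N by rewrite eqn_leq eqs.1.
split=> // i ti; apply/eqP; rewrite eqn_leq ge // andbT.
by move: eqs.2; rewrite E eqxx => /esym/'forall_implyP; apply.
Qed.

End Fixed.
End Expansion.

(** * Recovering a choice from its product and its letters *)

Section Reduced.
Variable d : nat.
Implicit Types (X : seq 'I_d) (Z t : seq ('I_d * 'I_d)) (w : 'S_d) (i j : 'I_d).

Lemma closed_porbit (S : {set 'I_d}) t x z : closed_on S t ->
  x \in porbit (tprod t) z -> (x \in S) = (z \in S).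
Proof.
move=> tS /porbitP[n ->]; elim: n => [|n IH]; first by rewrite expg0 perm1.
by rewrite expgSr permM tprod_closed.
Qed.

Lemma tprod_moves t i : tprod t i != i -> exists2 p, p \in t & (p.1 == i) || (p.2 == i).
Proof.
move=> ti; apply/hasP; apply: contraNT ti; rewrite -all_predC.
elim: t => [|p t IH] /=; first by rewrite tprod_nil perm1.
case/andP=> /norP[p1 p2] /IH /eqP tE.
by rewrite tprod_cons permM tpermD // tE.
Qed.

(** All letters of [X] lying in one cycle of [w] are equal. This is what allows a choice to be
    decoded in [choice_uniq]. *)
Definition separated w X := {in X &, injective (topof w)}.

Lemma separatedP w X i j : separated w X -> i \in X -> j \in X ->
  i \in porbit w j -> i = j.
Proof. by move=> wX iX jX; rewrite -eq_topof => /eqP; apply: wX. Qed.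

Lemma reduced_behead i j Z : i != j ->
  size (tletters ((i, j) :: Z)) = reflen (tprod ((i, j) :: Z)) ->
  size (tletters Z) = reflen (tprod Z) /\ i \notin porbit (tprod Z) j.
Proof.
move=> ij; rewrite tletters_cons (negbTE ij) tprod_cons /= reflen_tpermM //.
have := reflen_tprod (tletters Z); rewrite tprod_tletters.
by case: ifP => _; split => //; lia.
Qed.

Lemma porbit_behead i j Z x z :
  size (tletters ((i, j) :: Z)) = reflen (tprod ((i, j) :: Z)) ->
  x \in porbit (tprod Z) z -> x \in porbit (tprod ((i, j) :: Z)) z.
Proof.
rewrite -tprod_tletters => red xz.
have := reduced_closed z red; rewrite closed_tletters tprod_tletters => /andP[_ cl].
by rewrite (closed_porbit cl xz) porbit_id.
Qed.

(** Since [i] is the only letter in its cycle of the whole product, and the cycle of [j] under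
    [tprod Z] avoids [i], no letter [x_k] of [Z] lies in that smaller cycle. Hence [tprod Z] fixes
    [j], and no letter [y_j] can arise from [Z]. *)
Lemma first_transposition i j Z : i != j ->
  size (tletters ((i, j) :: Z)) = reflen (tprod ((i, j) :: Z)) ->
  separated (tprod ((i, j) :: Z)) (map fst ((i, j) :: Z)) ->
  [/\ separated (tprod Z) (map fst Z), tprod ((i, j) :: Z) i = j & j \notin yletters Z].
Proof.
move=> ij red sep; have [red' ijZ] := reduced_behead ij red.
have iX : i \in map fst ((i, j) :: Z) by rewrite inE eqxx.
have sub k : k \in map fst Z -> k \in map fst ((i, j) :: Z) by rewrite inE orbC => ->.
have ijw : i \in porbit (tprod ((i, j) :: Z)) j.
  rewrite -tprod_tletters; apply: reduced_same_porbit; first by rewrite tprod_tletters.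
  by rewrite tletters_cons (negbTE ij) inE eqxx.
have far k : k \in map fst Z -> k \notin porbit (tprod Z) j.
  move=> kZ; apply/negP=> kj; case/negP: ijZ.
  suff -> : i = k by [].
  apply: (separatedP sep iX (sub _ kZ)).
  move: ijw; rewrite -!eq_porbit_mem => /eqP ->.
  by rewrite eq_porbit_mem porbit_sym; apply: porbit_behead.
split.
- move=> k k' kZ k'Z /eqP; rewrite eq_topof => kk'.
  by apply: (separatedP sep (sub _ kZ) (sub _ k'Z)); apply: porbit_behead.
- rewrite tprod_cons permM tpermL; apply/eqP/negPn/negP; rewrite -tprod_tletters => mv.
  have [[a c] acZ ac] := tprod_moves mv.
  have aZ : a \in map fst Z.
    by move: acZ; rewrite /tletters mem_filter => /andP[_ acZ]; apply/mapP; exists (a, c).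
  case/negP: (far _ aZ); rewrite /= in ac.
  case/orP: ac => /eqP <-; first exact: porbit_id.
  rewrite -tprod_tletters; apply: reduced_same_porbit acZ.
  by rewrite tprod_tletters.
- apply/negP=> jZ; have cl : closed_on (porbit (tprod Z) j) Z.
    by rewrite -closed_tletters -{1}tprod_tletters reduced_closed // tprod_tletters.
  have [k kZ kj] := yletters_origin cl jZ (porbit_id _ _).
  by case/negP: (far _ kZ).
Qed.

(** Decoding goes from the left. The first letter is [y_i] exactly when [i] occurs among the [y]
    letters; otherwise it is a transposition, and its second entry is the image of [i] under the
    product. *)
Lemma choice_uniq X Z1 Z2 : Z1 \in choices X -> Z2 \in choices X ->
  tprod Z1 = tprod Z2 -> separated (tprod Z1) X ->
  size (tletters Z1) = reflen (tprod Z1) -> size (tletters Z2) = reflen (tprod Z2) ->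
  perm_eq (yletters Z1) (yletters Z2) -> Z1 = Z2.
Proof.
elim: X Z1 Z2 => [|i X IH] [|[i1 j1] Z1] [|[i2 j2] Z2]; rewrite !mem_choices //=.
rewrite !eqseq_cons => /andP[/andP[/eqP ? ZX1] /andP[_ le1]].
move=> /andP[/andP[/eqP ? ZX2] /andP[_ le2]]; subst i1 i2.
have Z1X : Z1 \in choices X by rewrite mem_choices ZX1.
have Z2X : Z2 \in choices X by rewrite mem_choices ZX2.
move=> E sep red1 red2 pE; have sep2 := sep; rewrite E in sep2.
have sep1' : separated (tprod ((i, j1) :: Z1)) (map fst ((i, j1) :: Z1)).
  by rewrite /= (eqP ZX1).
have sep2' : separated (tprod ((i, j2) :: Z2)) (map fst ((i, j2) :: Z2)).
  by rewrite /= (eqP ZX2).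
have [ij1|ij1] := eqVneq i j1; have [ij2|ij2] := eqVneq i j2.
- subst j1 j2; congr (_ :: _); move: E sep red1 red2 pE.
  rewrite !tletters_cons !tprod_cons /= !eqxx tperm1 !mul1g perm_cons => E sep red1 red2 pE.
  apply: IH => //; move=> k k' kX k'X; apply: sep; by rewrite inE ?kX ?k'X orbT.
- have [_ _ /negP[]] := first_transposition ij2 red2 sep2'.
  move: pE; rewrite /= ij1 eqxx -ij1 (negbTE ij2) => /perm_mem /(_ i).
  rewrite inE eqxx /= => /esym /mapP[k kZ ik].
  by have -> : j2 = k by rewrite -(tpermK i j2 k) -ik tpermL.
- have [_ _ /negP[]] := first_transposition ij1 red1 sep1'.
  move: pE; rewrite /= ij2 eqxx -ij2 (negbTE ij1) => /perm_mem /(_ i).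
  rewrite [in RHS]inE eqxx /= => /mapP[k kZ ik].
  by have -> : j1 = k by rewrite -(tpermK i j1 k) -ik tpermL.
- have [s1 w1 _] := first_transposition ij1 red1 sep1'.
  have [s2 w2 _] := first_transposition ij2 red2 sep2'.
  have jj : j1 = j2 by rewrite -w1 -w2 E.
  subst j2; congr (_ :: _).
  have [r1 _] := reduced_behead ij1 red1; have [r2 _] := reduced_behead ij2 red2.
  apply: IH => //.
  + by move: E; rewrite !tprod_cons => /mulgI.
  + by rewrite -(eqP ZX1).
  + by move: pE; rewrite /= (negbTE ij1); apply: perm_map_inj; apply: perm_inj.
Qed.

End Reduced.

(** * Monomials with one letter per cycle *)

Section Concentrated.
Variables (R : comNzRingType) (d l : nat) (A : dch_presentation R d l).
Hypothesis l_gt0 : (0 < l)%N.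
Notation Box := {ffun 'I_d -> 'I_l}.
Implicit Types (v X : seq 'I_d) (b : Box) (w u : 'S_d) (i j : 'I_d).
Implicit Types Z : seq ('I_d * 'I_d).
Notation sg := (dp_s A).
Notation Yw := (@Yw R d l A).
Notation kap := (@kap R d l A).

Variables (b : Box) (w : 'S_d) (X : seq 'I_d).
Hypotheses (wb : standard w b).

(** Separation provides the hypothesis of [kap_same]: two [y] letters in one cycle of [w] originate
    from equal letters of [X], hence share a cycle of [tprod Z]. *)
Lemma separated_choice Z : size X = (size (box_word b) + reflen w)%N ->
  separated w X -> Z \in choices X ->
  kap b w (Yw (yletters Z) * sg (tprod Z)) != 0 ->
  [/\ tprod Z = w, size (tletters Z) = reflen w,
      perm_eq (yletters Z) (box_word b)
    & kap b w (Yw (yletters Z) * sg (tprod Z)) = 1].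
Proof.
move=> Xn sep ZX nz.
have cl i := (choice_closed (eq_leq Xn) i ZX nz).1.
have sZ : (size (yletters Z) + size (tletters Z) = size X)%N.
  by move: ZX; rewrite size_letters mem_choices => /andP[/eqP <- _]; rewrite size_map.
have red : size (tletters Z) = reflen (tprod Z).
  have := reflen_tprod (tletters Z); rewrite tprod_tletters leq_eqVlt.
  case/orP => [/eqP->//|lt]; case/negP: nz; rewrite kap_short_perm // -Xn -sZ.
  by rewrite ltn_add2l.
have kE : kap b w (Yw (yletters Z) * sg (tprod Z)) =
    (perm_eq (yletters Z) (box_word b) && (w == tprod Z))%:R.
  apply: kap_same; first by rewrite -Xn -sZ red.
  have cl' i : closed_on (porbit (tprod Z) i) Z.
    by rewrite -closed_tletters -{1}tprod_tletters reduced_closed // tprod_tletters.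
  have ZXE : map fst Z = X by move: ZX; rewrite mem_choices => /andP[/eqP].
  move=> i j /(yletters_origin (cl' i)) /(_ (porbit_id _ _)) [a aX ai].
  move=> /(yletters_origin (cl' j)) /(_ (porbit_id _ _)) [c cX cj] _.
  have [ij|ij] := boolP (i \in porbit w j); [left | by right].
  have cw : c \in porbit w j by rewrite (closed_porbit (cl j) cj) porbit_id.
  have aw : a \in porbit w i by rewrite (closed_porbit (cl i) ai) porbit_id.
  have ac : a = c.
    rewrite ZXE in aX cX; apply: (separatedP sep) => //.
    by move: cw ij aw; rewrite -!eq_porbit_mem => /eqP -> /eqP <-.
  by move: ai cj; rewrite ac -!eq_porbit_mem => /eqP <- /eqP <-.
move: nz; rewrite kE; case: (boolP (perm_eq _ _ && _)) => [/andP[pb /eqP wE] _|_]; last by rewrite eqxx.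
by split=> //; rewrite ?wE // -wE; move: kE; rewrite pb wE eqxx.
Qed.

Definition cycle_mult i : nat := if is_top w i then cycle_exp w b i else 0.

Definition big_cycles : {set 'I_d} := [set i | is_top w i & (0 < cycle_exp w b i)%N].

Lemma topof_image : (size X <= size (box_word b) + reflen w)%N ->
  kap b w (Xw A X) != 0 -> topof w @: [set x in X] = big_cycles.
Proof.
move=> Xn nz; have [_ cE] := count_orbits l_gt0 wb Xn nz.
apply/setP=> i; rewrite inE; apply/imsetP/andP => [[x]|[ti i0]].
  rewrite inE => xX ->; split; first exact: topof_top.
  rewrite -cE ?topof_top // -has_count; apply/hasP; exists x => //=.
  by rewrite porbit_topof porbit_id.
move: i0; rewrite -cE // -has_count => /hasP[x xX /= xi].
by exists x; rewrite ?inE //; apply/esym/eqP; rewrite topof_eq.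
Qed.

(** The map [topof w] sends the letters of [X] onto the tops of the cycles with positive label; when
    the cardinalities agree it is injective. *)
Lemma kap_orbit_count : (size X <= size (box_word b) + reflen w)%N ->
  kap b w (Xw A X) != 0 ->
  (#|big_cycles| <= #|[set x in X]|)%N /\
  (#|big_cycles| = #|[set x in X]| ->
    separated w X /\ forall x, x \in X -> count_mem x X = cycle_exp w b (topof w x)).
Proof.
move=> Xn nz; have [_ cE] := count_orbits l_gt0 wb Xn nz.
have imE := topof_image Xn nz.
split; first by rewrite -imE leq_imset_card.
rewrite -imE => /eqP/imset_injP inj; have sep : separated w X.
  by move=> x z xX zX; apply: inj; rewrite inE.
split=> // x xX; rewrite -cE ?topof_top //; apply: eq_in_count => z zX /=.
by rewrite porbit_topof; apply/eqP/idP => [->|/(separatedP sep zX xX)//]; rewrite porbit_id.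
Qed.

(** A pair [(a, c)] of a choice has [c <= a]. So the top of a nontrivial cycle, which [w] moves, can
    only occur as a first entry of a transposition, and thus belongs to [X]. As the only letter in
    its cycle it carries the whole label. *)
Lemma separated_mult : size X = (size (box_word b) + reflen w)%N ->
  separated w X -> kap b w (Xw A X) != 0 -> forall i, count_mem i X = cycle_mult i.
Proof.
move=> Xn sep nz; have [_ cE] := count_orbits l_gt0 wb (eq_leq Xn) nz.
have [Z ZX Znz] := kap_Xw_neq0 nz.
have [Zw red _ _] := separated_choice Xn sep ZX Znz.
move: ZX; rewrite mem_choices => /andP[/eqP ZX /allP Zle].
have topX i : is_top w i -> w i != i -> i \in X.
  rewrite -{2}Zw -tprod_tletters => ti /tprod_moves[[a c] acZ /= aci].
  have [acn aZ] : a != c /\ (a, c) \in Z by move: acZ; rewrite mem_filter => /andP[].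
  have aX : a \in X by rewrite -ZX; apply/mapP; exists (a, c).
  case/orP: aci => [/eqP <-//|/eqP ci]; subst c.
  have ai : a \in porbit w i.
    rewrite -{1}Zw -tprod_tletters; apply: reduced_same_porbit acZ.
    by rewrite tprod_tletters Zw.
  case/negP: acn; apply/eqP/ord_inj/eqP; rewrite eqn_leq (top_le ti ai).
  exact: (Zle _ aZ).
have fixed i j : w i = i -> j \in porbit w i -> j = i.
  move=> wi /porbitP[n ->]; elim: n => [|n IH]; first by rewrite expg0 perm1.
  by rewrite expgSr permM IH.
move=> i; rewrite /cycle_mult; case: ifP => ti.
  rewrite -cE //; apply: eq_in_count => z zX /=.
  apply/eqP/idP => [->|zi]; first exact: porbit_id.
  have [wi|wi] := eqVneq (w i) i; first exact: fixed zi.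
  exact: (separatedP sep zX (topX _ ti wi)).
apply/eqP; rewrite -leqn0 leqNgt -has_count has_pred1; apply/negP => iX.
have [wi|wi] := eqVneq (w (topof w i)) (topof w i).
  move: ti; rewrite (fixed (topof w i) i wi) ?topof_top //.
  by rewrite porbit_topof porbit_id.
have /(separatedP sep iX) H := topX _ (topof_top _ _) wi.
by move: ti; rewrite H ?topof_top // porbit_topof porbit_id.
Qed.

End Concentrated.

(** * The monomial with coefficient 1 at a standard pair *)

Section StarChoice.
Variable d : nat.
Implicit Types (i j : 'I_d) (s : seq 'I_d) (w : 'S_d).

(** For each [j] of [s], the transposition with [j] and then [m] letters [y_i]. Once the
    transpositions are moved to the right these letters become [y_j], and the product is the cycle
    through [i] and [s]. *)
Definition star i m s := flatten [seq (i, j) :: nseq m (i, i) | j <- s].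

Lemma yletters_nseq n i Z : yletters (nseq n (i, i) ++ Z) = nseq n i ++ yletters Z.
Proof. by elim: n => //= n ->; rewrite eqxx. Qed.

Lemma tprod_nseq n i Z : tprod (nseq n (i, i) ++ Z) = tprod Z.
Proof. by elim: n => //= n <-; rewrite tprod_cons tperm1 mul1g. Qed.

Lemma yletters_star i m s : uniq (i :: s) ->
  yletters (star i m s) = flatten [seq nseq m j | j <- s].
Proof.
elim: s => [|j s IH] //; rewrite /= inE negb_or -andbA => /and4P[ij i_s j_s us].
rewrite (negbTE ij) yletters_nseq -/(star i m s) map_cat IH ?/= ?i_s //.
rewrite map_nseq tpermL; congr (_ ++ _); rewrite map_id_in // => k /flattenP[r].
case/mapP=> k' k's -> /nseqP[-> _]; rewrite tpermD //.
  by apply: contraNneq i_s => ->.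
by apply: contraNneq j_s => ->.
Qed.

Lemma tprod_star_notin i m s k : k \notin i :: s -> tprod (star i m s) k = k.
Proof.
elim: s => [|j s IH] /=; first by rewrite tprod_nil perm1.
rewrite !inE !negb_or => /and3P[ki kj ks].
rewrite tprod_cons permM tprod_nseq -/(star i m s) /= tpermD 1?eq_sym // IH //.
by rewrite inE negb_or ki.
Qed.

(** The default value [i] of [nth] closes the cycle: for [q = size s] the right side is [i]. *)
Lemma tprod_star i m s q : uniq (i :: s) -> (q <= size s)%N ->
  tprod (star i m s) (nth i (i :: s) q) = nth i (i :: s) q.+1.
Proof.
elim: s q => [|j s IH] q.
  by case: q => // _ _; rewrite /= tprod_nil perm1.
rewrite /= inE negb_or -andbA => /and4P[ij i_s j_s us] qs.
have us' : uniq (i :: s) by rewrite /= i_s.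
rewrite tprod_cons permM tprod_nseq -/(star i m s).
case: q qs => [|[|q]] qs /=.
- by rewrite tpermL tprod_star_notin // inE negb_or eq_sym ij.
- by rewrite tpermR; apply: (IH 0%N us').
have sq : (q < size s)%N by [].
rewrite tpermD.
- exact: (IH q.+1 us').
- by apply: contraNneq i_s => ->; apply: mem_nth.
- by apply: contraNneq j_s => ->; apply: mem_nth.
Qed.

Lemma star_fst i m s : map fst (star i m s) = nseq (size s * m.+1) i.
Proof.
elim: s => [|j s IH] //; rewrite [size _]/= mulSn nseqD -IH.
by rewrite /star /= map_cat map_nseq.
Qed.

Definition cycle_tail w i := behead (traject w i #|porbit w i|).

Lemma cycle_tailE w i : i :: cycle_tail w i = traject w i #|porbit w i|.
Proof. by rewrite /cycle_tail; case: #|_| (card_porbit_neq0 w i). Qed.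

Lemma size_cycle_tail w i : size (cycle_tail w i) = #|porbit w i|.-1.
Proof. by rewrite /cycle_tail size_behead size_traject. Qed.

Lemma mem_cycle_tail w i k : (k \in i :: cycle_tail w i) = (k \in porbit w i).
Proof. by rewrite cycle_tailE -porbit_traject. Qed.

Lemma tprod_star_cycle w i m k : tprod (star i m (cycle_tail w i)) k =
  if k \in porbit w i then w k else k.
Proof.
have ut : uniq (i :: cycle_tail w i) by rewrite cycle_tailE uniq_traject_porbit.
case: ifP => ki; last by rewrite tprod_star_notin // mem_cycle_tail ki.
have := ki; rewrite -mem_cycle_tail => /(nthP i)[q qs <-].
rewrite tprod_star // cycle_tailE.
move: qs; rewrite cycle_tailE size_traject => qs.
rewrite (set_nth_default i) ?size_traject //.
have [q1|q1] := ltnP q.+1 #|porbit w i|; first by rewrite !nth_traject.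
rewrite nth_default ?size_traject // nth_traject //.
have qE : #|porbit w i| = q.+1 by apply/eqP; rewrite eqn_leq q1.
by rewrite -{1}(iter_porbit w i) qE.
Qed.

End StarChoice.

Section CanonicalChoice.
Variables d l : nat.
Hypothesis l_gt0 : (0 < l)%N.
Notation Box := {ffun 'I_d -> 'I_l}.
Implicit Types (i j : 'I_d) (s T : seq 'I_d).
Variables (b : Box) (w : 'S_d).
Hypothesis wb : standard w b.

(** Here the label originates: [b i] of the letters [x_i] give [y_i], and every other point of the
    cycle takes [l] of them, one for a transposition and [l - 1] for [y] letters that become its
    own. *)
Definition cycle_choice i := nseq (b i) (i, i) ++ star i l.-1 (cycle_tail w i).

Definition cycle_letters i := nseq (b i) i ++ flatten [seq nseq l.-1 j | j <- cycle_tail w i].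

Lemma cycle_letters_porbit i k : k \in cycle_letters i -> k \in porbit w i.
Proof.
rewrite mem_cat => /orP[/nseqP[-> _]|/flattenP[r /mapP[j js ->] /nseqP[-> _]]].
  exact: porbit_id.
by rewrite -mem_cycle_tail inE js orbT.
Qed.

Lemma tprod_cycle_choices T k : uniq T -> all (is_top w) T ->
  tprod (flatten [seq cycle_choice i | i <- T]) k = if topof w k \in T then w k else k.
Proof.
elim: T k => [|i T IH] k /=; first by rewrite tprod_nil perm1.
move=> /andP[iT uT] /andP[ti tT]; rewrite tprod_cat permM IH //.
rewrite tprod_nseq tprod_star_cycle inE topof_eq //.
case: (boolP (k \in porbit w i)) => //= ki.
have -> : topof w (w k) = topof w k.
  by apply/eqP; rewrite eq_topof (mem_porbit w 1).
suff /negbTE -> : topof w k \notin T by [].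
by move: ki; rewrite -topof_eq // => /eqP ->.
Qed.

Lemma yletters_cycle_choices T : uniq T -> all (is_top w) T ->
  yletters (flatten [seq cycle_choice i | i <- T]) =
  flatten [seq cycle_letters i | i <- T].
Proof.
elim: T => [|i T IH] //= /andP[iT uT] /andP[ti tT].
rewrite yletters_cat IH // yletters_nseq yletters_star; last first.
  by rewrite cycle_tailE uniq_traject_porbit.
rewrite -/(cycle_letters i) map_id_in // => k /flattenP[r /mapP[i' i'T ->]].
move/cycle_letters_porbit => ki'; apply: (canLR (permK _)).
rewrite tprod_nseq tprod_star_cycle; case: ifP => // ki; case/negP: iT.
suff -> : i = i' by [].
apply: (top_uniq ti (allP tT _ i'T)).
by move: ki ki'; rewrite -!eq_porbit_mem => /eqP <-.
Qed.

Definition tops := [seq i <- enum 'I_d | is_top w i].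

Definition standard_choice := flatten [seq cycle_choice i | i <- tops].

Definition cycle_word := flatten [seq nseq (cycle_mult b w i) i | i <- enum 'I_d].

Lemma tops_uniq : uniq tops. Proof. by rewrite filter_uniq ?enum_uniq. Qed.

Lemma tops_top : all (is_top w) tops. Proof. exact: filter_all. Qed.

Lemma mem_tops i : (i \in tops) = is_top w i.
Proof. by rewrite mem_filter mem_enum andbT. Qed.

Lemma standard_choice_tprod : tprod standard_choice = w.
Proof.
by apply/permP=> k; rewrite tprod_cycle_choices ?tops_uniq ?tops_top // mem_tops topof_top.
Qed.

Lemma standard_choice_mem : standard_choice \in choices cycle_word.
Proof.
rewrite mem_choices; apply/andP; split.
  rewrite /standard_choice /cycle_word /tops map_flatten -map_comp.
  apply/eqP; elim: (enum 'I_d) => //= i s IH; rewrite /cycle_mult; case: ifP => ti //=.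
  rewrite IH map_cat map_nseq star_fst -nseqD size_cycle_tail prednK //.
  by rewrite /cycle_exp addnC.
apply/allP=> p /flattenP[r /mapP[i]]; rewrite mem_tops => ti ->.
rewrite mem_cat => /orP[/nseqP[-> _]|/flattenP[r' /mapP[j jt ->]]] //.
rewrite inE => /orP[/eqP ->|/nseqP[-> _]] //=.
by apply: (top_le ti); rewrite -mem_cycle_tail inE jt orbT.
Qed.

Lemma standard_choice_letters : perm_eq (yletters standard_choice) (box_word b).
Proof.
rewrite yletters_cycle_choices ?tops_uniq ?tops_top // perm_box_word.
apply/forallP=> k; rewrite count_flatten -map_comp sumnE big_map.
rewrite big_filter big_enum_cond /=.
rewrite (bigD1 (topof w k)) ?topof_top //= big1 => [|i /andP[ti ik]]; last first.
  apply: count_memPn; apply: contra ik => /cycle_letters_porbit ki.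
  by rewrite eq_sym topof_eq.
rewrite addn0 /cycle_letters count_cat count_nseq /=.
rewrite count_flatten -map_comp sumnE big_map.
have ut : uniq (topof w k :: cycle_tail w (topof w k)).
  by rewrite cycle_tailE uniq_traject_porbit.
have kt : k \in topof w k :: cycle_tail w (topof w k).
  by rewrite mem_cycle_tail porbit_topof porbit_id.
move: ut kt; rewrite inE => /= /andP[nt ut].
have [kE|kE] := eqVneq k (topof w k).
  move=> _; rewrite -kE ?eqxx mul1n big_seq big1 ?addn0 // => j jt /=.
  rewrite count_nseq /=; case: eqP => // jk; case/negP: nt.
  by rewrite -kE -{1}jk.
rewrite /= mul0n add0n => kt.
rewrite (bigD1_seq k) //= count_nseq /= eqxx mul1n big1 ?addn0 => [|j jk].
  apply/eqP/esym/(standardP wb); apply: contra kE => tk.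
  by rewrite eq_sym topof_id.
by rewrite count_nseq /= (negbTE jk).
Qed.

Lemma cycle_word_size : size cycle_word = (size (box_word b) + reflen w)%N.
Proof.
rewrite -count_predT count_flatten_nseq standard_degree // big_mkcond [RHS]big_mkcond.
by apply: eq_bigr => i _; rewrite /cycle_mult.
Qed.

Lemma cycle_word_separated : separated w cycle_word.
Proof.
have top i : i \in cycle_word -> is_top w i.
  case/flattenP => r /mapP[j _ ->]; rewrite /cycle_mult.
  by case: ifP => tj // /nseqP[-> _].
by move=> i j /top ti /top tj; rewrite !topof_id.
Qed.

Variables (R : comNzRingType) (A : dch_presentation R d l).

(** By [separated_choice] any contributing choice has product [w] and the [y] letters of [b], so
    [choice_uniq] identifies it with [standard_choice]. *)
Lemma kap_cycle_word : kap b w (Xw A cycle_word) = 1.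
Proof.
rewrite kap_Xw (bigD1_seq standard_choice) ?standard_choice_mem ?choices_uniq //=.
have [sp sl] := (standard_choice_tprod, standard_choice_letters).
have sz : (size (yletters standard_choice) + reflen (tprod standard_choice) =
    size (box_word b) + reflen w)%N by rewrite sp (perm_size sl).
rewrite kap_same // => [|i j _ _ _]; last first.
  by rewrite sp; case: (i \in porbit w j); [left|right].
rewrite sl sp eqxx big1_seq ?addr0 // => Z /andP[Zs ZX].
apply/eqP/negPn/negP => nz; case/negP: Zs; apply/eqP.
have [Zw red Zl _] := separated_choice cycle_word_size cycle_word_separated ZX nz.
apply: (choice_uniq ZX standard_choice_mem).
- by rewrite Zw sp.
- by rewrite Zw; apply: cycle_word_separated.
- by rewrite Zw.
- rewrite sp; apply/eqP; rewrite -(eqn_add2l (size (yletters standard_choice))).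
  rewrite size_letters (perm_size sl) -cycle_word_size.
  by move: standard_choice_mem; rewrite mem_choices => /andP[/eqP <- _]; rewrite size_map.
- by rewrite (permPl Zl) perm_sym.
Qed.

End CanonicalChoice.

(** * Leading coefficients of central elements *)

Section Central.
Variables (R : comNzRingType) (d l : nat) (A : dch_presentation R d l).
Hypothesis l_gt0 : (0 < l)%N.
Notation Box := {ffun 'I_d -> 'I_l}.
Implicit Types (v X : seq 'I_d) (a b : Box) (w u : 'S_d) (i j k : 'I_d).
Notation y := (dp_y A).
Notation sg := (dp_s A).
Notation Yw := (@Yw R d l A).
Notation kap := (@kap R d l A).

Variables (z : A) (n : nat).
Hypothesis (zC : forall h : A, z * h = h * z).
Hypothesis zn : forall b w, kap b w z != 0 -> (size (box_word b) <= n)%N.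

(** Here [e] is the number of added letters: 0 for conjugation, 1 for multiplication by some [y_i].
    In the top degree the order of the letters is irrelevant by [kap_top]. *)
Lemma kap_expand (e : nat) (v : Box -> 'S_d -> seq 'I_d) (g : 'S_d -> 'S_d) b w :
  (forall a u, size (v a u) = size (box_word a) + e)%N -> size (box_word b) = (n + e)%N ->
  kap b w (\sum_p ycoef z p *: (Yw (v p.1 p.2) * sg (g p.2))) =
  \sum_p kap p.1 p.2 z * (perm_eq (v p.1 p.2) (box_word b) && (w == g p.2))%:R.
Proof.
move=> sv sb; rewrite linear_sum; apply: eq_bigr => -[a u] _; rewrite linearZ /=.
rewrite -/(kap a u z); have [->|nz] := eqVneq (kap a u z) 0; first by rewrite !mul0r.
by rewrite kap_top // sv sb leq_add2r (zn nz).
Qed.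

Lemma sum_kap_pred1 (P : pred (Box * 'S_d)) a u : (forall p, P p = (p == (a, u))) ->
  \sum_p kap p.1 p.2 z * (P p)%:R = kap a u z.
Proof.
move=> PE; rewrite (bigD1 (a, u)) //= PE eqxx mulr1 big1 ?addr0 // => p /negbTE.
by rewrite PE => ->; rewrite mulr0.
Qed.

(** Top-degree comparison of [z] with its conjugate by [t]. *)
Lemma kap_conj (t : 'S_d) a b w : size (box_word b) = n -> (forall i, b i = a (t i)) ->
  kap b (t * w * t^-1)%g z = kap a w z.
Proof.
move=> sb ba.
have zE : z = sg t * z * sg (t^-1)%g.
  by rewrite -zC -mulrA -dp_sM mulgV dp_s1 mulr1.
rewrite [X in kap b _ X]zE {1}(ycoefE z) mulr_sumr mulr_suml.
transitivity (kap b (t * w * t^-1)%g (\sum_p ycoef z p *: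
    (Yw (map (t^-1)%g (box_word p.1)) * sg (t * p.2 * t^-1)%g))).
  congr (kap _ _ _); apply: eq_bigr => p _.
  by rewrite -scalerAr -scalerAl !mulrA sg_Yw -!mulrA -!dp_sM mulgA.
rewrite (@kap_expand 0%N (fun a u => map (t^-1)%g (box_word a)) (fun u => t * u * t^-1)%g).
- apply: (@sum_kap_pred1 (fun p => perm_eq (map (t^-1)%g (box_word p.1)) (box_word b)
    && (t * w * t^-1 == t * p.2 * t^-1)%g)) => -[a' u] /=.
  rewrite (inj_eq (mulIg _)) (inj_eq (mulgI _)) xpair_eqE [w == u]eq_sym; congr (_ && _).
  rewrite perm_box_word; apply/forallP/eqP => [H|-> i].
    apply/ffunP=> i; apply: val_inj => /=; have := H ((t^-1)%g i).
    rewrite count_map ba permKV => /eqP <-; rewrite -count_mem_box_word; apply: eq_count => k /=.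
    by rewrite (inj_eq perm_inj).
  rewrite count_map ba -count_mem_box_word; apply/eqP/eq_count => k /=.
  by apply/eqP/eqP => [<-|->]; rewrite ?permKV ?permK.
- by move=> a' u; rewrite size_map addn0.
- by rewrite addn0.
Qed.

(** Compare the coefficients of [y_i z] and [z y_i] at [u] and the box [a] raised by one at [i]. The
    first product gives back [a]; in the second, [y_i] passes [u] and the unit is taken off at the
    preimage of [i]. *)
Lemma kap_move a u i : kap a u z != 0 -> size (box_word a) = n -> ((a i).+1 < l)%N ->
  (u^-1)%g i != i ->
  exists2 a', kap a' u z != 0 &
    forall k, (a' k + (k == (u^-1)%g i) = a k + (k == i))%N.
Proof.
set j := (u^-1)%g i => nz sa il ji.
pose b : Box := [ffun k => if k == i then Ordinal il else a k].
have bE k : (b k = a k + (k == i) :> nat)%N.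
  by rewrite ffunE; case: eqP => [->|_] /=; rewrite ?addn1 ?addn0.
have sb : size (box_word b) = (n + 1)%N.
  rewrite -sa !size_box_word (eq_bigr _ (fun k _ => bE k)) big_split /=; congr (_ + _)%N.
  by rewrite (bigD1 i) //= eqxx big1 // => k /negbTE ->.
have E1 : kap b u (y i * z) = kap a u z.
  transitivity (kap b u (\sum_p ycoef z p *: (Yw (i :: box_word p.1) * sg p.2))).
    congr (kap _ _ _); rewrite {1}(ycoefE z) mulr_sumr; apply: eq_bigr => p _.
    by rewrite -scalerAr Yw_cons mulrA.
  rewrite (@kap_expand 1%N (fun a u => i :: box_word a) id) //; last first.
    by move=> a' u'; rewrite addn1.
  apply: (@sum_kap_pred1 (fun p => perm_eq (i :: box_word p.1) (box_word b) && (u == p.2))).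
  move=> [a' u'] /=; rewrite xpair_eqE [u == u']eq_sym; congr (_ && _).
  rewrite perm_box_word; apply/forallP/eqP => [H|-> k].
    apply/ffunP=> k; apply: val_inj => /=; have := H k.
    by rewrite bE /= count_mem_box_word addnC [i == k]eq_sym eqn_add2r => /eqP.
  by rewrite bE /= count_mem_box_word addnC [i == k]eq_sym.
have E2 : kap b u (z * y i) = \sum_p kap p.1 p.2 z *
    (perm_eq ((p.2^-1)%g i :: box_word p.1) (box_word b) && (u == p.2))%:R.
  transitivity (kap b u (\sum_p ycoef z p *:
      (Yw (rcons (box_word p.1) ((p.2^-1)%g i)) * sg p.2))).
    congr (kap _ _ _); rewrite {1}(ycoefE z) mulr_suml; apply: eq_bigr => p _.
    by rewrite -scalerAl -cats1 Yw_cat Yw_cons Yw_nil mulr1 -!mulrA dp_sy.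
  rewrite (@kap_expand 1%N (fun a u => rcons (box_word a) ((u^-1)%g i)) id) //; last first.
    by move=> a' u'; rewrite size_rcons addn1.
  by apply: eq_bigr => p _; rewrite (permPl (permEl (perm_rcons _ _))).
have permE (p : Box * 'S_d) : u == p.2 ->
    perm_eq ((p.2^-1)%g i :: box_word p.1) (box_word b) =
    [forall k, p.1 k + (k == j) == b k]%N.
  move=> /eqP <-; rewrite perm_box_word; apply: eq_forallb => k /=.
  by rewrite count_mem_box_word addnC [k == j]eq_sym.
(* With exponent 0 at [j] no term of [z * y i] would reach [b], and the coefficient of [y i * z]
   would vanish. *)
have j0 : (0 < a j)%N.
  rewrite lt0n; apply: contraNneq nz => aj; rewrite -E1 -zC E2 big1 // => p _.
  case: (boolP (u == p.2)) => [up|]; last by rewrite andbF mulr0.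
  rewrite andbT permE //; case: (boolP [forall k, _]) => [/forallP /(_ j)|]; last by rewrite mulr0.
  by rewrite eqxx addn1 bE aj (negbTE ji).
have jl : ((a j).-1 < l)%N by rewrite (leq_ltn_trans (leq_pred _)).
pose a' : Box := [ffun k => if k == j then Ordinal jl else b k].
have a'E k : (a' k + (k == j) = b k)%N.
  rewrite ffunE; have [->|_] := eqVneq k j; last by rewrite addn0.
  by rewrite bE (negbTE ji) addn0 /= addn1 prednK.
exists a' => [|k]; last by rewrite a'E bE.
suff <- : kap b u (z * y i) = kap a' u z by rewrite zC E1.
rewrite E2; apply: sum_kap_pred1 => -[a1 u1]; rewrite xpair_eqE [u1 == u]eq_sym.
case: (boolP (u == u1)) => [uu|]; last by rewrite !andbF.
rewrite !andbT permE //=; apply/forallP/eqP => [H|-> k]; last by rewrite a'E.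
apply/ffunP=> k; apply: val_inj => /=; apply/eqP.
by rewrite -(eqn_add2r (k == j)) a'E.
Qed.

End Central.

Section CentralStandard.
Variables (R : comNzRingType) (d l : nat) (A : dch_presentation R d l).
Hypothesis l_gt0 : (0 < l)%N.
Notation Box := {ffun 'I_d -> 'I_l}.
Implicit Types (a b : Box) (w u : 'S_d) (i j k : 'I_d).
Notation kap := (@kap R d l A).

Lemma index_step u j : ~~ is_top u (u j) ->
  (index (u j) (topof u j :: cycle_tail u (topof u j)) =
   (index j (topof u j :: cycle_tail u (topof u j))).+1)%N.
Proof.
move=> nt; rewrite cycle_tailE porbit_topof.
have := topof_top u j; have := porbit_topof u j; move: (topof u j) => i iu it.
have ut := uniq_traject_porbit u i; rewrite iu in ut.
have : j \in traject u i #|porbit u j| by rewrite -iu -porbit_traject iu porbit_id.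
case/trajectP => q qs jE.
have nq (m : nat) : (m < #|porbit u j|)%N ->
    index (iter m u i) (traject u i #|porbit u j|) = m.
  by move=> ks; rewrite -(nth_traject u ks) index_uniq // size_traject.
have -> : index j (traject u i #|porbit u j|) = q.
  by rewrite -[RHS](nq q qs) -jE.
have [q1|q1] := ltnP q.+1 #|porbit u j|; first by rewrite -(nq _ q1) /= -jE.
case/negP: nt; have -> // : u j = i.
have <- : iter #|porbit u j| u i = i by rewrite -iu iter_porbit.
have -> : #|porbit u j| = q.+1 by apply/eqP; rewrite eqn_leq q1.
by rewrite iterS -jE.
Qed.

Lemma central_standard (z : A) : (forall h : A, z * h = h * z) -> z != 0 ->
  exists a u, [/\ standard u a, kap a u z != 0 &
    forall b w, kap b w z != 0 -> (size (box_word b) <= size (box_word a))%N].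
Proof.
move=> zC z0.
have [p0 p0z] : exists p, kap p.1 p.2 z != 0.
  apply/existsP; apply: contraNT z0; rewrite negb_exists => /forallP z0.
  by apply/eqP/kap_eq0 => b w; apply/eqP/negPn; apply: (z0 (b, w)).
pose p1 := [arg max_(p > p0 | kap p.1 p.2 z != 0) size (box_word p.1)].
pose n := size (box_word p1.1); pose u := p1.2.
have [p1z p1n] : kap p1.1 p1.2 z != 0 /\
    forall b w, kap b w z != 0 -> (size (box_word b) <= n)%N.
  rewrite /n /p1; case: arg_maxnP => // p pz pmax; split=> // b w bz.
  exact: (pmax (b, w)).
pose pos k := index k (topof u k :: cycle_tail u (topof u k)).
(* The weight grows as units move along the cycles away from the tops. Below, a move into a non-top
   point that still has room raises it by one, against maximality; [u] and the degree are unchanged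
   by moves. *)
pose weight a := (\sum_k a k * pos k)%N.
pose Q a := (kap a u z != 0) && (size (box_word a) == n).
have Q1 : Q p1.1 by rewrite /Q p1z eqxx.
have [a /andP[az /eqP an] amax] := arg_maxnP weight Q1.
exists a, u; split=> //; last by rewrite an.
apply/forallP => i; apply/negPn/negP; rewrite negb_or => /andP[nti ail].
have ai : ((a i).+1 < l)%N.
  by rewrite -[X in (_ < X)%N](prednK l_gt0) ltnS ltn_neqAle ail -ltnS prednK // ltn_ord.
have uj : u ((u^-1)%g i) = i by rewrite permKV.
have ji : (u^-1)%g i != i.
  apply: contraNneq nti => ji; have ui : u i = i by rewrite -{1}ji.
  apply/'forall_implyP => k /porbitP[m ->].
  suff -> : (u ^+ m)%g i = i by [].
  by elim: m => [|m IH]; rewrite ?expg0 ?perm1 // expgSr permM IH ui.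
have [a' a'z a'E] := kap_move zC p1n az an ai ji.
have sumE (F : 'I_d -> nat) :
    (\sum_k a' k * F k + F ((u^-1)%g i) = \sum_k a k * F k + F i)%N.
  have single j : F j = (\sum_k (k == j) * F k)%N.
    by rewrite (bigD1 j) //= eqxx mul1n big1 ?addn0 // => k /negbTE ->.
  rewrite (single ((u^-1)%g i)) (single i) -!big_split /=.
  by apply: eq_bigr => k _; rewrite -!mulnDl a'E.
have sa' : size (box_word a') = n.
  have := sumE (fun=> 1%N); rewrite -an !size_box_word => /eqP; rewrite eqn_add2r => /eqP.
  by rewrite (eq_bigr _ (fun k _ => muln1 (a' k))) (eq_bigr _ (fun k _ => muln1 (a k))).
have := amax a'; rewrite /Q a'z sa' eqxx => /(_ isT) le.
have {le} : (weight a' <= weight a)%N := le; apply/negP; rewrite -ltnNge.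
have := sumE pos; rewrite -/(weight a') -/(weight a).
suff -> : pos i = (pos ((u^-1)%g i)).+1 by lia.
rewrite /pos -{1 2 3 4}uj; set j := (u^-1)%g i in uj *.
have -> : topof u (u j) = topof u j by apply/eqP; rewrite eq_topof (mem_porbit u 1).
by rewrite index_step // uj.
Qed.

End CentralStandard.

(** * Conjugacy of standard pairs with equal labels *)

Section Conjugacy.
Variables d l : nat.
Notation Box := {ffun 'I_d -> 'I_l}.
Implicit Types (a b : Box) (w u : 'S_d) (i j k : 'I_d).

(** Used to line up the cycles of two permutations with the same multiset of labels. *)
Lemma perm_eq_map2 (T1 T2 T3 : eqType) (f : T1 -> T3) (g : T2 -> T3) s1 s2 :
  perm_eq (map f s1) (map g s2) -> exists2 s3, perm_eq s3 s2 & map f s1 = map g s3.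
Proof.
elim: s1 s2 => [|x s1 IH] s2 /=.
  by rewrite perm_sym => /perm_nilP/eqP; case: s2 => // _; exists [::].
move=> ps; have : f x \in map g s2 by rewrite -(perm_mem ps) mem_head.
case/mapP=> z zs fx; have pz := perm_to_rem zs.
have : perm_eq (map f s1) (map g (rem z s2)).
  by rewrite -(perm_cons (f x)) (permPl ps) fx; apply: (perm_map g pz).
case/IH => s3 ps3 E; exists (z :: s3); last by rewrite /= E fx.
by rewrite perm_sym (permPl pz) perm_cons perm_sym.
Qed.

Lemma iter_mod_porbit u i n : iter (n %% #|porbit u i|) u i = iter n u i.
Proof.
rewrite {2}(divn_eq n #|porbit u i|) addnC iterD; congr (iter _ _ _).
by elim: (n %/ _)%N => // m IH; rewrite mulSn iterD -IH iter_porbit.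
Qed.

(** Tops are matched by label, and [t] carries iterates of [w] at a top to iterates of [u] at the
    matched top. Equal labels give equal cycle lengths and top exponents; at the other points both
    boxes have the value [l - 1]. *)
Lemma standard_conj w b u a : standard w b -> standard u a ->
  perm_eq [seq cycle_exp w b i | i <- tops w] [seq cycle_exp u a i | i <- tops u] ->
  exists t : 'S_d, (t * u * t^-1)%g = w /\ forall i, b i = a (t i).
Proof.
move=> wb ua /perm_eq_map2[T pT expT].
pose tau i := nth i T (index i (tops w)).
have sT : size T = size (tops w) by rewrite -(size_map (cycle_exp u a) T) -expT size_map.
have tauT i : is_top w i -> tau i \in T.
  by move=> ti; apply: mem_nth; rewrite sT index_mem mem_tops.
have tau_top i : is_top w i -> is_top u (tau i).
  by move/tauT; rewrite (perm_mem pT) mem_tops.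
have uT : uniq T by rewrite (perm_uniq pT) tops_uniq.
have tau_inj i j : is_top w i -> is_top w j -> tau i = tau j -> i = j.
  move=> ti tj; have [iT jT] : i \in tops w /\ j \in tops w by rewrite !mem_tops.
  rewrite /tau (set_nth_default i j) ?sT ?index_mem // => /eqP.
  rewrite nth_uniq ?sT ?index_mem // => /eqP.
  by move/(congr1 (nth i (tops w))); rewrite !nth_index.
have tau_exp i : is_top w i -> cycle_exp u a (tau i) = cycle_exp w b i.
  move=> ti; have iT : i \in tops w by rewrite mem_tops.
  rewrite /tau -(nth_map i 0%N) ?sT ?index_mem // -expT.
  by rewrite (nth_map i) ?index_mem // nth_index.
have tauP i : is_top w i -> #|porbit u (tau i)| = #|porbit w i| /\ a (tau i) = b i.
  move=> ti; have := tau_exp i ti; rewrite /cycle_exp => E.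
  have := congr1 (fun m => (m %/ l, m %% l)%N) E.
  have l_gt0 : (0 < l)%N by rewrite (leq_trans _ (ltn_ord (b i))).
  rewrite !divnMDl // !modnMDl !divn_small ?modn_small ?addn0 // => -[c1 c2].
  split; last exact: val_inj.
  move: c1 (card_porbit_neq0 w i) (card_porbit_neq0 u (tau i)).
  by case: #|_| => // p; case: #|_| => // q /= -> .
pose pos x := index x (traject w (topof w x) #|porbit w x|).
have posP x : iter (pos x) w (topof w x) = x /\ (pos x < #|porbit w x|)%N.
  have xt : x \in traject w (topof w x) #|porbit w x|.
    by rewrite -(porbit_topof w x) -porbit_traject porbit_topof porbit_id.
  have ps : (pos x < #|porbit w x|)%N by rewrite -index_mem size_traject in xt.
  by split=> //; rewrite -(nth_traject w ps) nth_index.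
pose t0 x := iter (pos x) u (tau (topof w x)).
have t0_orbit x : t0 x \in porbit u (tau (topof w x)).
  by rewrite /t0 -permX mem_porbit.
have t0E i n : is_top w i -> t0 (iter n w i) = iter n u (tau i).
  move=> ti; set x := iter n w i.
  have xi : topof w x = i.
    by apply/eqP; rewrite topof_eq // /x -permX mem_porbit.
  have [sz _] := tauP i ti.
  rewrite /t0 xi -(iter_mod_porbit u _ n) sz; congr (iter _ _ _).
  have [_ ps] := posP x.
  have cx : #|porbit w x| = #|porbit w i| by rewrite -xi porbit_topof.
  rewrite /pos xi cx /x -(iter_mod_porbit w i n).
  have ns : (n %% #|porbit w i| < #|porbit w i|)%N.
    by rewrite ltn_mod lt0n card_porbit_neq0.
  by rewrite -(nth_traject w ns) index_uniq ?size_traject // uniq_traject_porbit.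
have t0w x : t0 (w x) = u (t0 x).
  by rewrite -{1}(posP x).1 -iterS t0E ?topof_top.
have t0_inj : injective t0.
  move=> x x' E; have tx : topof w x = topof w x'.
    apply: tau_inj; rewrite ?topof_top //.
    apply: (top_uniq (tau_top _ (topof_top _ _)) (tau_top _ (topof_top _ _))).
    rewrite -eq_porbit_mem; have := t0_orbit x; have := t0_orbit x'.
    by rewrite E -!eq_porbit_mem => /eqP <- /eqP <-.
  rewrite -(posP x).1 -(posP x').1 tx; congr (iter _ _ _).
  have [sz _] := tauP _ (topof_top w x').
  have cx : #|porbit w x| = #|porbit w x'|.
    by rewrite -(porbit_topof w x) tx porbit_topof.
  have ps := (posP x).2; have ps' := (posP x').2; move: ps ps'; rewrite cx => ps ps'.
  move: E; rewrite /t0 tx; rewrite -porbit_topof -sz in ps ps'.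
  rewrite -(nth_traject u ps) -(nth_traject u ps') => /eqP.
  by rewrite nth_uniq ?size_traject ?uniq_traject_porbit // => /eqP.
exists (perm t0_inj); split.
  apply/permP=> x; rewrite !permM; apply: (canLR (permK _)).
  by rewrite !permE t0w.
move=> i; rewrite permE; have [ti|nti] := boolP (is_top w i).
  have -> : t0 i = tau i by exact: (t0E i 0%N ti).
  by rewrite (tauP i ti).2.
apply: val_inj => /=; rewrite (standardP wb nti) (standardP ua) //.
apply: contra nti => t0i; suff -> : i = topof w i by apply: topof_top.
apply: t0_inj; rewrite (t0E _ 0%N (topof_top w i) : t0 (topof w i) = tau _).
exact: (top_uniq t0i (tau_top _ (topof_top _ _)) (t0_orbit i)).
Qed.

End Conjugacy.

(** * Multipartitions and exponents *)

Section MultipartitionExponents.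
Variables d l : nat.
Hypothesis l_gt0 : (0 < l)%N.
Implicit Types (E : seq nat) (la : multipartition l d).

(** Inverts the exponent [(a - 1) l + r]: the quotient gives the part [a], the remainder its
    component. *)
Definition parts E r := [seq (e %/ l).+1 | e <- E & (e %% l == r)%N].

Lemma parts_perm E E' r : perm_eq E E' -> perm_eq (parts E r) (parts E' r).
Proof. by move=> EE'; apply/perm_map/perm_filter. Qed.

Lemma parts_cat E E' r : parts (E ++ E') r = parts E r ++ parts E' r.
Proof. by rewrite /parts filter_cat map_cat. Qed.

Definition of_parts (P : 'I_l -> seq nat) :=
  flatten [seq [seq (a.-1 * l + val r)%N | a <- P r] | r : 'I_l].

Lemma parts_of_parts P r : all (leq 1) (P r) -> parts (of_parts P) (val r) = P r.
Proof.
move=> Pr; have blk (r' : 'I_l) : parts [seq (a.-1 * l + val r')%N | a <- P r'] (val r) =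
    if r' == r then P r else [::].
  rewrite /parts filter_map -map_comp; case: eqP => [->|rr'].
    have -> : [seq x <- P r | preim (fun a => (a.-1 * l + val r)%N)
        (fun e => (e %% l == val r)%N) x] = P r.
      by apply/all_filterP/allP => a _ /=; rewrite modnMDl modn_small.
    rewrite map_id_in // => a /(allP Pr) /= a1.
    by rewrite divnMDl // divn_small // addn0 prednK.
  rewrite (eq_filter (a2 := pred0)) ?filter_pred0 // => a /=.
  by rewrite modnMDl modn_small //; apply/eqP => /ord_inj.
have gen s : uniq s -> parts (flatten [seq [seq (a.-1 * l + val r')%N | a <- P r'] | r' <- s])
    (val r) = if r \in s then P r else [::].
  elim: s => //= r' s IH /andP[r's us]; rewrite parts_cat blk inE eq_sym IH //.
  have [rr'|_] := eqVneq r' r; last by [].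
  by move: r's; rewrite rr' => /negbTE ->; rewrite cats0.
by rewrite /of_parts /image_mem gen ?enum_uniq // mem_enum.
Qed.

Lemma mem_parts_le E r a : a \in parts E r -> (0 < a)%N.
Proof. by case/mapP=> e _ ->. Qed.

Lemma of_parts_perm E (P : 'I_l -> seq nat) :
  (forall r, perm_eq (P r) (parts E (val r))) -> perm_eq (of_parts P) E.
Proof.
move=> PE; apply/seq.permP => p; rewrite /of_parts count_flatten sumnE big_map /image_mem big_map.
rewrite big_enum /=.
rewrite -sum1_count (partition_big (fun e => Ordinal (ltn_pmod e l_gt0)) predT) //=.
apply: eq_bigr => r _; rewrite sum1_count count_map (seq.permP (PE r)) /parts count_map.
rewrite (eq_in_count (a2 := p)) => [|e]; last first.
  by rewrite mem_filter => /andP[/eqP er _] /=; rewrite -er -divn_eq.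
by rewrite count_filter; apply: eq_count => e.
Qed.

Lemma mp_exponentsE la : mp_exponents la =
  of_parts (fun r => [seq val a | a <- tnth la r & (0 < val a)%N]).
Proof.
by rewrite /mp_exponents /of_parts /image_mem; congr flatten; apply: eq_map => r; rewrite -map_comp.
Qed.

Lemma mp_parts la r :
  parts (mp_exponents la) (val r) = [seq val a | a <- tnth la r & (0 < val a)%N].
Proof.
rewrite mp_exponentsE parts_of_parts //; apply/allP => x /mapP[a].
by rewrite mem_filter => /andP[a0 _] ->.
Qed.

Lemma mp_sorted la r : sorted geq [seq val a | a <- tnth la r].
Proof. by have := valP la; rewrite /is_multipartition => /andP[/forallP]. Qed.

Lemma sumn_parts E : \sum_(e <- E) (e %/ l).+1 = (\sum_(r < l) \sum_(a <- parts E r) a)%N.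
Proof.
rewrite (partition_big (fun e => Ordinal (ltn_pmod e l_gt0)) predT) //=.
by apply: eq_bigr => r _; rewrite /parts big_map big_filter; apply: eq_bigl => e.
Qed.

Lemma sum_positive (s : seq nat) : (\sum_(a <- s | 0 < a) a = \sum_(a <- s) a)%N.
Proof. by rewrite big_mkcond; apply: eq_bigr => -[]. Qed.

Lemma mp_exponents_sum la : (\sum_(e <- mp_exponents la) (e %/ l).+1 = d)%N.
Proof.
have := valP la; rewrite /is_multipartition => /andP[_ /eqP sd].
rewrite sumn_parts -[RHS]sd; apply: eq_bigr => r _; rewrite mp_parts big_map big_filter.
by rewrite -(big_map val (fun a => 0 < a)%N id) sum_positive big_map.
Qed.

Lemma filter_pos_perm (s s' : seq nat) : size s = size s' ->
  perm_eq [seq a <- s | (0 < a)%N] [seq a <- s' | (0 < a)%N] -> perm_eq s s'.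
Proof.
move=> ss pp; have E (s0 : seq nat) : [seq a <- s0 | ~~ (0 < a)%N] =
    nseq (size s0 - size [seq a <- s0 | (0 < a)%N]) 0%N.
  rewrite size_filter -(count_predC (fun a => (0 < a)%N) s0) addKn -size_filter.
  by apply/all_pred1P/allP => a; rewrite mem_filter /= -eqn0Ngt => /andP[].
rewrite -(perm_filterC (fun a => (0 < a)%N)) perm_sym.
rewrite -(perm_filterC (fun a => (0 < a)%N)) perm_sym.
apply: perm_cat => //; rewrite -!(eq_filter (a1 := fun a => ~~ (0 < a)%N)) // !E ss.
by rewrite (perm_size pp).
Qed.

Lemma mp_exponents_inj la la' :
  perm_eq (mp_exponents la) (mp_exponents la') -> la = la'.
Proof.
move=> pE; apply: val_inj; apply: eq_from_tnth => r; apply: val_inj.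
apply: (inj_map val_inj); apply: (@sorted_eq _ geq).
- by move=> x y z; rewrite /geq /= => yx xz; apply: leq_trans xz yx.
- by move=> x y; rewrite /geq /= => /andP[xy yx]; apply/eqP; rewrite eqn_leq xy yx.
- exact: mp_sorted.
- exact: mp_sorted.
apply: filter_pos_perm; first by rewrite !size_map !size_tuple.
by have := parts_perm (val r) pE; rewrite !mp_parts !filter_map.
Qed.

Lemma exists_multipartition E : (\sum_(e <- E) (e %/ l).+1 = d)%N ->
  exists la, perm_eq (mp_exponents la) E.
Proof.
move=> Ed; pose s r := sort geq (parts E (val (r : 'I_l))).
have ps r : perm_eq (s r) (parts E (val r)) by rewrite /s perm_sort.
have sum_s : (\sum_(r < l) \sum_(a <- s r) a = d)%N.
  by rewrite -Ed sumn_parts; apply: eq_bigr => r _; apply: perm_big.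
have s_le r : (\sum_(a <- s r) a <= d)%N.
  by rewrite -sum_s (bigD1 r) //= leq_addr.
have s_pos r a : a \in s r -> (0 < a)%N.
  by rewrite (perm_mem (ps r)) => /mem_parts_le.
have s_mem r a : a \in s r -> (a <= d)%N.
  move=> asr; apply: leq_trans (s_le r); rewrite (perm_big _ (perm_to_rem asr)) big_cons.
  exact: leq_addr.
have s_size r : (size (s r) <= d)%N.
  apply: leq_trans (s_le r); rewrite -sum1_size big_seq [in leqRHS]big_seq.
  by apply: leq_sum => a /s_pos.
pose t r := [tuple (inord (nth 0%N (s r) i) : 'I_d.+1) | i < d].
have tE r : [seq val a | a <- t r] = s r ++ nseq (d - size (s r)) 0%N.
  apply: (@eq_from_nth _ 0%N).
    by rewrite size_map size_tuple size_cat size_nseq subnKC.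
  move=> i; rewrite size_map size_tuple => id.
  rewrite (nth_map ord0) ?size_tuple // -[i]/(val (Ordinal id)) -tnth_nth tnth_mktuple /=.
  rewrite inordK; last first.
    have [si|si] := ltnP i (size (s r)); first by rewrite ltnS (s_mem r) // mem_nth.
    by rewrite nth_default.
  by rewrite nth_cat nth_nseq if_same; case: ltnP => // si; rewrite nth_default.
have laP : is_multipartition [tuple t r | r < l].
  apply/andP; split.
    apply/forallP=> r; rewrite tnth_mktuple tE.
    have tot : total geq by move=> x y; rewrite /geq /= leq_total.
    have tr : transitive geq by move=> x y z; rewrite /geq /= => yx xz; apply: leq_trans xz yx.
    rewrite sorted_pairwise // pairwise_cat; apply/and3P; split.
    - by apply/allrelP => x y _ /nseqP[-> _]; apply: leq0n.
    - by rewrite -sorted_pairwise // sort_sorted.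
    - by elim: (d - _)%N => //= n ->; rewrite andbT all_nseq orbT.
  apply/eqP; rewrite -[RHS]sum_s; apply: eq_bigr => r _.
  rewrite tnth_mktuple -(big_map val predT id) tE big_cat /= [X in (_ + X)%N]big1_seq ?addn0 //.
  by move=> a /nseqP[].
exists (Multipartition laP); rewrite mp_exponentsE; apply: of_parts_perm => r.
rewrite /= tnth_mktuple -(filter_map val (fun a => 0 < a)%N) tE filter_cat.
have -> : [seq a <- s r | (0 < a)%N] = s r by apply/all_filterP/allP => a /s_pos.
by rewrite filter_nseq cats0.
Qed.

End MultipartitionExponents.

(** * Standard pairs with prescribed labels *)

Section BlockPermutation.
Variables (d : nat) (L : seq (seq 'I_d)).
Hypotheses (Lu : uniq (flatten L)) (Lall : forall x, x \in flatten L).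
Implicit Types x z : 'I_d.

Definition bidx x := find (fun B : seq 'I_d => x \in B) L.
Definition block x := nth [::] L (bidx x).

Lemma bidx_size x : (bidx x < size L)%N.
Proof. by rewrite -has_find; have /flattenP[B BL xB] := Lall x; apply/hasP; exists B. Qed.

Lemma mem_block x : x \in block x.
Proof. by rewrite /block; apply: (nth_find [::] (a := fun B : seq 'I_d => x \in B)); rewrite has_find bidx_size. Qed.

Lemma bidx_nth x q : (q < size L)%N -> x \in nth [::] L q -> bidx x = q.
Proof.
rewrite /bidx; elim: L Lu q => //= B L' IH; rewrite cat_uniq => /and3P[_ BL uL] [|q] /=.
  by move=> _ ->.
rewrite ltnS => qL xq; case: ifP => xB; last by rewrite (IH uL q).
case/negP: BL; apply/hasP; exists x => //.
by apply/flattenP; exists (nth [::] L' q); rewrite ?mem_nth.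
Qed.

Lemma block_uniq x : uniq (block x).
Proof.
rewrite /block; have := bidx_size x; move: (bidx x) => q; elim: L Lu q => //= B L' IH.
by rewrite cat_uniq => /and3P[uB _ uL] [|q] //=; rewrite ltnS; apply: IH.
Qed.

Lemma block_eq x z : z \in block x -> block z = block x.
Proof. by move=> /(bidx_nth (bidx_size x)) E; rewrite /block E. Qed.

Lemma next_block_inj : injective (fun x => next (block x) x).
Proof.
move=> x z E; have : next (block x) x \in block x by rewrite mem_next mem_block.
have : next (block z) z \in block z by rewrite mem_next mem_block.
rewrite -E => /block_eq E1 /block_eq E2.
rewrite -(prev_next (block_uniq x) x) E -E2 E1.
by rewrite prev_next // block_uniq.
Qed.

Definition block_perm : 'S_d := perm next_block_inj.

Lemma block_permE x : block_perm x = next (block x) x.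
Proof. by rewrite permE. Qed.

Lemma porbit_block x : porbit block_perm x =i block x.
Proof.
move=> z; apply/idP/idP => [/porbitP[n ->]|zx].
  elim: n => [|n IH]; first by rewrite expg0 perm1 mem_block.
  by rewrite expgSr permM block_permE (block_eq IH) mem_next.
have cyc : fcycle block_perm (block x).
  have := cycle_next (block_uniq x); rewrite (eq_in_cycle (e' := frel block_perm) (P := mem (block x))) //.
    by move=> u v ux _; rewrite /= block_permE (block_eq ux).
have := fconnect_cycle cyc (mem_block x) z; rewrite zx => /iter_findex <-.
by rewrite -permX mem_porbit.
Qed.

Lemma card_porbit_block x : #|porbit block_perm x| = size (block x).
Proof. by rewrite (eq_card (porbit_block x)) (card_uniqP (block_uniq x)). Qed.

End BlockPermutation.

Section ExistsStandard.
Variables d l : nat.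
Hypothesis l_gt0 : (0 < l)%N.
Notation Box := {ffun 'I_d -> 'I_l}.

(** Cut the points into consecutive blocks of [e %/ l + 1] points, permute each block cyclically,
    and put the exponent [e %% l] at its largest point. *)
Lemma exists_standard (E : seq nat) : (\sum_(e <- E) (e %/ l).+1 = d)%N ->
  exists w (b : Box), standard w b /\
    perm_eq [seq cycle_exp w b i | i <- tops w] E.
Proof.
move=> Ed; pose sh := [seq (e %/ l).+1 | e <- E].
have shd : sumn sh = d by rewrite sumnE big_map.
pose L := reshape sh (enum 'I_d).
have Lf : flatten L = enum 'I_d by rewrite reshapeKr // size_enum_ord shd.
have Ls : shape L = sh by rewrite reshapeKl // size_enum_ord shd.
have Lu : uniq (flatten L) by rewrite Lf enum_uniq.
have Lall x : x \in flatten L by rewrite Lf mem_enum.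
have sL : size L = size E by rewrite -(size_map size) -[map _ _]/(shape L) Ls size_map.
have sB q : (q < size E)%N -> size (nth [::] L q) = (nth 0 E q %/ l).+1.
  move=> qE; have -> : size (nth [::] L q) = nth 0 (shape L) q.
    by rewrite (nth_map [::]) ?sL.
  by rewrite Ls (nth_map 0).
pose w := block_perm Lu Lall.
have bE x : (bidx L x < size E)%N by rewrite -sL bidx_size.
have c_lt x : (nth 0 E (bidx L x) %% l < l)%N by rewrite ltn_pmod.
have l1 : (l.-1 < l)%N by rewrite prednK.
pose b : Box := [ffun x => if is_top w x then Ordinal (c_lt x) else Ordinal l1].
exists w, b; split.
  by apply/forallP => x; rewrite ffunE; case: (is_top w x) => /=.
have expE x : is_top w x -> cycle_exp w b x = nth 0 E (bidx L x).
  move=> tx; rewrite /cycle_exp card_porbit_block ffunE tx /block sB //=.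
  by rewrite -divn_eq.
have -> : [seq cycle_exp w b i | i <- tops w] = [seq nth 0 E q | q <- [seq bidx L i | i <- tops w]].
  by rewrite -map_comp; apply/eq_in_map => x; rewrite mem_tops => /expE.
have blk x z : (bidx L x == bidx L z) = (x \in porbit w z).
  rewrite porbit_block; apply/eqP/idP => [E1|/(block_eq Lu Lall)].
    by rewrite /block -E1 mem_block.
  move=> E1; apply: (bidx_nth Lu); first by rewrite sL.
  by rewrite -/(block L z) -E1 mem_block.
rewrite -[X in perm_eq _ X](mkseq_nth 0 E); apply: perm_map; apply: uniq_perm; rewrite ?iota_uniq //.
  rewrite map_inj_in_uniq ?tops_uniq // => x z; rewrite !mem_tops => tx tz /eqP.
  by rewrite blk; apply: top_uniq.
move=> q; rewrite mem_iota /= add0n; apply/mapP/idP => [[x _ ->]|qE] //.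
have [x xq] : exists x, x \in nth [::] L q.
  have : (0 < size (nth [::] L q))%N by rewrite sB.
  by case: (nth _ _ _) => // x s _; exists x; rewrite mem_head.
exists (topof w x); first by rewrite mem_tops topof_top.
have <- : bidx L x = q by apply: (bidx_nth Lu) => //; rewrite sL.
by apply/eqP; rewrite blk porbit_sym topof_porbit.
Qed.

End ExistsStandard.

(** * Symmetric generators and the basis theorem *)

Section DrinfeldGenerators.
Variables (R : comNzRingType) (d : nat) (H : degAffHecke R d).
Implicit Types (i j k m : 'I_d) (w u : 'S_d).
Notation S := (dah_perm H).
Notation x i := (dah_poly H 'X_i).

Definition dah_y i : H := x i - \sum_(j < d | (j < i)%N) S (tperm i j).
Notation y := dah_y.

Lemma dah_tperm2 i j : S (tperm i j) * S (tperm i j) = 1.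
Proof. by rewrite -dah_permM tperm2 dah_perm1. Qed.

Lemma dah_tperm_conj (s : 'S_d) i j :
  S s * S (tperm i j) = S (tperm ((s^-1)%g i) ((s^-1)%g j)) * S s.
Proof. by rewrite -!dah_permM -tpermJ /conjg invgK mulgA mulgKV. Qed.

Lemma dah_adj_prev i k : k = i.+1 :> nat ->
  S (tperm i k) * x i = x k * S (tperm i k) - 1.
Proof.
move=> ik; set s := S _; have ss : s * s = 1 by apply: dah_tperm2.
apply/eqP; rewrite eq_sym subr_eq; apply/eqP.
have := dah_sx_next H ik; rewrite -/s => E.
have : s * (s * x k) * s = s * (x i * s + 1) * s by rewrite E.
by rewrite mulrA ss mul1r mulrDr mulr1 mulrDl -!mulrA ss mulr1.
Qed.

Lemma dah_adj_y i k j : k = i.+1 :> nat ->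
  S (tperm i k) * y j = y (tperm i k j) * S (tperm i k).
Proof.
move=> ik; set s := tperm i k; have ss : S s * S s = 1 by apply: dah_tperm2.
(* The summand of [y k] with index [i] squares to 1 and cancels the [+ 1] of [dah_sx_next]. *)
have key : S s * y k = y i * S s.
  rewrite /y mulrBr mulrBl dah_sx_next // (bigD1 i) /= ?ik //.
  rewrite mulrDr (tpermC k i) -/s ss opprD addrA addrK; congr (_ - _).
  rewrite mulr_sumr mulr_suml; apply: eq_big => m.
    by rewrite ltnS [RHS]ltn_neqAle andbC.
  move=> /andP[mk mi]; rewrite dah_tperm_conj tpermV /s tpermR tpermD // eq_sym //.
  by apply/eqP => km; rewrite km ik ltnn in mk.
have [->|jk] := eqVneq j k; first by rewrite /s tpermR.
have [->|ji] := eqVneq j i.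
  rewrite /s tpermL -/s -[y k]mul1r -ss -(mulrA (S s)) key.
  by rewrite -!mulrA ss mulr1.
rewrite tpermD 1?eq_sym // /y mulrBr mulrBl dah_sx_far //; congr (_ - _).
rewrite mulr_sumr mulr_suml (reindex_inj (@perm_inj _ s)) /=.
apply: eq_big => m; last first.
  by move=> _; rewrite dah_tperm_conj tpermV tpermK tpermD // eq_sym.
by rewrite /s; case: tpermP => // ->; move/eqP/val_eqP: ji jk => /= ?; rewrite -val_eqE /= ; lia.
Qed.

Lemma dah_perm_y w i : S w * y i = y ((w^-1)%g i) * S w.
Proof.
elim/adjacent_tperm_ind: w i => [i|u w IHu IHw i|j k jk i].
- by rewrite dah_perm1 mulr1 mul1r invg1 perm1.
- by rewrite dah_permM -mulrA IHw mulrA IHu -mulrA invMg permM.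
- by rewrite dah_adj_y // tpermV.
Qed.

Variable d_gt0 : (0 < d)%N.
Notation i0 := (Ordinal d_gt0).

Lemma dah_y0 : y i0 = x i0.
Proof. by rewrite /y big_pred0 ?subr0. Qed.

(** At the first index [y] equals [x] and commutes with every [x k], so only the transpositions in
    [y k] contribute to the commutator. Conjugation by a transposition carries this case to all
    pairs. *)
Lemma dah_yy i j : i != j ->
  y i * y j = y j * y i + (y j - y i) * S (tperm i j).
Proof.
have base k : k != i0 -> y i0 * y k = y k * y i0 + (y k - y i0) * S (tperm i0 k).
  move=> k0; have xC : x i0 * x k = x k * x i0 by rewrite -!rmorphM mulrC.
  set T := \sum_(m < d | (m < k)%N) S (tperm k m).
  have E : T * x i0 - x i0 * T = (y k - y i0) * S (tperm i0 k).
    rewrite mulr_suml mulr_sumr -sumrB (bigD1 i0) /=; last by rewrite lt0n.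
    rewrite big1 ?addr0 => [|m /andP[mk m0]].
      by rewrite -dah_y0 dah_perm_y tpermV tpermR (tpermC k) -mulrBl.
    by rewrite -dah_y0 dah_perm_y tpermV tpermD ?subrr // eq_sym.
  by rewrite -E dah_y0 [y k]/(x k - T) mulrBr mulrBl xC addrA subrK.
move=> ij; pose s := tperm i0 i; pose k := s j.
have sj : j = s k by rewrite /k tpermK.
have si : i = s i0 by rewrite /s tpermL.
have kn : k != i0 by rewrite -(inj_eq (@perm_inj _ s)) -sj -si eq_sym.
have Sy a : S s * y a = y (s a) * S s by rewrite dah_perm_y tpermV.
have Ss : S s * S s = 1 by apply: dah_tperm2.
have St : S s * S (tperm i0 k) = S (tperm i j) * S s.
  by rewrite dah_tperm_conj tpermV -sj -si.
have conj (a b : H) a' b' : S s * a = a' * S s -> S s * b = b' * S s ->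
    S s * (a * b) = a' * b' * S s.
  by move=> aE bE; rewrite mulrA aE -mulrA bE mulrA.
have E : S s * (y k - y i0) = (y j - y i) * S s.
  by rewrite [LHS]mulrBr [RHS]mulrBl !Sy -sj -si.
have E0 : S s * (y i0 * y k) = S s * (y k * y i0 + (y k - y i0) * S (tperm i0 k)).
  by rewrite base.
rewrite (conj _ _ _ _ (Sy i0) (Sy k)) [RHS]mulrDr (conj _ _ _ _ (Sy k) (Sy i0)) in E0.
rewrite (conj _ _ _ _ E St) -sj -si -mulrDl in E0.
by have /= := congr1 ( *%R^~ (S s)) E0; rewrite -!(mulrA _ (S s)) Ss !mulr1.
Qed.

End DrinfeldGenerators.

(** * Centrality of symmetric polynomials *)

Section SymmetricCentral.
Variables (R : comNzRingType) (d : nat) (H : degAffHecke R d).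
Implicit Types (i j k : 'I_d) (w u : 'S_d) (p q : {mpoly R[d]}).
Notation S := (dah_perm H).
Notation X := (dah_poly H).

(** [R] may have zero divisors, but the leading coefficient is 1 or -1, which is regular. *)
Lemma mpolyX_diff_lreg i k : i != k -> GRing.lreg ('X_k - 'X_i : {mpoly R[d]}).
Proof.
move=> ik; set p := 'X_k - 'X_i; apply: lreg_mleadc.
have pk : p@_U_(k) = 1 by rewrite mcoeffB !mcoeffXU eqxx (negbTE ik) subr0.
have p0 : p != 0.
  by apply/eqP => p0; move/eqP: pk; rewrite p0 mcoeff0 eq_sym oner_eq0.
have := mlead_supp p0; rewrite mcoeff_msupp /p mcoeffB !mcoeffX -/p.
have ne : (U_(i)%MM == U_(k)%MM :> 'X_{1..d}) = false.
  apply/eqP=> /mnmP /(_ i); rewrite !mnm1E eqxx eq_sym.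
  by rewrite (negbTE ik).
case: (U_(k)%MM =P _) => [<- _|_]; first by rewrite ne subr0; apply: lreg1.
case: (U_(i)%MM =P _) => [_ _|_]; last by rewrite subr0 eqxx.
by rewrite sub0r; apply/lregN/lreg1.
Qed.

(** The witness [q] is the divided difference of [p]. It extends from the variables to products by
    the twisted Leibniz rule [q1 * p2 + msym s p1 * q2]. *)
Lemma dah_adj_poly i k p : k = i.+1 :> nat -> exists q,
  S (tperm i k) * X p = X (msym (tperm i k) p) * S (tperm i k) + X q /\
  ('X_k - 'X_i) * q = p - msym (tperm i k) p.
Proof.
move=> ik; set s := tperm i k.
pose Q p := exists q, S s * X p = X (msym s p) * S s + X q /\
  ('X_k - 'X_i) * q = p - msym s p.
have QD p1 p2 : Q p1 -> Q p2 -> Q (p1 + p2).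
  move=> [q1 [E1 F1]] [q2 [E2 F2]]; exists (q1 + q2); split.
    by rewrite msymD !rmorphD /= mulrDr E1 E2 mulrDl addrACA.
  by rewrite msymD mulrDr F1 F2 opprD addrACA.
have QZ c p1 : Q p1 -> Q (c *: p1).
  move=> [q1 [E1 F1]]; exists (c *: q1); split.
    by rewrite msymZ !linearZ /= -scalerAr E1 scalerDr -scalerAl.
  by rewrite msymZ -scalerAr F1 scalerBr.
have QM p1 p2 : Q p1 -> Q p2 -> Q (p1 * p2).
  move=> [q1 [E1 F1]] [q2 [E2 F2]]; exists (q1 * p2 + msym s p1 * q2); split.
    rewrite msymM !rmorphD !rmorphM /= mulrA E1 mulrDl -mulrA E2 mulrDr !mulrA -addrA.
    by congr (_ + _); rewrite addrC.
  by rewrite msymM mulrDr mulrA F1 mulrCA F2 mulrBl mulrBr addrA subrK.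
have Q1 : Q 1 by exists 0; rewrite msym1 subrr mulr0 !rmorph1 rmorph0 addr0 mulr1 mul1r.
have symX j : msym s 'X_j = 'X_(s j) :> {mpoly R[d]}.
  rewrite msymX; congr 'X_[_]; apply/mnmP => m.
  by rewrite mnmE !mnm1E /s tpermV -(inj_eq (@perm_inj _ s)) tpermK.
have QX j : Q 'X_j.
  rewrite /Q symX; have [->|jk] := eqVneq j k.
    exists 1; rewrite /s tpermR mulr1; split=> //.
    by rewrite rmorph1 dah_sx_next.
  have [->|ji] := eqVneq j i.
    exists (-1); rewrite /s tpermL mulrN1 opprB; split=> //.
    by rewrite rmorphN1 dah_adj_prev.
  exists 0; rewrite /s tpermD 1?eq_sym // subrr mulr0 rmorph0 addr0.
  by rewrite dah_sx_far.
rewrite -/(Q p); elim/mpolyind: p => [|c m p _ _ Qp].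
  by rewrite -[0](scale0r 1); apply: QZ.
apply: QD => //; apply: QZ; rewrite mpolyXE_id.
elim/big_ind: _ => // j _; elim: (m j) => [|n IH]; first by rewrite expr0.
by rewrite exprS; apply: QM.
Qed.

Lemma dah_sym_perm p w : p \is symmetric -> S w * X p = X p * S w.
Proof.
move=> /issymP ps; elim/adjacent_tperm_ind: w => [|u w IHu IHw|i k ik].
- by rewrite dah_perm1 mulr1 mul1r.
- by rewrite dah_permM -mulrA IHw !mulrA IHu.
have [q [-> E]] := dah_adj_poly p ik.
have neq : i != k by rewrite -val_eqE /= ik neq_ltn ltnSn.
rewrite ps subrr in E *.
have -> : q = 0 by apply: (mpolyX_diff_lreg neq); rewrite E mulr0.
by rewrite rmorph0 addr0.
Qed.

Lemma dah_decomp (h : H) : exists p : {ffun 'S_d -> {mpoly R[d]}},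
  h = \sum_w X (p w) * S w.
Proof. by have [g _ gK] := dah_tensor H; exists (g h); rewrite gK. Qed.

Lemma dah_sym_central p (h : H) : p \is symmetric -> X p * h = h * X p.
Proof.
move=> ps; have [q ->] := dah_decomp h; rewrite mulr_sumr mulr_suml.
apply: eq_bigr => w _; rewrite -[RHS]mulrA dah_sym_perm // !mulrA; congr (_ * _).
by rewrite -!rmorphM mulrC.
Qed.

End SymmetricCentral.

(** * Linear spans and the degree filtration *)

Section LinearSpan.
Variables (R : comNzRingType) (A : algType R).
Implicit Types (B : A -> Prop) (a b c h : A).

(** The inductive form lets membership proofs go by induction, without families of coefficients. *)
Inductive lspan B : A -> Prop :=
| lspan0 : lspan B 0
| lspanS r b h : B b -> lspan B h -> lspan B (r *: b + h).

Lemma lspan_gen B b : B b -> lspan B b.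
Proof. by move=> Bb; rewrite -[b]addr0 -[b]scale1r; apply/lspanS/lspan0. Qed.

Lemma lspanD B h1 h2 : lspan B h1 -> lspan B h2 -> lspan B (h1 + h2).
Proof.
move=> S1 S2; elim: S1 => [|r b h Bb _ IH]; first by rewrite add0r.
by rewrite -addrA; apply: lspanS.
Qed.

Lemma lspanZ B r h : lspan B h -> lspan B (r *: h).
Proof.
elim=> [|r' b h' Bb _ IH]; first by rewrite scaler0; apply: lspan0.
by rewrite scalerDr scalerA; apply: lspanS.
Qed.

Lemma lspanN B h : lspan B h -> lspan B (- h).
Proof. by rewrite -scaleN1r; apply: lspanZ. Qed.

Lemma lspanB B h1 h2 : lspan B h1 -> lspan B h2 -> lspan B (h1 - h2).
Proof. by move=> S1 /lspanN; apply: lspanD. Qed.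

Lemma lspan_sum B (I : Type) (s : seq I) (P : pred I) (F : I -> A) :
  (forall i, P i -> lspan B (F i)) -> lspan B (\sum_(i <- s | P i) F i).
Proof. by move=> SF; elim/big_ind: _ => //; [apply: lspan0 | apply: lspanD]. Qed.

Lemma lspan_mul B B' a c h : (forall b, B b -> lspan B' (a * b * c)) ->
  lspan B h -> lspan B' (a * h * c).
Proof.
move=> BB'; elim=> [|r b h' Bb _ IH]; first by rewrite mulr0 mul0r; apply: lspan0.
rewrite mulrDr mulrDl; apply: lspanD IH.
by rewrite -scalerAr -scalerAl; apply/lspanZ/BB'.
Qed.

Lemma lspan_mull B B' a h : (forall b, B b -> lspan B' (a * b)) ->
  lspan B h -> lspan B' (a * h).
Proof.
move=> BB'; rewrite -[a * h]mulr1; apply: lspan_mul => b /BB'.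
by rewrite mulr1.
Qed.

Lemma lspan_mulr B B' c h : (forall b, B b -> lspan B' (b * c)) ->
  lspan B h -> lspan B' (h * c).
Proof.
move=> BB'; rewrite -[h * c]mul1r mulrA; apply: lspan_mul => b /BB'.
by rewrite mul1r.
Qed.

Lemma lspan_sub B B' h : (forall b, B b -> lspan B' b) -> lspan B h -> lspan B' h.
Proof.
by move=> BB'; elim=> [|r b h' /BB' Bb _ IH]; [apply: lspan0 | apply/lspanD/IH/lspanZ].
Qed.

End LinearSpan.

Section Filtration.
Variables (R : comNzRingType) (d : nat) (d_gt0 : (0 < d)%N) (H : degAffHecke R d).
Implicit Types (i j k : 'I_d) (w u : 'S_d) (p : {mpoly R[d]}) (m : 'X_{1..d}).
Implicit Types (n : nat) (h : H).
Notation S := (dah_perm H).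
Notation X := (dah_poly H).
Notation y := (dah_y H).
Notation i0 := (Ordinal d_gt0).

(** The strict bound matches [msize], which exceeds the degree by one, and makes [filt 0] zero. *)
Definition filt n := lspan (fun b : H =>
  exists m w, (mdeg m < n)%N /\ b = X 'X_[m] * S w).

Lemma filt_le n n' h : (n <= n')%N -> filt n h -> filt n' h.
Proof.
move=> nn'; apply: lspan_sub => _ [m [w [mn ->]]].
by apply: lspan_gen; exists m, w; rewrite (leq_trans mn).
Qed.

Lemma filt_poly p w n : (msize p <= n)%N -> filt n (X p * S w).
Proof.
move=> pn; rewrite {1}(mpolyE p) raddf_sum mulr_suml big_seq.
apply: lspan_sum => m mp; rewrite /= linearZ /= -scalerAl; apply/lspanZ/lspan_gen.
by exists m, w; split=> //; apply: leq_trans (msize_mdeg_lt mp) pn.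
Qed.

Lemma filt_ex h : exists n, filt n h.
Proof.
have [p ->] := dah_decomp h; exists (\max_w msize (p w)).
by apply: lspan_sum => w _; apply: filt_poly; apply: leq_bigmax.
Qed.

Lemma filt_X m n h : filt n h -> filt (mdeg m + n) (X 'X_[m] * h).
Proof.
apply: lspan_mull => _ [m' [w [mn ->]]]; apply: lspan_gen; exists (m + m')%MM, w.
by rewrite mdegD ltn_add2l mn mulrA -rmorphM -mpolyXD.
Qed.

Lemma filt_X1 i n h : filt n h -> filt n.+1 (X 'X_i * h).
Proof. by move=> /(filt_X U_(i)%MM); rewrite mdeg1. Qed.

Lemma filt_Sr u n h : filt n h -> filt n (h * S u).
Proof.
apply: lspan_mulr => _ [m [w [mn ->]]]; apply: lspan_gen; exists m, (w * u)%g.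
by rewrite -mulrA -dah_permM.
Qed.

Definition mword m : seq 'I_d := flatten [seq nseq (m i) i | i <- enum 'I_d].

Lemma mpolyX_mword m : 'X_[m] = \prod_(i <- mword m) 'X_i :> {mpoly R[d]}.
Proof.
rewrite mpolyXE_id /mword big_flatten big_map big_enum /=.
by apply: eq_bigr => i _; rewrite big_nseq iter_mulr_1.
Qed.

Lemma size_mword m : size (mword m) = mdeg m.
Proof. by rewrite -count_predT count_flatten_nseq mdegE. Qed.

Definition wmon (v : seq 'I_d) : 'X_{1..d} := (\sum_(i <- v) U_(i))%MM.

Lemma mpolyX_word v : \prod_(i <- v) 'X_i = 'X_[wmon v] :> {mpoly R[d]}.
Proof.
rewrite /wmon; elim: v => [|i v IH]; first by rewrite !big_nil mpolyX0.
by rewrite !big_cons IH mpolyXD.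
Qed.

Lemma mdeg_wmon v : mdeg (wmon v) = size v.
Proof.
rewrite /wmon; elim: v => [|i v IH]; first by rewrite big_nil mdeg0.
by rewrite big_cons mdegD mdeg1 IH.
Qed.

Lemma filt_Sl u n h : filt n h -> filt n (S u * h).
Proof.
elim/adjacent_tperm_ind: u h => [|u w IHu IHw|i k ik] h.
- by rewrite dah_perm1 mul1r.
- by move=> Fh; rewrite dah_permM -mulrA; apply/IHu/IHw.
apply: lspan_mull => _ [m [w [mn ->]]]; rewrite mulrA.
apply: filt_Sr; apply: filt_le mn _; rewrite mpolyX_mword -size_mword.
elim: (mword m) => [|j v IH].
  rewrite big_nil rmorph1 mulr1 -[S _]mul1r -(rmorph1 X).
  by apply: filt_poly; rewrite msize1.
rewrite big_cons rmorphM mulrA.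
have Fv : filt (size v).+1 (X (\prod_(i <- v) 'X_i)).
  rewrite -[X _]mulr1 -(dah_perm1 H); apply: filt_poly.
  by rewrite mpolyX_word msizeX mdeg_wmon.
have [->|jk] := eqVneq j k.
  rewrite dah_sx_next // mulrDl mul1r -mulrA; apply: lspanD.
    exact: filt_X1.
  exact: filt_le Fv.
have [->|ji] := eqVneq j i.
  rewrite dah_adj_prev // mulrBl mul1r -mulrA; apply: lspanB.
    exact: filt_X1.
  exact: filt_le Fv.
by rewrite dah_sx_far // -mulrA; apply: filt_X1.
Qed.

(** The difference of [y i] and [x i] is a sum of group elements, which do not raise the degree. *)
Lemma filt_yx i n h : filt n h -> filt n (y i * h - X 'X_i * h).
Proof.
move=> Fh; rewrite -mulrBl /dah_y addrC addrA addNr add0r mulNr mulr_suml.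
by apply/lspanN/lspan_sum => j _; apply: filt_Sl.
Qed.

Lemma filt_y i n h : filt n h -> filt n.+1 (y i * h).
Proof.
move=> Fh; rewrite -[_ * _](subrK (X 'X_i * h)); apply: lspanD (filt_X1 _ Fh).
by apply: filt_le (filt_yx _ Fh).
Qed.

Lemma filt_word (v : seq 'I_d) :
  filt (size v) (\prod_(i <- v) y i - X (\prod_(i <- v) 'X_i)).
Proof.
elim: v => [|i v IH]; first by rewrite !big_nil rmorph1 subrr; apply: lspan0.
rewrite !big_cons rmorphM -[_ - _](subrKA (y i * X (\prod_(j <- v) 'X_j))) -mulrBr.
apply: lspanD; first exact: filt_y.
apply: filt_yx; rewrite -[X _]mulr1 -(dah_perm1 H); apply: filt_poly.
by rewrite mpolyX_word msizeX mdeg_wmon.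
Qed.

End Filtration.

(** * Normal form for elements of the cyclotomic ideal *)

Section CyclotomicIdeal.
Variables (R : comNzRingType) (d : nat) (d_gt0 : (0 < d)%N) (H : degAffHecke R d).
Variables (l : nat) (f : {poly R}).
Hypotheses (f_monic : f \is monic) (f_deg : size f = l.+1).
Implicit Types (i j k : 'I_d) (w u : 'S_d) (p : {mpoly R[d]}) (m : 'X_{1..d}).
Implicit Types (n : nat) (h : H).
Notation S := (dah_perm H).
Notation X := (dah_poly H).
Notation y := (dah_y H).
Notation i0 := (Ordinal d_gt0).
Notation filt := (@filt R d H).

Definition cyc i : H := horner_alg (y i) f.
Notation g := cyc.

Lemma cycE i : g i = \sum_(k < l.+1) f`_k *: y i ^+ k.
Proof.
rewrite /cyc -{1}[f]coefK poly_def f_deg raddf_sum; apply: eq_bigr => k _.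
by rewrite /= linearZ /= rmorphXn /= horner_algX mulr_algl.
Qed.

Lemma cyc0 : horner_alg (X 'X_i0) f = g i0.
Proof. by rewrite /cyc dah_y0. Qed.

Lemma S_cyc w i : S w * g i = g ((w^-1)%g i) * S w.
Proof.
rewrite !cycE mulr_sumr mulr_suml; apply: eq_bigr => k _.
rewrite -scalerAr -scalerAl; congr (_ *: _).
elim: (k : nat) => [|n IH]; first by rewrite !expr0 mulr1 mul1r.
by rewrite !exprS mulrA dah_perm_y -mulrA IH mulrA.
Qed.

Lemma X_cyc0 p : X p * g i0 = g i0 * X p.
Proof.
rewrite cycE mulr_sumr mulr_suml; apply: eq_bigr => k _.
rewrite -scalerAr -scalerAl dah_y0 -rmorphXn -!rmorphM; congr (_ *: X _).
by rewrite mulrC.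
Qed.

Lemma filt_cyc i : filt l (g i - X 'X_i ^+ l).
Proof.
have ypow n : y i ^+ n = \prod_(j <- nseq n i) y j by rewrite big_nseq iter_mulr_1.
have xpow n : X 'X_i ^+ n = X (\prod_(j <- nseq n i) 'X_j).
  by rewrite big_nseq iter_mulr_1 rmorphXn.
have fl : f`_l = 1 by have := f_monic; rewrite monicE lead_coefE f_deg => /eqP.
rewrite cycE big_ord_recr /= fl scale1r -addrA; apply: lspanD.
  apply: lspan_sum => k _; apply: lspanZ.
  rewrite -[y i ^+ k](subrK (X 'X_i ^+ k)); apply: lspanD.
    rewrite ypow xpow.
    by apply: filt_le (filt_word _ _); rewrite size_nseq ltnW.
  rewrite xpow -[X _]mulr1 -(dah_perm1 H); apply: filt_poly.
  by rewrite mpolyX_word msizeX mdeg_wmon size_nseq.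
by rewrite ypow xpow; have := filt_word H (nseq l i); rewrite size_nseq.
Qed.

Definition gspan n := lspan (fun b : H =>
  exists m i w, (mdeg m < n)%N /\ b = X 'X_[m] * g i * S w).

(** The condition on [m] makes [i] the smallest index with exponent at least [l] in the leading
    monomial [x^m x_i^l]. *)
Definition gspan_restricted n := lspan (fun b : H =>
  exists m i w, [/\ (mdeg m < n)%N, forall j, (j < i)%N -> (m j < l)%N
    & b = X 'X_[m] * g i * S w]).

Lemma gspan_le n n' h : (n <= n')%N -> gspan n h -> gspan n' h.
Proof.
move=> nn'; apply: lspan_sub => _ [m [i [w [mn ->]]]].
by apply: lspan_gen; exists m, i, w; rewrite (leq_trans mn).
Qed.

Lemma gspan_restricted_le n n' h :
  (n <= n')%N -> gspan_restricted n h -> gspan_restricted n' h.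
Proof.
move=> nn'; apply: lspan_sub => _ [m [i [w [mn ml ->]]]].
by apply: lspan_gen; exists m, i, w; rewrite (leq_trans mn).
Qed.

Lemma gspan_X m n h : gspan n h -> gspan (mdeg m + n) (X 'X_[m] * h).
Proof.
apply: lspan_mull => _ [m' [i [w [mn ->]]]]; apply: lspan_gen; exists (m + m')%MM, i, w.
by rewrite mdegD ltn_add2l mn !mulrA -rmorphM -mpolyXD.
Qed.

Lemma gspan_Sr u n h : gspan n h -> gspan n (h * S u).
Proof.
apply: lspan_mulr => _ [m [i [w [mn ->]]]]; apply: lspan_gen; exists m, i, (w * u)%g.
by rewrite -mulrA -dah_permM.
Qed.

Lemma filt_gspan n h i w : filt n h -> gspan n (h * g i * S w).
Proof.
move=> Fh; rewrite -mulrA; apply: lspan_mulr Fh => _ [m [u [mn ->]]].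
rewrite mulrA -(mulrA _ (S u)) S_cyc !mulrA -mulrA -dah_permM.
by apply: lspan_gen; exists m, ((u^-1)%g i), (u * w)%g.
Qed.

Lemma filt_gspan1 n h i : filt n h -> gspan n (h * g i).
Proof. by move=> Fh; rewrite -[_ * _]mulr1 -(dah_perm1 H); apply: filt_gspan. Qed.

Lemma gspan_Sl u n h : gspan n h -> gspan n (S u * h).
Proof.
apply: lspan_mull => _ [m [i [w [mn ->]]]]; rewrite !mulrA; apply: filt_gspan.
apply: filt_le mn _; apply: filt_Sl; rewrite -[X _]mulr1 -(dah_perm1 H); apply: filt_poly.
by rewrite msizeX.
Qed.

(** At the first index [cyc] is a polynomial in one [x] and commutes with all of them, so the term
    [x_k^l] drops out of its commutator with [g k]; what remains of [g k] has degree below [l].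
    Conjugation gives the other pairs. *)
Lemma gspan_comm i j : gspan l (g i * g j - g j * g i).
Proof.
have base k : gspan l (g i0 * g k - g k * g i0).
  rewrite -[g k](subrK (X 'X_k ^+ l)) mulrDr mulrDl -rmorphXn X_cyc0 opprD addrACA subrr addr0.
  have : filt l (g k - X ('X_k ^+ l)) by rewrite rmorphXn; apply: filt_cyc.
  elim=> [|r b h [m [w [ml ->]]] _ IH].
    by rewrite mulr0 mul0r subrr; apply: lspan0.
  rewrite mulrDr mulrDl opprD addrACA; apply: lspanD IH.
  rewrite -scalerAr -scalerAl -scalerBr; apply: lspanZ; apply: lspanB.
    by rewrite mulrA -X_cyc0; apply: lspan_gen; exists m, i0, w.
  rewrite -mulrA S_cyc mulrA.
  by apply: lspan_gen; exists m, ((w^-1)%g i0), w.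
pose s := tperm i0 i; have := gspan_Sr s (gspan_Sl s (base (s j))).
have conj a c : S s * (g a * g c) * S s = g (s a) * g (s c).
  rewrite mulrA S_cyc -!mulrA (mulrA (S s)) S_cyc -!mulrA dah_tperm2 mulr1.
  by rewrite tpermV.
by rewrite mulrBr mulrBl !conj /s tpermK tpermL.
Qed.

(** The Koszul relation between [g i] and [g j]: replacing a factor by its leading term, or
    exchanging the factors, costs only terms of lower degree. *)
Lemma gspan_swap i j : gspan l (X 'X_j ^+ l * g i - X 'X_i ^+ l * g j).
Proof.
have -> : X 'X_j ^+ l * g i - X 'X_i ^+ l * g j =
    (g i - X 'X_i ^+ l) * g j - (g j - X 'X_j ^+ l) * g i + (g j * g i - g i * g j).
  rewrite !mulrBl; move: (g i * g j) (g j * g i) (_ * g j) (_ * g i) => a b c e.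
  by rewrite opprB [RHS]addrC [RHS]addrA (addrA (b - a)) subrK [RHS]addrC addrA subrK.
apply: lspanD (gspan_comm _ _); apply: lspanB; apply: filt_gspan1; apply: filt_cyc.
Qed.

(** A factor [x_j^l] with [j < i] is traded by [gspan_swap]. The main term keeps its degree and gets
    the smaller index [j]; the other terms have smaller degree. The nested induction follows these
    two measures. *)
Lemma gspan_normal n h : gspan n h -> gspan_restricted n h.
Proof.
elim: n {-2}n (leqnn n) h => [|N IHN] n nN h; apply: lspan_sub => _ [m [i [w [mn ->]]]].
  by move: mn; move: nN; rewrite leqn0 => /eqP ->.
elim: {i}(i : nat) {-2}i (leqnn i) m mn => [|I IHI] i iI m mn.
  by apply: lspan_gen; exists m, i, w; split=> // j; rewrite ltnNge (leq_trans iI).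
have [small|] := boolP [forall (j : 'I_d | (j < i)%N), (m j < l)%N].
  by apply: lspan_gen; exists m, i, w; split=> // j ji; apply: (forall_inP small).
rewrite negb_forall_in => /exists_inP[j ji]; rewrite -leqNgt => lm.
pose m' := (m - U_(j) *+ l)%MM.
have mE : m = (m' + U_(j) *+ l)%MM.
  apply/esym/submK/mnm_lepP => k; rewrite mulmnE mnm1E.
  by case: eqP => [<-|]; rewrite ?mul1n ?mul0n.
have dm : mdeg m = (mdeg m' + l)%N by rewrite {1}mE mdegD mdegMn mdeg1 mul1n.
have -> : X 'X_[m] * g i * S w =
    X 'X_[m'] * (X 'X_j ^+ l * g i - X 'X_i ^+ l * g j) * S w +
    X 'X_[m' + U_(i) *+ l] * g j * S w.
  rewrite {1}mE !mpolyXD -!mpolyXn !rmorphM !rmorphXn mulrBr mulrBl !mulrA.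
  by rewrite subrK.
apply: lspanD.
  apply: (@gspan_restricted_le (mdeg m)); first exact: ltnW.
  apply: IHN; first by rewrite -ltnS (leq_trans mn).
  by apply: gspan_Sr; rewrite dm; apply/gspan_X/gspan_swap.
by apply: IHI; [rewrite -ltnS (leq_trans ji) | rewrite mdegD mdegMn mdeg1 mul1n -dm].
Qed.

(** The generator commutes with the [x] part of the right factor, which can therefore be absorbed
    into the left factor. *)
Lemma ideal_gspan h : in_ideal_gen (horner_alg (X 'X_i0) f) h -> exists n, gspan n h.
Proof.
rewrite cyc0 => -[s ->]; elim: s => [|[a b] s [n IH]].
  by exists 0%N; rewrite big_nil; apply: lspan0.
suff [n' ab] : exists n', gspan n' (a * g i0 * b).
  exists (n + n')%N; rewrite big_cons; apply: lspanD.
    by apply: gspan_le ab; rewrite leq_addl.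
  by apply: gspan_le IH; rewrite leq_addr.
have [n1 b1] := filt_ex b; elim: b1 => [|r b' h' [m [w [_ ->]]] _ [n' IH']].
  by exists 0%N; rewrite mulr0; apply: lspan0.
have [n2 am] := filt_ex (a * X 'X_[m]); exists (n' + n2)%N.
rewrite mulrDr -scalerAr; apply: lspanD; last by apply: gspan_le IH'; rewrite leq_addr.
apply: lspanZ; rewrite mulrA -(mulrA a) -X_cyc0 mulrA.
by apply: gspan_le (filt_gspan _ _ am); rewrite leq_addl.
Qed.

End CyclotomicIdeal.

(** * Leading monomials of the ideal and linear independence *)

Section LeadingTerms.
Variables (R : comNzRingType) (d : nat) (d_gt0 : (0 < d)%N) (H : degAffHecke R d).
Variables (l : nat) (f : {poly R}).
Hypotheses (f_monic : f \is monic) (f_deg : size f = l.+1).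
Implicit Types (i j k : 'I_d) (w u : 'S_d) (p : {mpoly R[d]}) (m : 'X_{1..d}).
Implicit Types (n : nat) (h : H) (q : {ffun 'S_d -> {mpoly R[d]}}).
Notation S := (dah_perm H).
Notation X := (dah_poly H).
Notation y := (dah_y H).
Notation i0 := (Ordinal d_gt0).
Notation filt := (@filt R d H).
Notation g := (@cyc R d H f).

Definition pbw q : H := \sum_w X (q w) * S w.

Lemma pbw_inj : injective pbw.
Proof. exact: bij_inj (dah_tensor H). Qed.

Lemma pbwD q1 q2 : pbw [ffun w => q1 w + q2 w] = pbw q1 + pbw q2.
Proof.
rewrite -big_split; apply: eq_bigr => w _.
by rewrite ffunE rmorphD mulrDl.
Qed.

Lemma pbw0 : pbw [ffun=> 0] = 0.
Proof. by rewrite /pbw big1 // => w _; rewrite ffunE rmorph0 mul0r. Qed.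

Lemma pbw1 p w : pbw [ffun u => if u == w then p else 0] = X p * S w.
Proof.
rewrite /pbw (bigD1 w) //= ffunE eqxx big1 ?addr0 // => u /negbTE uw.
by rewrite ffunE uw rmorph0 mul0r.
Qed.

Lemma filt_coef n h : filt n h ->
  exists q, h = pbw q /\ forall w m, (n <= mdeg m)%N -> (q w)@_m = 0.
Proof.
elim=> [|r b h' [m [w [mn ->]]] _ [q [-> qn]]].
  by exists [ffun=> 0]; rewrite pbw0; split=> // w m _; rewrite ffunE mcoeff0.
exists [ffun u => [ffun u => if u == w then r *: 'X_[m] else 0] u + q u]; split.
  by rewrite pbwD pbw1 linearZ /= -scalerAl.
move=> u m' nm; rewrite !ffunE mcoeffD qn // addr0; case: eqP => _; rewrite ?mcoeff0 //.
rewrite mcoeffZ mcoeffX; case: eqP => [E|_]; last by rewrite mulr0.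
by move: nm; rewrite -E leqNgt mn.
Qed.

Lemma gspan_coef n h : gspan_restricted l f n h ->
  exists P : 'I_d -> 'S_d -> {mpoly R[d]},
  h = \sum_i \sum_w X (P i w) * g i * S w /\
  forall i w m, (P i w)@_m != 0 -> forall j, (j < i)%N -> (m j < l)%N.
Proof.
elim=> [|r b h' [m [i [w [mn ml ->]]]] _ [P [-> Pl]]].
  exists (fun _ _ => 0); split=> [|i w m]; last by rewrite mcoeff0 eqxx.
  by rewrite big1 // => i _; rewrite big1 // => w _; rewrite rmorph0 !mul0r.
exists (fun i' w' => (if (i' == i) && (w' == w) then r *: 'X_[m] else 0) + P i' w').
split.
  have -> : r *: (X 'X_[m] * g i * S w) = \sum_i' \sum_w'
      X (if (i' == i) && (w' == w) then r *: 'X_[m] else 0) * g i' * S w'.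
    rewrite (bigD1 i) //= (bigD1 w) //= !eqxx /= linearZ /= -!scalerAl.
    rewrite big1 ?addr0 => [|w' /negbTE ->]; last by rewrite rmorph0 !mul0r.
    rewrite big1 ?addr0 // => i' /negbTE ->.
    by rewrite big1 // => w' _; rewrite rmorph0 !mul0r.
  rewrite -big_split; apply: eq_bigr => i' _; rewrite -big_split; apply: eq_bigr => w' _.
  by rewrite rmorphD !mulrDl.
move=> i' w' m'; rewrite mcoeffD; have [/Pl//|] := boolP ((P i' w')@_m' != 0).
rewrite negbK => /eqP ->; rewrite addr0; case: ifP => [/andP[/eqP -> _]|]; last by rewrite mcoeff0 eqxx.
by rewrite mcoeffZ mcoeffX; case: (m =P m') => [<- _ //|_]; rewrite mulr0 eqxx.
Qed.

Lemma mcoeffMX_neq0 p m m' : (p * 'X_[m])@_m' != 0 ->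
  exists2 k, m' = (m + k)%MM & p@_k != 0.
Proof.
rewrite -mcoeff_msupp (perm_mem (msuppMX _ _)) => /mapP[k kp ->].
by exists k; rewrite // -mcoeff_msupp.
Qed.

(* The restriction on P makes the leading monomials x^b x_i^l distinct. *)
Lemma ideal_lead h : in_ideal_gen (horner_alg (X 'X_i0) f) h ->
  h = 0 \/ exists q w m, [/\ h = pbw q, (q w)@_m != 0, exists i, (l <= m i)%N
    & forall w' m', (q w')@_m' != 0 -> (mdeg m' <= mdeg m)%N].
Proof.
case/(ideal_gspan f_deg) => n /(gspan_normal d_gt0 f_monic f_deg) /gspan_coef[P [hE Pl]].
have [P0|] := boolP [forall i, [forall w, P i w == 0]].
  left; rewrite hE big1 // => i _; rewrite big1 // => w _.
  by rewrite (eqP (forallP (forallP P0 i) w)) rmorph0 !mul0r.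
rewrite negb_forall => /existsP[i1]; rewrite negb_forall => /existsP[w1 P1].
pose N := \max_(s : 'I_d * 'S_d) msize (P s.1 s.2).
have PN i w : (msize (P i w) <= N)%N by apply: (leq_bigmax (i, w)).
have [[i w] /= PiN] : {s : 'I_d * 'S_d | N = msize (P s.1 s.2)}.
  by apply: eq_bigmax; apply/card_gt0P; exists (i1, w1).
have Pi0 : P i w != 0.
  apply: contraNneq P1 => P0; rewrite -msize_poly_eq0 -leqn0.
  by rewrite (leq_trans (PN _ _)) // PiN P0 msize0.
set b := mlead (P i w).
have bN : (mdeg b).+1 = N by rewrite PiN mlead_deg.
(* Replacing every [g k] by [x_k^l] changes [h] only in degrees below [mdeg b + l]. *)
pose q0 := [ffun u => \sum_k P k u * 'X_[U_(k) *+ l]].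
right; have [r [rE r0]] : exists r, h - pbw q0 = pbw r /\
    forall u m, (mdeg b + l <= mdeg m)%N -> (r u)@_m = 0.
  have /filt_coef[r [rE r0]] : filt (mdeg b + l) (h - pbw q0); last by exists r.
  have -> : pbw q0 = \sum_k \sum_u X (P k u) * X 'X_k ^+ l * S u.
    rewrite exchange_big; apply: eq_bigr => u _; rewrite ffunE rmorph_sum mulr_suml.
    by apply: eq_bigr => k _; rewrite rmorphM -mpolyXn rmorphXn.
  rewrite hE -sumrB; apply: lspan_sum => k _; rewrite -sumrB; apply: lspan_sum => u _.
  rewrite -mulrBl -mulrBr; apply: filt_Sr.
  rewrite {1}(mpolyE (P k u)) raddf_sum mulr_suml big_seq; apply: lspan_sum => m mP.
  rewrite /= linearZ /= -scalerAl; apply: lspanZ.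
  apply: filt_le (filt_X _ (filt_cyc H f_monic f_deg k)).
  rewrite leq_add2r -ltnS bN (leq_trans _ (PN k u)) //.
  exact: msize_mdeg_lt.
pose m := (U_(i) *+ l + b)%MM.
have mE : mdeg m = (mdeg b + l)%N by rewrite mdegD mdegMn mdeg1 mul1n addnC.
have qE : h = pbw [ffun u => r u + q0 u] by rewrite pbwD -rE subrK.
have mi : m i = (l + b i)%N by rewrite mnmDE mulmnE mnm1E eqxx mul1n.
have mk k : k != i -> m k = b k.
  by rewrite eq_sym => /negbTE ki; rewrite mnmDE mulmnE mnm1E ki mul0n.
exists [ffun u => r u + q0 u], w, m; split=> //.
- rewrite ffunE mcoeffD r0 ?mE // add0r ffunE raddf_sum (bigD1 i) //= mcoeffMX.
  have Pb : (P i w)@_b != 0 by rewrite mleadc_eq0.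
  rewrite big1 ?addr0 // => k ki; apply/eqP/negPn/negP => /mcoeffMX_neq0[c mc Pc].
  have cE j : (m j = (k == j) * l + c j)%N by rewrite mc mnmDE mulmnE mnm1E.
  (* For [k < i] the exponent at [k] violates the restriction on [P i w]; for [k > i] the exponent
     at [i] violates the one on [P k w]. *)
  have [lt|lt|/ord_inj E] := ltngtP k i; last by rewrite E eqxx in ki.
    have := Pl _ _ _ Pb _ lt; rewrite -mk // cE eqxx mul1n; lia.
  by have := Pl _ _ _ Pc _ lt; have := cE i; rewrite mi (negbTE ki) mul0n; lia.
- by exists i; rewrite mi leq_addr.
move=> w' m'; rewrite ffunE mcoeffD mE.
have [le|lt _] := leqP (mdeg b + l) (mdeg m'); last exact: ltnW.
rewrite r0 // add0r ffunE raddf_sum /= => nz.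
have [k /mcoeffMX_neq0[c -> Pc]] : exists k, (P k w' * 'X_[U_(k) *+ l])@_m' != 0.
  apply/existsP; apply: contraNT nz; rewrite negb_exists => /forallP z.
  by rewrite big1 // => k _; apply/eqP/negPn/z.
rewrite mdegD mdegMn mdeg1 mul1n addnC leq_add2r -ltnS bN (leq_trans _ (PN k w')) //.
by apply: msize_mdeg_lt; rewrite mcoeff_msupp.
Qed.

Notation Box := {ffun 'I_d -> 'I_l}.

(** The top-degree part of a nonzero combination consists of monomials with all exponents below [l],
    whereas [ideal_lead] finds in it a monomial with an exponent at least [l]. *)
Lemma ideal_free (c : {ffun Box * 'S_d -> R}) :
  in_ideal_gen (horner_alg (X 'X_i0) f)
    (\sum_s c s *: ((\prod_(i <- box_word s.1) y i) * S s.2)) ->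
  forall s, c s = 0.
Proof.
set h := \sum_s _ => hJ s1; apply/eqP/negPn/negP => cs1.
pose s := [arg max_(s > s1 | c s != 0) size (box_word s.1)].
have [cs pmax] : c s != 0 /\ forall s', c s' != 0 ->
    (size (box_word s'.1) <= size (box_word s.1))%N.
  by rewrite /s; case: arg_maxnP.
set M := size (box_word s.1) in pmax.
pose q0 := [ffun u => \sum_(a : Box) c (a, u) *: 'X_[wmon (box_word a)]].
have wmonE (a : Box) j : wmon (box_word a) j = a j.
  rewrite /wmon mnm_sumE -(count_mem_box_word a) -sum1_count big_mkcond [RHS]big_mkcond /=.
  by apply: eq_bigr => i _; rewrite mnm1E; case: eqP.
have wmon_inj (a a' : Box) : (wmon (box_word a) == wmon (box_word a')) = (a == a').
  apply/eqP/eqP => [E|-> //]; apply/ffunP => j; apply: val_inj.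
  by rewrite /= -!wmonE E.
have [r [rE r0]] : exists r, h - pbw q0 = pbw r /\
    forall u m, (M <= mdeg m)%N -> (r u)@_m = 0.
  have /filt_coef[r [rE r0]] : filt M (h - pbw q0); last by exists r.
  have -> : pbw q0 = \sum_s c s *: (X (\prod_(i <- box_word s.1) 'X_i) * S s.2).
    rewrite [RHS](eq_bigr (fun s => c (s.1, s.2) *:
      (X (\prod_(i <- box_word s.1) 'X_i) * S s.2))) => [|[a u] _ //].
    rewrite -(pair_bigA _ (fun (a : Box) u => c (a, u) *: (X (\prod_(i <- box_word a) 'X_i) * S u))).
    rewrite [RHS]exchange_big; apply: eq_bigr => u _ /=; rewrite ffunE rmorph_sum mulr_suml.
    by apply: eq_bigr => a _; rewrite /= linearZ /= -scalerAl mpolyX_word.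
  rewrite -sumrB; apply: lspan_sum => s' _; rewrite -scalerBr -mulrBl.
  have [->|/pmax le] := eqVneq (c s') 0; first by rewrite scale0r; apply: lspan0.
  by apply/lspanZ/filt_Sr; apply: filt_le le _; apply: filt_word.
have qE : h = pbw [ffun u => r u + q0 u] by rewrite pbwD -rE subrK.
have q0E u m : (q0 u)@_m = \sum_(a : Box) c (a, u) * (wmon (box_word a) == m)%:R.
  by rewrite ffunE raddf_sum /=; apply: eq_bigr => a _; rewrite mcoeffZ mcoeffX.
have lead : (r s.2 + q0 s.2)@_(wmon (box_word s.1)) != 0.
  rewrite mcoeffD r0 ?mdeg_wmon // add0r q0E (bigD1 s.1) //= eqxx mulr1 big1 ?addr0.
    by rewrite -surjective_pairing.
  by move=> a ap; rewrite wmon_inj (negbTE ap) mulr0.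
have [h0|[q [w [m [qE' qm [i li] max_q]]]]] := ideal_lead hJ.
  case/eqP: lead; have := h0; rewrite qE -pbw0 => /pbw_inj /ffunP /(_ s.2).
  by rewrite !ffunE => ->; rewrite mcoeff0.
have E : q = [ffun u => r u + q0 u] by apply: pbw_inj; rewrite -qE'.
have Mm : (M <= mdeg m)%N.
  by have := max_q s.2 (wmon (box_word s.1)); rewrite E ffunE mdeg_wmon; apply.
move: qm; rewrite E ffunE mcoeffD r0 // add0r q0E => nz; case/negP: nz; apply/eqP.
apply: big1 => a _; case: eqP => [am|_]; last by rewrite mulr0.
by move: li; rewrite -am wmonE leqNgt ltn_ord.
Qed.

End LeadingTerms.

(** * The center of the cyclotomic quotient *)

Section Presentation.
Variables (R : comNzRingType) (d l : nat) (d_gt0 : (0 < d)%N) (l_gt0 : (0 < l)%N).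
Variables (f : {poly R}) (f_monic : f \is monic) (f_deg : size f = l.+1).
Variables (H : degAffHecke R d) (Hf : degCycHecke d_gt0 f H).
Notation S := (dah_perm H).
Notation X := (dah_poly H).
Notation y := (dah_y H).
Notation pi := (dch_proj Hf).
Notation i0 := (Ordinal d_gt0).

(** Every [cyc H f i] is a conjugate of the generator of the ideal by a transposition. *)
Lemma dch_ypow i : pi (y i) ^+ l = \sum_(k < l) (- f`_k) *: pi (y i) ^+ k.
Proof.
have g0 : pi (cyc H f i) = 0.
  have -> : cyc H f i = S (tperm i0 i) * cyc H f i0 * S (tperm i0 i).
    by rewrite (S_cyc H f_deg) tpermV tpermL -mulrA dah_tperm2 mulr1.
  rewrite !rmorphM /= [pi (cyc _ _ _)](_ : _ = 0) ?mulr0 ?mul0r //.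
  apply/dch_proj_ker; rewrite -cyc0; exists [:: (1, 1)].
  by rewrite big_seq1 /= mul1r mulr1.
have fl : f`_l = 1 by have := f_monic; rewrite monicE lead_coefE f_deg => /eqP.
move: g0; rewrite (cycE H f_deg) raddf_sum big_ord_recr /= fl scale1r rmorphXn => /eqP.
rewrite addr_eq0 eq_sym eqr_oppLR => /eqP ->; rewrite -sumrN; apply: eq_bigr => k _.
by rewrite linearZ /= rmorphXn scaleNr.
Qed.

Lemma dch_gen (h : Hf) : exists s : seq (R * (seq 'I_d * 'S_d)),
  h = \sum_(q <- s) q.1 *: ((\prod_(i <- q.2.1) pi (y i)) * pi (S q.2.2)).
Proof.
have [h' <-] := dch_proj_surj h.
pose span := lspan (fun b : H => exists v w, b = (\prod_(i <- v) y i) * S w).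
have span_y i h1 : span h1 -> span (y i * h1).
  apply: lspan_mull => _ [v [w ->]]; apply: lspan_gen; exists (i :: v), w.
  by rewrite big_cons mulrA.
have span_S u h1 : span h1 -> span (S u * h1).
  apply: lspan_mull => _ [v [w ->]]; apply: lspan_gen; exists (map (u^-1)%g v), (u * w)%g.
  rewrite dah_permM !mulrA; congr (_ * _); elim: v => [|i v IH].
    by rewrite !big_nil mulr1 mul1r.
  by rewrite /= !big_cons mulrA dah_perm_y -!mulrA IH.
have span_X i h1 : span h1 -> span (X 'X_i * h1).
  move=> sh; have -> : X 'X_i = y i + \sum_(j < d | (j < i)%N) S (tperm i j) by rewrite subrK.
  rewrite mulrDl mulr_suml; apply: lspanD; first exact: span_y.
  by apply: lspan_sum => j _; apply: span_S.
have sh : span h'.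
  have [n] := filt_ex h'; apply: lspan_sub => _ [m [w [_ ->]]].
  rewrite mpolyX_mword; elim: (mword m) => [|i v IH].
    by rewrite big_nil rmorph1 mul1r; apply: lspan_gen; exists [::], w; rewrite big_nil mul1r.
  by rewrite big_cons rmorphM -mulrA; apply: span_X.
elim: sh => [|r _ h1 [v [w ->]] _ [s sE]]; first by exists [::]; rewrite big_nil rmorph0.
exists ((r, (v, w)) :: s); rewrite big_cons /= -sE rmorphD /= linearZ /=.
by rewrite rmorphM rmorph_prod.
Qed.

Lemma dch_free (c : {ffun {ffun 'I_d -> 'I_l} * 'S_d -> R}) :
  \sum_p c p *: ((\prod_(i <- box_word p.1) pi (y i)) * pi (S p.2)) = 0 ->
  forall p, c p = 0.
Proof.
move=> c0; apply: (ideal_free (d_gt0 := d_gt0) (H := H) f_monic f_deg).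
apply/(dch_proj_ker Hf); rewrite -[RHS]c0 raddf_sum; apply: eq_bigr => p _.
by rewrite /= linearZ /= rmorphM rmorph_prod.
Qed.

(** Transparent, because elements of [Hf] are used below as elements of this presentation by
    conversion. *)
Definition dch_pres : dch_presentation R d l.
Proof.
refine (@DchPresentation R d l Hf (fun i => pi (y i)) (fun w => pi (S w))
  (fun k => - f`_k) _ _ _ _ dch_ypow dch_gen dch_free).
- by rewrite dah_perm1 rmorph1.
- by move=> u w; rewrite dah_permM rmorphM.
- by move=> w i; rewrite -!rmorphM dah_perm_y.
- by move=> i j ij; rewrite -!rmorphM -rmorphB -rmorphM -rmorphD (dah_yy _ d_gt0).
Defined.

Lemma dch_poly_Xw (m : 'X_{1..d}) : dch_poly Hf 'X_[m] = Xw dch_pres (mword m).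
Proof.
rewrite /dch_poly mpolyX_mword !rmorph_prod /Xw; apply: eq_bigr => i _.
rewrite /jmx /= -(raddf_sum pi) -rmorphD /dah_y.
by rewrite subrK.
Qed.

Lemma dch_poly_central (p : {mpoly R[d]}) : p \is symmetric -> in_center (dch_poly Hf p).
Proof.
move=> ps z; have [h <-] := dch_proj_surj z.
by rewrite /dch_poly -!rmorphM dah_sym_central.
Qed.

End Presentation.

(** * Monomial symmetric polynomials *)

Section MonomialSymmetric.
Variables (R : comNzRingType) (d : nat).
Implicit Types (mu : seq nat) (m : 'X_{1..d}).

Definition rearrangements mu : seq 'X_{1..d} :=
  undup [seq [multinom nth 0%N mu (w i) | i < d] | w : 'S_d].

Definition padded mu := mu ++ nseq (d - size mu) 0%N.

Lemma mem_rearrangements mu m : (size mu <= d)%N ->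
  (m \in rearrangements mu) = perm_eq [seq m i | i <- enum 'I_d] (padded mu).
Proof.
move=> mud; have padE : [seq nth 0%N mu (i : 'I_d) | i <- enum 'I_d] = padded mu.
  apply: (@eq_from_nth _ 0%N).
    by rewrite size_map size_enum_ord size_cat size_nseq subnKC.
  move=> i; rewrite size_map size_enum_ord => id.
  rewrite (nth_map (Ordinal id)) ?size_enum_ord // nth_enum_ord //.
  by rewrite nth_cat nth_nseq if_same; case: ltnP => // /(nth_default 0%N).
rewrite mem_undup -padE; apply/mapP/idP => [[w _ ->]|pm].
  have -> : [seq [multinom nth 0%N mu (w i) | i < d] i | i <- enum 'I_d] =
      [seq nth 0%N mu (i : 'I_d) | i <- map w (enum 'I_d)].
    by rewrite -[RHS]map_comp; apply: eq_map => i /=; rewrite mnmE.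
  apply/perm_map/uniq_perm; rewrite ?(map_inj_uniq (@perm_inj _ _)) ?enum_uniq //.
  move=> i; rewrite mem_enum; apply/mapP; exists ((w^-1)%g i); rewrite ?mem_enum //.
  by rewrite permKV.
have /tuple_permP[w wE] : perm_eq [tuple m i | i < d] [tuple nth 0%N mu i | i < d] by [].
exists w; rewrite ?mem_enum //; apply/mnmP => i; rewrite mnmE.
have := congr1 (fun s => nth 0%N s i) wE.
by rewrite -!tnth_nth !tnth_mktuple.
Qed.

Definition mperm m (s : 'S_d) : 'X_{1..d} := [multinom m (s i) | i < d].

Lemma monomial_sym_symmetric mu : (size mu <= d)%N -> monomial_sym R d mu \is symmetric.
Proof.
move=> mud; apply/issymP => s; rewrite /monomial_sym -/(rearrangements mu).
rewrite raddf_sum (eq_bigr (fun m => 'X_[mperm m (s^-1)%g])) => [|m _]; last exact: msymX.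
rewrite -(big_map (fun m => mperm m (s^-1)%g) predT (fun m => 'X_[m])) /=.
apply: perm_big.
have um : uniq (map (fun m : 'X_{1..d} => mperm m (s^-1)%g) (rearrangements mu)).
  by rewrite map_inj_uniq ?undup_uniq //; apply: mperm_inj.
apply: uniq_perm => //; first exact: undup_uniq.
(* An injective map of a duplicate-free list into itself permutes it. *)
apply: (uniq_min_size um _ _).2; last by rewrite size_map.
move=> _ /mapP[m mL ->]; move: mL; rewrite !mem_rearrangements //; apply: perm_trans.
have -> : [seq (mperm m (s^-1)%g) i | i <- enum 'I_d] = [seq m i | i <- map (s^-1)%g (enum 'I_d)].
  by rewrite -[RHS]map_comp; apply: eq_map => i; rewrite /= mnmE.
apply/perm_map/uniq_perm; rewrite ?(map_inj_uniq (@perm_inj _ _)) ?enum_uniq //.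
move=> i; rewrite mem_enum; apply/mapP; exists (s i); rewrite ?mem_enum //.
by rewrite permK.
Qed.

Lemma padded_pos mu : [seq e <- padded mu | (0 < e)%N] = [seq e <- mu | (0 < e)%N].
Proof. by rewrite /padded filter_cat filter_nseq cats0. Qed.

Lemma rearrangement_sum mu m : (size mu <= d)%N -> m \in rearrangements mu ->
  mdeg m = sumn mu.
Proof.
move=> mud; rewrite mem_rearrangements // => pm; rewrite mdegE.
transitivity (sumn [seq m i | i <- enum 'I_d]); first by rewrite sumnE big_map big_enum.
by rewrite (perm_sumn pm) sumn_cat sumn_nseq mul0n addn0.
Qed.

Lemma rearrangement_pos mu m : (size mu <= d)%N -> m \in rearrangements mu ->
  perm_eq [seq m i | i <- enum 'I_d & (0 < m i)%N] [seq e <- mu | (0 < e)%N].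
Proof.
move=> mud; rewrite mem_rearrangements // => pm.
by rewrite -padded_pos -(filter_map m (fun e => 0 < e)%N); apply: perm_filter.
Qed.

Lemma mem_mword m i : (i \in mword m) = (0 < m i)%N.
Proof.
rewrite -has_pred1 has_count count_flatten_nseq /=.
by rewrite big_pred1_eq.
Qed.

End MonomialSymmetric.

(** * Unitriangularity of the coefficients *)

Section Triangular.
Variables (R : comNzRingType) (d l : nat) (A : dch_presentation R d l).
Hypothesis l_gt0 : (0 < l)%N.
Notation Box := {ffun 'I_d -> 'I_l}.
Implicit Types (b : Box) (w u : 'S_d) (mu : seq nat) (la : multipartition l d).
Notation kap := (@kap R d l A).

Lemma sum_divn_pos mu : (\sum_(e <- mu) (e %/ l).+1 =
  \sum_(e <- mu | (0 < e)%N) (e %/ l).+1 + count (pred1 0%N) mu)%N.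
Proof.
rewrite (bigID (fun e => 0 < e)%N) /=; congr (_ + _)%N.
rewrite -sum1_count; apply: eq_big => e; first by rewrite -eqn0Ngt.
by rewrite -eqn0Ngt => /eqP ->; rewrite div0n.
Qed.

(** Zero exponents, which come from parts 1 of the first component, are invisible in a monomial.
    Each of them adds 1 to the sum, so the sum recovers their number. *)
Lemma perm_eq_pos mu mu' :
  (\sum_(e <- mu) (e %/ l).+1 = \sum_(e <- mu') (e %/ l).+1)%N ->
  perm_eq [seq e <- mu | (0 < e)%N] [seq e <- mu' | (0 < e)%N] -> perm_eq mu mu'.
Proof.
move=> sE pE; apply: filter_pos_perm => //.
move: sE; rewrite (sum_divn_pos mu) (sum_divn_pos mu') -(big_filter mu) -(big_filter mu') (perm_big _ pE) /= => /addnI cE.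
have split (s : seq nat) : size s = (size [seq e <- s | (0 < e)%N] + count (pred1 0%N) s)%N.
  rewrite size_filter -(count_predC (fun e => 0 < e)%N s); congr (_ + _)%N.
  by apply: eq_count => e /=; rewrite -eqn0Ngt.
by rewrite (split mu) (split mu') cE (perm_size pE).
Qed.

Lemma size_exponents mu : (\sum_(e <- mu) (e %/ l).+1 = d)%N -> (size mu <= d)%N.
Proof. by move=> <-; rewrite -sum1_size; apply: leq_sum. Qed.

Variables (b : Box) (w : 'S_d) (mu : seq nat).
Hypotheses (wb : standard w b) (mu_d : (\sum_(e <- mu) (e %/ l).+1 = d)%N).
Hypothesis w_mu : perm_eq [seq cycle_exp w b i | i <- tops w] mu.

Lemma standard_sumn : (size (box_word b) + reflen w = sumn mu)%N.
Proof.
rewrite standard_degree // -(perm_sumn w_mu) sumnE big_map big_filter big_enum_cond.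
by [].
Qed.

Lemma big_cycles_pos :
  perm_eq [seq cycle_exp w b i | i <- enum (big_cycles b w)] [seq e <- mu | (0 < e)%N].
Proof.
have := perm_filter (fun e => 0 < e)%N w_mu; rewrite filter_map => /(perm_trans _); apply.
apply/perm_map/uniq_perm; first exact: enum_uniq.
  by rewrite filter_uniq ?tops_uniq.
move=> i; rewrite mem_enum inE mem_filter mem_tops /=.
by rewrite andbC.
Qed.

(** Degrees are compared by [count_orbits], numbers of distinct letters by [kap_orbit_count]. When
    both agree the monomial is separated, and [separated_mult] leaves only one possibility for
    [m]. *)
Lemma kap_rearrangement mu' m : (\sum_(e <- mu') (e %/ l).+1 = d)%N ->
  m \in rearrangements d mu' -> (sumn mu' <= sumn mu)%N ->
  kap b w (Xw A (mword m)) != 0 ->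
  [/\ sumn mu' = sumn mu, (count (leq 1) mu <= count (leq 1) mu')%N &
    count (leq 1) mu = count (leq 1) mu' ->
    perm_eq mu mu' /\ forall i, m i = cycle_mult b w i].
Proof.
move=> mu'd mL le nz; have mu's := size_exponents mu'd.
have Xn : (size (mword m) <= size (box_word b) + reflen w)%N.
  by rewrite standard_sumn size_mword (rearrangement_sum mu's mL).
have [Xs cE] := count_orbits l_gt0 wb Xn nz.
have [le_card sep] := kap_orbit_count l_gt0 wb Xn nz.
have card_b : #|big_cycles b w| = count (leq 1) mu.
  by rewrite cardE -(size_map (cycle_exp w b)) (perm_size big_cycles_pos) size_filter.
have card_X : #|[set x in mword m]| = count (leq 1) mu'.
  rewrite -size_filter -(perm_size (rearrangement_pos mu's mL)) size_map cardE.
  apply: perm_size; apply: uniq_perm; [exact: enum_uniq | |move=> i].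
    by apply: filter_uniq; apply: enum_uniq.
  by rewrite mem_enum inE mem_filter mem_enum andbT mem_mword.
split.
- by move: Xs; rewrite standard_sumn size_mword (rearrangement_sum mu's mL).
- by rewrite -card_b -card_X.
rewrite -card_b -card_X => /sep[sX cX].
have mi i : count_mem i (mword m) = m i by rewrite count_flatten_nseq /= big_pred1_eq.
split; last by move=> i; rewrite -mi; apply: (separated_mult l_gt0 wb Xs sX nz).
apply: perm_eq_pos; first by rewrite mu_d mu'd.
apply: perm_trans (rearrangement_pos mu's mL); rewrite perm_sym.
apply: perm_trans big_cycles_pos.
have -> : [seq m i | i <- enum 'I_d & (0 < m i)%N] =
    [seq cycle_exp w b i | i <- [seq topof w i | i <- enum 'I_d & (0 < m i)%N]].
  rewrite -[RHS]map_comp; apply/eq_in_map => i; rewrite mem_filter -mem_mword => /andP[iX _] /=.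
  by rewrite -mi cX.
have inX i : i \in [seq i <- enum 'I_d | (0 < m i)%N] = (i \in mword m).
  by rewrite mem_filter mem_enum andbT mem_mword.
apply/perm_map/uniq_perm; last 1 first.
- move=> i; rewrite mem_enum -(topof_image l_gt0 wb Xn nz).
  apply/mapP/imsetP => -[x xX ->]; exists x => //; first by rewrite inE -inX.
  by rewrite inX; rewrite inE in xX.
- rewrite map_inj_in_uniq ?(filter_uniq _ (enum_uniq _)) // => i j.
  by rewrite !inX; apply: sX.
- exact: enum_uniq.
Qed.

(** The only contributing rearrangement puts each label at the top of its cycle, and
    [kap_cycle_word] computes its coefficient. *)
Lemma kap_diagonal :
  \sum_(m <- rearrangements d mu) kap b w (Xw A (mword m)) = 1.
Proof.
have mus := size_exponents mu_d.
pose m0 : 'X_{1..d} := [multinom cycle_mult b w i | i < d].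
have m0X : mword m0 = cycle_word b w.
  by rewrite /mword /cycle_word; congr flatten; apply: eq_map => i; rewrite mnmE.
have m0L : m0 \in rearrangements d mu.
  rewrite mem_rearrangements //; apply: filter_pos_perm.
    by rewrite size_map size_enum_ord size_cat size_nseq subnKC.
  rewrite padded_pos; apply: perm_trans big_cycles_pos.
  rewrite filter_map; have -> : [seq m0 i | i <- enum 'I_d & (0 < m0 i)%N] =
      [seq cycle_exp w b i | i <- [seq i <- enum 'I_d | (0 < m0 i)%N]].
    apply/eq_in_map => i; rewrite mem_filter mnmE /cycle_mult.
    by case: (is_top w i).
  apply/perm_map/uniq_perm; rewrite ?(filter_uniq _ (enum_uniq _)) //.
    exact: enum_uniq.
  move=> i; rewrite mem_filter mem_enum andbT mem_enum inE mnmE /cycle_mult.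
  by case: (is_top w i).
rewrite (bigD1_seq m0) ?undup_uniq //= m0X kap_cycle_word // big1_seq ?addr0 //.
move=> m /andP[mm0 mL]; apply/eqP/negPn/negP => nz; case/negP: mm0; apply/eqP.
have [_ _ /(_ erefl)[_ mE]] := kap_rearrangement mu_d mL (leqnn _) nz.
by apply/mnmP => i; rewrite mE mnmE.
Qed.

End Triangular.

(** * The basis of the center *)

Section CenterBasis.
Variables (R : comNzRingType) (d l : nat) (d_gt0 : (0 < d)%N) (l_gt0 : (0 < l)%N).
Variables (f : {poly R}) (f_monic : f \is monic) (f_deg : size f = l.+1).
Variables (H : degAffHecke R d) (Hf : degCycHecke d_gt0 f H).
Notation Box := {ffun 'I_d -> 'I_l}.
Notation A := (dch_pres f_monic f_deg Hf).
Implicit Types (la : multipartition l d).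

Definition standard_for la (p : 'S_d * Box) :=
  standard p.1 p.2 && perm_eq [seq cycle_exp p.1 p.2 i | i <- tops p.1] (mp_exponents la).

Lemma standard_forP la : exists p, standard_for la p.
Proof.
have [w [b [wb pE]]] := exists_standard l_gt0 (mp_exponents_sum l_gt0 la).
by exists (w, b); rewrite /standard_for wb.
Qed.

(** The choice is harmless: by [standard_conj] and [kap_conj], standard pairs with these labels have
    equal top-degree coefficients in a central element. *)
Definition std_rep la := xchoose (standard_forP la).

Definition center_coef la (z : Hf) : R := @kap R d l A (std_rep la).2 (std_rep la).1 z.

Lemma center_coef_is_linear la : scalar (center_coef la).
Proof. by move=> a h1 h2; rewrite /center_coef linearP. Qed.

HB.instance Definition _ la :=
  GRing.isLinear.Build R Hf R *%R (center_coef la) (center_coef_is_linear la).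

Definition center_elt la : Hf := dch_poly Hf (monomial_sym R d (mp_exponents la)).

Lemma center_eltE la :
  center_elt la = \sum_(m <- rearrangements d (mp_exponents la)) Xw A (mword m).
Proof.
rewrite /center_elt /dch_poly /monomial_sym !raddf_sum; apply: eq_bigr => m _.
by rewrite -dch_poly_Xw.
Qed.

Lemma size_mp_exponents la : (size (mp_exponents la) <= d)%N.
Proof. exact: size_exponents (mp_exponents_sum l_gt0 la). Qed.

Lemma center_elt_central la : in_center (center_elt la).
Proof. exact/dch_poly_central/monomial_sym_symmetric/size_mp_exponents. Qed.

Lemma center_coef_diag la : center_coef la (center_elt la) = 1.
Proof.
have /andP[wb pE] := xchooseP (standard_forP la).
rewrite /center_coef center_eltE linear_sum.
exact: (kap_diagonal A l_gt0 wb (mp_exponents_sum l_gt0 la) pE).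
Qed.

(* Lexicographic order on (total degree, number of nonzero exponents). *)
Definition mp_rank la : nat :=
  (sumn (mp_exponents la) * d.+1 + count (leq 1) (mp_exponents la))%N.

Lemma center_coef_triangular la la' :
  center_coef la (center_elt la') != 0 -> la = la' \/ (mp_rank la < mp_rank la')%N.
Proof.
have /andP[wb pE] := xchooseP (standard_forP la).
rewrite /center_coef center_eltE linear_sum => nz.
have [m mL mnz] : exists2 m, m \in rearrangements d (mp_exponents la') &
    @kap R d l A (std_rep la).2 (std_rep la).1 (Xw A (mword m)) != 0.
  apply/hasP; apply: contraNT nz; rewrite -all_predC => /allP z.
  by rewrite big_seq big1 // => m /z; rewrite /= negbK => /eqP.
have cnt la0 : (count (leq 1) (mp_exponents la0) <= d)%N.
  exact: leq_trans (count_size _ _) (size_mp_exponents _).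
have [lt|le] := ltnP (sumn (mp_exponents la)) (sumn (mp_exponents la')).
  right; rewrite /mp_rank; have := cnt la; nia.
have [sE cE eqE] := kap_rearrangement l_gt0 wb (mp_exponents_sum l_gt0 la) pE
  (mp_exponents_sum l_gt0 la') mL le mnz.
move: cE; rewrite leq_eqVlt => /orP[/eqP /eqE[/(mp_exponents_inj l_gt0) ? _]|lt]; first by left.
by right; rewrite /mp_rank sE ltn_add2l.
Qed.

(** A nonzero central element has a nonzero top-degree coefficient at a standard pair. The labels of
    this pair come from some [la], and conjugation carries the pair to [std_rep la]. *)
Lemma center_coef_inj (z : Hf) : in_center z ->
  (forall la, center_coef la z = 0) -> z = 0.
Proof.
move=> zC z0; apply/eqP/negPn/negP => nz.
have [a [u [ua az amax]]] := @central_standard R d l A l_gt0 z zC nz.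
pose E := [seq cycle_exp u a i | i <- tops u].
have Ed : (\sum_(e <- E) (e %/ l).+1 = d)%N.
  rewrite big_map big_filter big_enum_cond /=.
  rewrite -[RHS](card_ord d) -sum1_card (sum_tops u); apply: eq_bigr => i _.
  rewrite /cycle_exp divnMDl // divn_small // addn0 prednK ?sum1_card //.
  by rewrite lt0n card_porbit_neq0.
have [la laE] := exists_multipartition l_gt0 Ed.
have /andP[wb pE] := xchooseP (standard_forP la).
have [t [tw ta]] := standard_conj wb ua (perm_trans pE laE).
have sb : size (box_word (std_rep la).2) = size (box_word a).
  rewrite !size_box_word (reindex_inj (@perm_inj _ t^-1)) /=.
  by apply: eq_bigr => i _; rewrite ta permKV.
have := kap_conj (A := A) (z := z) zC amax u sb ta; rewrite tw -/(center_coef la z) z0 => /esym/eqP.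
by rewrite (negbTE az).
Qed.

(** At an index of highest rank among those with nonzero coefficient, triangularity leaves only the
    diagonal term. *)
Lemma center_elt_free (c : multipartition l d -> R) :
  \sum_la c la *: center_elt la = 0 -> forall la, c la = 0.
Proof.
move=> c0 la0; apply/eqP/negPn/negP => cla0.
pose la := [arg max_(la > la0 | c la != 0) mp_rank la].
have [cla la_max] : c la != 0 /\ forall la', c la' != 0 -> (mp_rank la' <= mp_rank la)%N.
  by rewrite /la; case: arg_maxnP.
have := congr1 (center_coef la) c0; rewrite linear0 linear_sum (bigD1 la) //= linearZ /=.
rewrite center_coef_diag mulr1 big1 ?addr0 => [E|la' la'P]; first by rewrite E eqxx in cla.
rewrite linearZ /=; have [->|/la_max le] := eqVneq (c la') 0; first by rewrite mul0r.
have [->|/center_coef_triangular[E|lt]] := eqVneq (center_coef la (center_elt la')) 0.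
- by rewrite mulr0.
- by rewrite E eqxx in la'P.
- by rewrite ltnNge le in lt.
Qed.

Lemma in_centerB (z1 z2 : Hf) : in_center z1 -> in_center z2 -> in_center (z1 - z2).
Proof. by move=> c1 c2 h; rewrite mulrBl mulrBr c1 c2. Qed.

Lemma in_center_sum (c : multipartition l d -> R) :
  in_center (\sum_la c la *: center_elt la).
Proof.
move=> h; rewrite mulr_suml mulr_sumr; apply: eq_bigr => la _.
by rewrite -scalerAl -scalerAr center_elt_central.
Qed.

Lemma center_elt_span (z : Hf) : in_center z ->
  exists c : multipartition l d -> R, z = \sum_la c la *: center_elt la.
Proof.
move=> zC; pose N := (\max_la mp_rank la).+1.
(* Coefficients are cleared from the highest rank downwards, starting above all ranks. Apart from
   its own coefficient, a basis element affects only coefficients of smaller rank, so those already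
   cleared stay zero. *)
have step n : exists c : multipartition l d -> R, forall la, (N - n <= mp_rank la)%N ->
    center_coef la (z - \sum_la c la *: center_elt la) = 0.
  elim: n => [|n [c cE]].
    exists (fun=> 0) => la; rewrite subn0 /N ltnNge.
    by rewrite (leq_bigmax (F := mp_rank)).
  pose z' := z - \sum_la c la *: center_elt la.
  pose c' la := if mp_rank la == (N - n.+1)%N then center_coef la z' else 0.
  exists (fun la => c la + c' la) => la rla.
  have -> : z - \sum_la (c la + c' la) *: center_elt la =
      z' - \sum_la c' la *: center_elt la.
    rewrite /z' -addrA -opprD -big_split /=; congr (_ - _); apply: eq_bigr => la' _.
    by rewrite scalerDl.
  rewrite linearB linear_sum /= (bigD1 la) //= linearZ /= center_coef_diag mulr1.
  rewrite big1 ?addr0 => [|la' la'P].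
    rewrite /c'; case: eqP => [_|ne]; first by rewrite subrr.
    by rewrite subr0; apply: cE; lia.
  rewrite linearZ /= /c'; case: eqP => [r'|_]; last by rewrite mul0r.
  have [->|/center_coef_triangular[E|lt]] := eqVneq (center_coef la (center_elt la')) 0.
  - by rewrite mulr0.
  - by rewrite E eqxx in la'P.
  - by move: lt; rewrite r' ltnNge rla.
have [c cE] := step N; exists c; apply/eqP; rewrite -subr_eq0; apply/eqP.
apply: center_coef_inj; first exact: in_centerB zC (in_center_sum c).
by move=> la; apply: cE; rewrite subnn.
Qed.

End CenterBasis.

Theorem theorem1 (R : comNzRingType) (d l : nat)
    (d_gt0 : (0 < d)%N) (l_gt0 : (0 < l)%N)
    (f : {poly R}) (f_monic : f \is monic) (f_deg : size f = l.+1)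
    (H : degAffHecke R d) (Hf : degCycHecke d_gt0 f H) :
  (forall z : Hf, in_center z <->
     exists2 p : {mpoly R[d]}, p \is symmetric & z = dch_poly Hf p) /\
  is_basis_of (@in_center Hf)
    (fun la : multipartition l d =>
       dch_poly Hf (monomial_sym R d (mp_exponents la))).
Proof.
split=> [z|]; split.
- case/(center_elt_span l_gt0 f_monic f_deg) => c ->.
  exists (\sum_la c la *: monomial_sym R d (mp_exponents la)).
    apply: rpred_sum => la _; apply: rpredZ.
    exact/monomial_sym_symmetric/size_mp_exponents.
  rewrite /dch_poly !raddf_sum; apply: eq_bigr => la _.
  by rewrite /= !linearZ.
- by case=> p ps ->; apply: dch_poly_central.
- move=> v; split=> [/(center_elt_span l_gt0 f_monic f_deg)//|[c ->]].
  exact: in_center_sum.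
- exact: center_elt_free.
Qed.
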